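(* Let $V$ be a set of $n$ distinct positive integers. Then $$\mathrm{ML}(V)\geqslant \frac{1}{2n}+\frac{\dim_2(V)^2}{n^{3+o(1)}},$$ where $o(1)$ denotes a quantity tending to $0$ as $n\to\infty$, uniformly over all such $V$. Explicitly: for every $\varepsilon>0$ there exists $n_0=n_0(\varepsilon)$ such that for all $n\geqslant n_0$ and every set $V$ of $n$ distinct positive integers, $\mathrm{ML}(V)\geqslant \frac{1}{2n}+\frac{\dim_2(V)^2}{n^{3+\varepsilon}}$.
   Context: Let $\mathbf{T}=\mathbf{R}/\mathbf{Z}$ and let $\lVert x\rVert_{\mathbf{T}}$ denote the distance from $x$ to the nearest integer. For a finite nonempty set $V$ of positive integers, $\mathrm{ML}(V):=\max_{t\in\mathbf{T}}\min_{v\in V}\lVert tv\rVert_{\mathbf{T}}$. A set $D\subseteq\mathbf{Z}$ is $2$-dissociated if whenever $\sum_{d\in D}\varepsilon_d d=0$ for some $\varepsilon_d\in\{-2,-1,0,1,2\}$, then all $\varepsilon_d=0$. The additive $2$-dimension $\dim_2(V)$ of a finite set $V\subset\mathbf{Z}$ is the size of the largest $2$-dissociated subset of $V$. *)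

(* Defs.v *)
From HB Require Import structures.
From mathcomp Require Import all_boot all_order all_algebra finmap.
From mathcomp Require Import all_classical all_reals all_analysis.
From mathcomp Require Import ring lra.

Set Implicit Arguments.
Unset Strict Implicit.
Unset Printing Implicit Defensive.

Import Order.TTheory GRing.Theory Num.Theory numFieldNormedType.Exports.

Local Open Scope fset_scope.
Local Open Scope classical_set_scope.
Local Open Scope ring_scope.

Definition dist_int (R : realType) (x : R) : R :=
  inf [set `|x - m%:~R| | m in [set: int]].

Definition min_dist (R : realType) (V : {fset int}) (t : R) : R :=
  inf [set dist_int (t * v%:~R) | v in [set` V]].

(* A point of R/Z is given by any real representative t: for integers v,
   dist_int (t * v) only depends on t modulo 1 (min_dist_periodic). For V
   nonempty, the inf in min_dist and the sup below are attained
   (min_dist_min and ML_max), so they are a minimum and a maximum. *)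
Definition ML (R : realType) (V : {fset int}) : R :=
  sup [set min_dist V t | t in [set: R]].

Definition dissociated2 (D : {fset int}) : Prop :=
  forall e : int -> int,
    (forall d, d \in D -> e d \in [:: -2; -1; 0; 1; 2]) ->
    \sum_(d <- D) e d * d = 0 ->
    forall d, d \in D -> e d = 0.

Definition dim2 (V : {fset int}) : nat :=
  \max_(D <- fpowerset V | `[< dissociated2 D >]) #|` D|.

Lemma dist_int_le (R : realType) (x : R) (m : int) :
  dist_int x <= `|x - m%:~R|.
Proof.
apply: ge_inf; last by exists m.
by exists 0 => _ [k _ <-].
Qed.

Lemma le_dist_int (R : realType) (x a : R) :
  (forall m : int, a <= `|x - m%:~R|) -> a <= dist_int x.
Proof.
move=> h; apply: lb_le_inf; first by exists `|x - 0%:~R|; exists 0.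
by move=> _ [k _ <-].
Qed.

Lemma dist_int_lip (R : realType) (x y : R) :
  dist_int x <= dist_int y + `|x - y|.
Proof.
rewrite -lerBlDr; apply: le_dist_int => m; rewrite lerBlDr.
apply: le_trans (dist_int_le _ m) _; rewrite [leRHS]addrC.
exact: ler_distD.
Qed.

Lemma dist_int_periodic (R : realType) (x : R) (k : int) :
  dist_int (x + k%:~R) = dist_int x.
Proof.
apply/eqP; rewrite eq_le; apply/andP; split; apply: le_dist_int => m.
- apply: le_trans (dist_int_le _ (m + k)) _.
  by have -> : x + k%:~R - (m + k)%:~R = x - m%:~R :> R by rewrite intrD; ring.
- apply: le_trans (dist_int_le _ (m - k)) _.
  by have -> : x - (m - k)%:~R = x + k%:~R - m%:~R :> R by rewrite intrB; ring.
Qed.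

Lemma min_dist_le (R : realType) (V : {fset int}) (t : R) (v : int) :
  v \in V -> min_dist V t <= dist_int (t * v%:~R).
Proof.
move=> vV; apply: ge_inf; last by exists v.
by exists 0 => _ [k _ <-]; exact: le_dist_int.
Qed.

Lemma min_dist_min (R : realType) (V : {fset int}) (t : R) : V != fset0 ->
  exists2 v, v \in V & min_dist V t = dist_int (t * v%:~R).
Proof.
case/fset0Pn => v0 v0V.
pose f (v : V) : R := dist_int (t * (val v)%:~R).
case: (arg_minP f (i0 := [` v0V]) (P := xpredT)) => // v _ vmin.
exists (val v); first exact: valP.
apply/eqP; rewrite eq_le min_dist_le ?valP //=.
apply: lb_le_inf; first by exists (dist_int (t * v0%:~R)); exists v0.
by move=> _ [w wV <-]; exact: (vmin [` wV]).
Qed.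

Lemma min_dist_periodic (R : realType) (V : {fset int}) (t : R) (k : int) :
  min_dist V (t + k%:~R) = min_dist V t.
Proof.
by congr inf; apply: eq_imagel => v _; rewrite mulrDl -intrM dist_int_periodic.
Qed.

Lemma min_dist_lip (R : realType) (V : {fset int}) : V != fset0 ->
  exists2 L : R, 0 < L & forall s t : R,
    min_dist V s <= min_dist V t + L * `|s - t|.
Proof.
move=> V0; exists (1 + \sum_(v <- V) `|v%:~R : R|).
  by rewrite ltr_pwDl // sumr_ge0.
move=> s t; have [v vV ->] := min_dist_min t V0.
apply: le_trans (min_dist_le s vV) _.
apply: le_trans (dist_int_lip _ (t * v%:~R)) _.
rewrite lerD2l -mulrBl normrM mulrC ler_wpM2r //.
rewrite (big_fsetD1 v) //= addrCA lerDl addr_ge0 // sumr_ge0 //.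
Qed.

Lemma min_dist_continuous (R : realType) (V : {fset int}) : V != fset0 ->
  continuous (@min_dist R V).
Proof.
case/(@min_dist_lip R) => L L0 lip t; apply/cvgrPdist_lt => e e0.
have eL : 0 < e / L by rewrite divr_gt0.
near=> s.
have st : `|t - s| < e / L.
  by near: s; apply: (nbhsx_ballx t (e / L) eL).
have {}st : L * `|t - s| < e by rewrite mulrC -ltr_pdivlMr.
have h1 := lip t s; have h2 := lip s t; rewrite distrC in h2.
by rewrite ltr_norml; apply/andP; split; lra.
Unshelve. all: by end_near. Qed.

Lemma ML_max (R : realType) (V : {fset int}) : V != fset0 ->
  exists2 t : R, min_dist V t = ML R V & forall s : R, min_dist V s <= ML R V.
Proof.
move=> V0; have [] := @EVT_max R (min_dist V) 0 1 ler01.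
  by apply: continuous_subspaceT; exact: min_dist_continuous.
move=> t _ tmax.
have h s : min_dist V s <= min_dist V t.
  have -> : s = (s - (Num.floor s)%:~R) + (Num.floor s)%:~R by rewrite subrK.
  rewrite min_dist_periodic; apply: tmax.
  by rewrite in_itv /= subr_ge0 floor_le lerBlDl -intrD1 ltW ?floorD1_gt.
have -> : ML R V = min_dist V t; last by exists t.
apply/eqP; rewrite eq_le; apply/andP; split.
  by apply: ge_sup; [exists (min_dist V 0); exists 0 | move=> _ [s _ <-]].
by apply: ub_le_sup; [exists (min_dist V t) => _ [s _ <-] | exists t].
Qed.

(* Main.v *)
Require Import Defs.
From HB Require Import structures.
From mathcomp Require Import all_boot all_order all_algebra.
From mathcomp Require Import boolp.
From mathcomp Require Import zify ring lra.

Set Implicit Arguments.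
Unset Strict Implicit.
Unset Printing Implicit Defensive.

Import Order.TTheory GRing.Theory Num.Theory.

(* Suppose that each t has some v in V with ||t v|| <= delta = 1/(2n) + k. Let G be
   a nonnegative even trigonometric polynomial of degree polynomial in n, almost
   majorizing the indicator function of ||y|| <= delta, of mean gamma close to
   2 delta. Then F(t) = sum_v G(v t) is at least about 1 for every t, while its
   mean is n gamma, about 1 + 2 n k. So the integral of (F - 1) P against any
   trigonometric polynomial P >= 0 of mean 1 is nonnegative up to a small error,
   and a P whose other frequencies correlate negatively with F bounds k from below.

   P is a Riesz product, of factors 1 - a cos(2 pi l e t) for e in E. Here E is a
   subset of V, dissociated at a level of order log n, such that the Fourier
   coefficients of F at l e are at least gamma/8, and such that |E| is at least
   dim_2(V) n^(-o(1)). The terms of order at least two of the Riesz product are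
   harmless because few sign combinations of l E are small multiples of a given v.

   To find E, start from a 2-dissociated D. For most d in D, a suitable prime l of
   size about n creates no accidental divisibility near d, so that for w = d / K
   in V the coefficient of F at l w only involves the divisors of w in V. Either
   this coefficient is large for an l of some scale, or w has many divisors v in V
   with w / v small. The second alternative cannot recur a bounded number of
   times, since the number of divisors of an integer K <= n^O(1) is n^o(1). So d
   has such a w with a large coefficient, and these w span many of the d. *)

(** * Divisors and primes *)

(** The exponent 3 comes from optimizing the Riesz product. With [N = |E|], its linear terms gain
    about [a * N / n] and its higher terms cost about [a^2], both up to [n^(o(1))]. Taking [a] near
    [N / n] gains [N^2 / n^2] on the mean of [F], hence [N^2 / n^3] on [delta]. This is done only
    when [dim_2(V)^2] is at least [2^q], the power of 2 just above [n]. Below that, the test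
    polynomial [1 - cos(2 pi x t)] with [x = min V] already gains order [1 / n] on the mean, more
    than is required.

    The role of the scales of [l] is to move a cut-off. At [l * x w], with [l] creating no
    accidental divisibility, a divisor with quotient [t] contributes the coefficient of [G] at
    [l * t]. This is at least [gamma / 4] for [l * t] up to order [n], then it may oscillate with
    size up to [1 / (l * t)]. As [l] varies, the cut-off in [t] varies, and at some scale the
    positive part wins unless the number of divisors keeps growing with the cut-off. *)

Lemma size_divisors n : size (divisors n) = \prod_(f <- prime_decomp n) f.2.+1.
Proof.
rewrite /divisors; elim: (prime_decomp n) => [|[p e] s IH] /=.
  by rewrite big_nil.
rewrite big_cons /= -IH; set d := foldr _ _ _.
suff H k (l : seq nat) : size (iter k (fun l : seq nat => merge leq [seq NatTrec.mul p i | i <- l] d) l)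
    = size l + k * size d by rewrite H mulSn.
elim: k => [|k IHk] /=; first by rewrite mul0n addn0.
by rewrite size_merge size_cat size_map IHk mulSnr addnA.
Qed.

(** With [t = e %/ k], [e.+1 <= k * t.+1] and [t.+1 <= 2 ^ t]. *)
Lemma succ_exp_le k e : 0 < k -> e.+1 ^ k <= k ^ k * 2 ^ e.
Proof.
move=> k0; rewrite {2}(divn_eq e k) expnD expnM.
have h : e.+1 <= k * (e %/ k).+1.
  by rewrite mulnC; have := ltn_ceil e k0.
apply: leq_trans (_ : (k * (e %/ k).+1) ^ k <= _); first by rewrite leq_exp2r.
rewrite expnMn leq_mul2l; apply/orP; right.
apply: leq_trans (leq_pmulr _ _); last by rewrite expn_gt0.
by rewrite leq_exp2r // ltn_expl.
Qed.

(** One prime at a time: a factor [e.+1 ^ k] is at most [p ^ e] when [2 ^ k <= p], and each of the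
    at most [2 ^ k] smaller primes costs a further [k ^ k]. As [k] is free, this is the bound
    [n^(o(1))] for the number of divisors. *)
Lemma divisor_bound k n : 0 < k -> 0 < n ->
  size (divisors n) ^ k <= (k ^ k) ^ (2 ^ k) * n.
Proof.
move=> k0 n0; rewrite size_divisors {2}(prod_prime_decomp n0).
have kk : 0 < k ^ k by rewrite expn_gt0 k0.
have : all (fun f => prime f.1) (prime_decomp n) /\ uniq (map fst (prime_decomp n)).
  split; last by have := primes_uniq n; rewrite /primes /unzip1.
  by apply/allP => -[p e] /mem_prime_decomp[].
pose c (s : seq (nat * nat)) := count (fun f => f.1 < 2 ^ k) s.
move: (prime_decomp n) => s [sp su].
have cs : c s <= 2 ^ k.
  rewrite /c -(count_map fst (fun p => p < 2 ^ k)) -size_filter.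
  rewrite -[leqRHS](size_iota 0); apply: uniq_leq_size; first exact: filter_uniq.
  by move=> p; rewrite mem_filter mem_iota add0n => /andP[].
apply: leq_trans (_ : (k ^ k) ^ c s * \prod_(f <- s) f.1 ^ f.2 <= _); last first.
  by rewrite leq_mul2r leq_pexp2l // orbT.
elim: s sp {su cs} => [|[p e] s IH] /=.
  by rewrite !big_nil exp1n.
case/andP=> pp /IH {}IH; rewrite !big_cons /= expnMn.
have: e.+1 ^ k <= (k ^ k) ^ (p < 2 ^ k) * p ^ e.
  case: ltnP => h; rewrite ?expn1 ?expn0.
    apply: leq_trans (succ_exp_le e k0) _.
    by rewrite leq_mul2l; apply/orP; right; case: (e) => // e'; rewrite leq_exp2r // prime_gt1.
  rewrite mul1n; apply: leq_trans (_ : (2 ^ k) ^ e <= _).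
    by rewrite -expnM mulnC expnM leq_exp2r // ltn_expl.
  by case: (e) => // e'; rewrite leq_exp2r.
move/leq_mul/(_ IH)/leq_trans; apply.
by rewrite mulnACA -expnD.
Qed.

Lemma prime_dvd_fact p m : prime p -> p %| m`! -> p <= m.
Proof.
move=> pp; elim: m => [|m IH]; first by rewrite fact0 Euclid_dvd1.
by rewrite factS Euclid_dvdM // => /orP[/dvdn_leq->//|/IH]; exact: leqW.
Qed.

Lemma prod_primes_dvd (s : seq nat) m : uniq s -> all prime s ->
  (forall p, p \in s -> p %| m) -> \prod_(p <- s) p %| m.
Proof.
elim: s => [|p s IH] /=; first by rewrite big_nil dvd1n.
case/andP=> ps us /andP[pp ap] h; rewrite big_cons Gauss_dvd.
  apply/andP; split; first by apply: h; rewrite inE eqxx.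
  by apply: IH => // r rs; apply: h; rewrite inE rs orbT.
rewrite big_seq; elim/big_ind: _ => [|a b ha hb|r rs]; rewrite ?coprimen1 //.
  by rewrite coprimeMr ha hb.
rewrite prime_coprime // dvdn_prime2 //; last exact: (allP ap).
by apply: contraNN ps => /eqP->.
Qed.

(** * Chebyshev's lower bound for the number of primes in a range *)

Definition primes_in a b := [seq p <- index_iota a.+1 b.+1 | prime p].

Lemma mem_primes_in a b p : (p \in primes_in a b) = [&& prime p, a < p & p <= b].
Proof. by rewrite mem_filter mem_index_iota ltnS. Qed.

Lemma primes_in_uniq a b : uniq (primes_in a b).
Proof. by rewrite filter_uniq // iota_uniq. Qed.

Lemma primes_in_all a b : all prime (primes_in a b).
Proof. exact: filter_all. Qed.

Lemma primes_in_cat a b c : a <= b -> b <= c ->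
  primes_in a c = primes_in a b ++ primes_in b c.
Proof. move=> ab bc; rewrite /primes_in -filter_cat /index_iota; congr seq.filter.
rewrite (_ : c.+1 - a.+1 = (b.+1 - a.+1) + (c.+1 - b.+1)) ?iotaD; last by lia.
by congr (_ ++ iota _ _); lia. Qed.

Lemma bin_odd_sym m : 'C(m.*2.+1, m.+1) = 'C(m.*2.+1, m).
Proof. by rewrite -bin_sub; [congr binomial; lia | lia]. Qed.

Lemma bin_odd_le m : 'C(m.*2.+1, m.+1) <= 4 ^ m.
Proof.
have h : 'C(m.*2.+1, m) + 'C(m.*2.+1, m.+1) <= (1 + 1) ^ m.*2.+1.
  rewrite expnDn; have m1 : m < m.*2.+2 by lia.
  have m2 : m.+1 < m.*2.+2 by lia.
  rewrite (bigD1 (Ordinal m1)) //= (bigD1 (Ordinal m2)) /=; last first.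
    by apply/eqP => /(congr1 val) /=; lia.
  by rewrite !exp1n !muln1 addnA leq_addr.
move: h; rewrite -bin_odd_sym addnn -mul2n expnS addn1 leq_pmul2l //.
by rewrite -mul2n expnM.
Qed.

(** Erdos's induction: an even [n > 2] adds no prime, and for [n = 2 m + 1] the primes in
    [(m + 1, n]] divide ['C(n, m + 1) <= 4 ^ m]. *)
Lemma primorial_le n : \prod_(p <- primes_in 0 n) p <= 4 ^ n.
Proof.
elim/ltn_ind: n => n IH.
case: (ltnP n 3) => n3.
  by case: n n3 {IH} => [|[|[|n]]] //; rewrite unlock.
case: (boolP (odd n)) => on; last first.
  have -> : primes_in 0 n = primes_in 0 n.-1.
    rewrite (@primes_in_cat 0 n.-1 n) //; try lia.
    rewrite -[RHS]cats0; congr (_ ++ _).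
    case E : (primes_in n.-1 n) => [//|p l].
    have : p \in primes_in n.-1 n by rewrite E inE eqxx.
    rewrite mem_primes_in => /and3P[pp h1 h2].
    have pn : p = n by lia.
    by case: (even_prime pp) => [p2|op]; [lia | rewrite -pn op in on].
  apply: leq_trans (IH n.-1 _) _; first by lia.
  by rewrite leq_exp2l //; lia.
have [m En] : exists m, n = m.*2.+1 by exists n./2; have := odd_double_half n; rewrite on; lia.
rewrite (@primes_in_cat 0 m.+1 n) ?big_cat /=; try lia.
have hm : m.+1 < n by lia.
have -> : 4 ^ n = 4 ^ m.+1 * 4 ^ m by rewrite -expnD; congr (_ ^ _); lia.
apply: leq_mul; first exact: IH.
apply: leq_trans (bin_odd_le m); apply: dvdn_leq; first by rewrite bin_gt0; lia.
apply: prod_primes_dvd; [exact: primes_in_uniq | exact: primes_in_all |].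
move=> p; rewrite mem_primes_in => /and3P[pp p1 p2].
have := bin_fact (_ : m.+1 <= n); rewrite En => /(_ ltac:(lia)) E.
have : p %| (m.*2.+1)`! by rewrite dvdn_fact //; lia.
rewrite -E Euclid_dvdM // => /orP[//|].
by rewrite Euclid_dvdM // => /orP[] /(prime_dvd_fact pp); lia.
Qed.

(** Legendre's formula: each difference of [2 N %/ p ^ k] and [2 * (N %/ p ^ k)] is 0 or 1, and it
    vanishes once [p ^ k] exceeds [2 N]. *)
Lemma pfactor_central_bin p N : prime p -> 0 < N ->
  p ^ logn p 'C(N.*2, N) <= N.*2.
Proof.
move=> pp N0; have p1 := prime_gt1 pp.
have N20 : 0 < N.*2 by rewrite double_gt0.
have /andP[t1 t2] := trunc_log_bounds p1 N20; set t := trunc_log p N.*2 in t1 t2.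
suff h : logn p 'C(N.*2, N) <= t.
  by apply: leq_trans t1; rewrite leq_exp2l.
have E : logn p (N.*2)`! = logn p 'C(N.*2, N) + 2 * logn p N`!.
  have := bin_fact (_ : N <= N.*2); rewrite -addnn addnK => <-; last exact: leq_addr.
  by rewrite !lognM ?muln_gt0 ?fact_gt0 ?bin_gt0 ?leq_addr // mul2n -addnn.
rewrite -(leq_add2r (2 * logn p N`!)) -E !logn_fact //.
have -> : \sum_(1 <= k < N.+1) N %/ p ^ k = \sum_(1 <= k < N.*2.+1) N %/ p ^ k.
  rewrite [RHS](@big_cat_nat _ _ _ N.+1) //=; last by lia.
  rewrite [X in _ = _ + X]big_nat_cond [X in _ = _ + X]big1 ?addn0 // => k /andP[/andP[k1 _] _].
  rewrite divn_small //; apply: leq_trans (ltn_expl k p1); lia.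
apply: leq_trans (_ : \sum_(1 <= k < N.*2.+1) ((k <= t) + 2 * (N %/ p ^ k)) <= _).
  rewrite big_nat_cond [leqRHS]big_nat_cond; apply: leq_sum => k /andP[/andP[k1 k2] _].
  have pk : 0 < p ^ k by rewrite expn_gt0; lia.
  case: (leqP k t) => kt.
    rewrite -ltnS -[X in _ < X]addn1 ltn_divLR //.
    have := ltn_ceil N pk; lia.
  rewrite divn_small //; apply: leq_trans t2 _; rewrite leq_exp2l //.
rewrite big_split /= big_distrr /= leq_add2r.
have tN : t <= N.*2 by apply: leq_trans t1; exact/ltnW/ltn_expl.
rewrite (@big_cat_nat _ _ _ t.+1) //=; try lia.
rewrite [X in _ + X]big_nat_cond [X in _ + X]big1 ?addn0; last first.
  by move=> k /andP[/andP[k1 _] _]; rewrite leqNgt k1.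
apply: leq_trans (_ : \sum_(1 <= k < t.+1) 1 <= _); last by rewrite sum_nat_const_nat muln1 subn1.
by apply: leq_sum => k _; exact: leq_b1.
Qed.

Lemma central_bin_ge N : 2 ^ N <= 'C(N.*2, N).
Proof.
elim: N => // N IH; rewrite doubleS binS expnS mul2n -addnn.
have E := bin_odd_sym N; rewrite E; apply: leq_add; (apply: leq_trans IH _).
  by rewrite -E binS leq_addl.
by rewrite -E binS leq_addl.
Qed.

(** Split the factorization of ['C(2 N, N) >= 2 ^ N], where [N = 2 ^ s]. Primes up to [r], about the
    square root of [2 N], give at most [(2 N) ^ r]; those in [(r, N / 8]] occur at most to the first
    power and give at most [4 ^ (N / 8)]. Each part uses at most a quarter of the exponent [N], so
    the remaining primes, worth at most [2 N] each, carry [2 ^ (N / 2)]. *)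
Lemma many_primes s : 16 <= s ->
  2 ^ s.-1 <= s.+1 * size (primes_in (2 ^ (s - 3)) (2 ^ s.+1)).
Proof.
move=> s16; set cnt := size _; set N := 2 ^ s.
have N0 : 0 < N by rewrite expn_gt0.
have NE : N.*2 = 2 ^ s.+1 by rewrite expnS mul2n.
set B := 'C(N.*2, N).
have B0 : 0 < B by rewrite bin_gt0 -addnn leq_addr.
pose h := (s.+2)./2; pose r := 2 ^ h.
have hs : s.+1 <= h.*2 by rewrite /h; lia.
have rr : N.*2 <= r * r by rewrite NE -expnD leq_exp2l // addnn.
have ry : r <= 2 ^ (s - 3) by rewrite leq_exp2l // /h; lia.
have y2 : 2 ^ (s - 3) <= 2 ^ s.+1 by rewrite leq_exp2l //; lia.
have EB : B = \prod_(p <- primes_in 0 N.*2) p ^ logn p B.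
  rewrite [LHS]prod_prime_decomp // prime_decompE big_map /=.
  rewrite [RHS](bigID (fun p => p \in primes B)) /= [X in _ = _ * X]big1 ?muln1; last first.
    by move=> p pB; rewrite -[RHS](expn0 p); congr (_ ^ _); apply/eqP; rewrite -leqn0 leqNgt logn_gt0.
  rewrite -[RHS]big_filter; apply: perm_big; apply: uniq_perm; rewrite ?primes_uniq ?filter_uniq ?iota_uniq //.
  move=> p; rewrite mem_filter mem_primes_in; case: (boolP (p \in primes B)) => //=.
  rewrite mem_primes => /and3P[pp _ pB]; rewrite pp prime_gt0 //=; apply/esym.
  apply: (prime_dvd_fact pp); apply: dvdn_trans pB _.
  have hN : N <= N.*2 by rewrite -addnn leq_addr.
  by rewrite -(bin_fact hN); exact: dvdn_mulr.
rewrite (@primes_in_cat 0 r) // in EB; last by rewrite NE; apply: leq_trans y2.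
rewrite (@primes_in_cat r (2 ^ (s - 3))) // in EB; last by rewrite NE.
rewrite !big_cat /= in EB.
have small (l : seq nat) : all prime l -> \prod_(p <- l) p ^ logn p B <= 2 ^ (s.+1 * size l).
  elim: l => [|p l IH] /=; first by rewrite big_nil expn_gt0.
  case/andP=> pp /IH {}IH; rewrite big_cons mulnS expnD; apply: leq_mul => //.
  by rewrite -NE; exact: pfactor_central_bin.
have h1 : \prod_(p <- primes_in 0 r) p ^ logn p B <= 2 ^ (s.+1 * r).
  apply: leq_trans (small _ (primes_in_all _ _)) _.
  rewrite leq_exp2l // leq_mul2l; apply/orP; right.
  by rewrite size_filter; apply: leq_trans (count_size _ _) _; rewrite size_iota subSS subn0.
have h3 : \prod_(p <- primes_in (2 ^ (s - 3)) N.*2) p ^ logn p B <= 2 ^ (s.+1 * cnt).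
  by rewrite NE; apply: small; exact: primes_in_all.
have h2 : \prod_(p <- primes_in r (2 ^ (s - 3))) p ^ logn p B <= 4 ^ (2 ^ (s - 3)).
  apply: leq_trans (primorial_le _); rewrite (@primes_in_cat 0 r) // big_cat /=.
  apply: leq_trans (leq_pmull _ _); last first.
    by rewrite big_seq prodn_cond_gt0 // => p; rewrite mem_primes_in => /and3P[/prime_gt0].
  rewrite big_seq [leqRHS]big_seq; apply: leq_prod => p; rewrite mem_primes_in => /and3P[pp p1 p2].
  have := pfactor_central_bin pp N0; rewrite -/B.
  case: (logn p B) => [|[|k]]; rewrite ?expn1 //; first by move=> _; rewrite expn0 prime_gt0.
  rewrite !expnS mulnA => hh; exfalso.
  have : p * p <= N.*2 by apply: leq_trans hh; rewrite leq_pmulr // expn_gt0 prime_gt0.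
  rewrite leqNgt => /negP; apply; apply: leq_ltn_trans rr _; apply: ltn_mul => //.
have := central_bin_ge N; rewrite -/B EB.
move/leq_trans/(_ (leq_mul h1 (leq_mul h2 h3))).
rewrite -[4]/(2 ^ 2) -expnM -!expnD leq_exp2l //.
have -> : 2 * 2 ^ (s - 3) = 2 ^ (s - 2) by rewrite -expnS; congr (_ ^ _); lia.
have -> : N = 2 ^ (s.-1) + 2 * 2 ^ (s - 2).
  by rewrite -expnS (_ : (s - 2).+1 = s.-1) ?addnn -?mul2n -?expnS; [congr (_ ^ _); lia | lia].
suff : s.+1 * r <= 2 ^ (s - 2) by lia.
(* Here [s >= 16] enters: [(s + 1) * r <= N / 4] is checked at [s = 16, 17] and propagates in steps
   of two, [r] doubling while [N] quadruples. *)
have base : forall k, (16 + k).+1 * 2 ^ (9 + k./2) <= 2 ^ (14 + k).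
  elim/ltn_ind => k IH; case: (ltnP k 2) => k2.
    have -> : k./2 = 0 by lia.
    rewrite addn0 (_ : 14 + k = 9 + (5 + k)); last by lia.
    rewrite (expnD _ 9 (5 + k)) mulnC leq_mul2l (expnD _ 5) -[2 ^ 5]/32; apply/orP; right.
    have : 0 < 2 ^ k by rewrite expn_gt0.
    by lia.
  have {}IH := IH (k - 2) ltac:(lia).
  have -> : k./2 = ((k - 2)./2).+1 by lia.
  have -> : 14 + k = (14 + (k - 2)).+2 by lia.
  rewrite (addnS 9) (expnS 2 (9 + _)) (expnS 2 (14 + (k - 2)).+1) (expnS 2 (14 + (k - 2))).
  rewrite mulnCA leq_pmul2l //; apply: leq_trans _ (leq_mul (leqnn 2) IH).
  by rewrite mulnA leq_mul2r; apply/orP; right; lia.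
have E1 : 14 + (s - 16) = s - 2 by lia.
have E2 : 16 + (s - 16) = s by lia.
have E3 : 9 + (s - 16)./2 = h by rewrite /h; lia.
by move: (base (s - 16)); rewrite E1 E2 E3.
Qed.

Local Open Scope ring_scope.

(** * Dissociated sets *)

(** The level [C] bounds the coefficients of the excluded relations: level 1 separates subset sums,
    level 2 is 2-dissociation. *)
Definition diss (S : finType) (k : S -> int) (C : nat) (A : {set S}) : Prop :=
  forall y : S -> int, (forall s, `|y s| <= C%:Z) ->
    \sum_(s in A) y s * k s = 0 -> forall s, s \in A -> y s = 0.

Lemma diss_leq (S : finType) (k : S -> int) C C' A :
  (C' <= C)%N -> diss k C A -> diss k C' A.
Proof.
move=> CC dA y yC; apply: dA => s; apply: le_trans (yC s) _; by rewrite lez_nat.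
Qed.

Lemma diss_subset (S : finType) (k : S -> int) C (A B : {set S}) :
  A \subset B -> diss k C B -> diss k C A.
Proof.
move=> AB dB y yC y0 s sA.
have := dB (fun s => if s \in A then y s else 0) _ _ s (fintype.subsetP AB _ sA).
rewrite sA; apply.
  by move=> i; case: ifP => // _; rewrite normr0.
rewrite -[RHS]y0 [LHS](bigID (mem A)) /= [X in _ + X]big1 ?addr0.
  rewrite [LHS](eq_bigl (mem A)); last first.
    by move=> i /=; rewrite andb_idl // => /(fintype.subsetP AB).
  by apply: eq_bigr => i /= ->.
by move=> i /andP[_ /negbTE->]; rewrite mul0r.
Qed.

Lemma subset_sum_inj (S : finType) (k : S -> int) (A B1 B2 : {set S}) :
  diss k 1 A -> B1 \subset A -> B2 \subset A ->
  \sum_(s in B1) k s = \sum_(s in B2) k s -> B1 = B2.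
Proof.
move=> dA s1 s2 E.
pose y s : int := (s \in B1)%:R - (s \in B2)%:R.
have E2 (B : {set S}) : B \subset A ->
    \sum_(s in A) (s \in B)%:R * k s = \sum_(s in B) k s.
  move=> sB; rewrite (bigID (mem B)) /= [X in _ + X]big1 ?addr0; last first.
    by move=> i /andP[_ /negbTE->]; rewrite mul0r.
  rewrite [LHS](eq_bigl (mem B)); last first.
    by move=> i /=; rewrite andb_idl // => /(fintype.subsetP sB).
  by apply: eq_bigr => i /= ->; rewrite mul1r.
have yA : forall s, s \in A -> y s = 0.
  apply: dA.
    by move=> s; rewrite /y; case: (_ \in _); case: (_ \in _).
  rewrite -[RHS](subrr (\sum_(s in B2) k s)) -{1}E -!E2 // -sumrB.
  by apply: eq_bigr => s _; rewrite -mulrBl.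
apply/setP => s; case: (boolP (s \in A)) => sA.
  by have := yA _ sA; rewrite /y; case: (s \in B1); case: (s \in B2).
by rewrite (contraNF (fintype.subsetP s1 s)) ?(contraNF (fintype.subsetP s2 s)).
Qed.

(** Pigeonhole: the [2 ^ #|A|] subset sums are distinct integers of absolute value at most
    [#|A| * X]. *)
Lemma diss_card (S : finType) (k : S -> int) (A : {set S}) (X : nat) :
  diss k 1 A -> (forall s, s \in A -> `|k s| <= X%:Z) ->
  (2 ^ #|A| <= #|A| * (2 * X) + 1)%N.
Proof.
move=> dA kX; rewrite -card_powerset addn1.
pose f (B : {set S}) : 'I_(#|A| * (2 * X)).+1 :=
  inord `|(\sum_(s in B) k s + (#|A| * X)%:Z)%R|%N.
have bnd (B : {set S}) : B \subset A -> `|\sum_(s in B) k s| <= (#|A| * X)%:Z.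
  move=> sB; apply: le_trans (ler_norm_sum _ _ _) _.
  apply: le_trans (_ : \sum_(s in B) X%:Z <= _).
    by apply: ler_sum => s /(fintype.subsetP sB) sA; exact: kX.
  by rewrite sumr_const -mulr_natl natz -PoszM lez_nat leq_mul2r subset_leq_card ?orbT.
have finj : {in powerset A &, injective f}.
  move=> B1 B2; rewrite !inE => s1 s2 /(congr1 val) /=.
  have a1 := bnd _ s1; have a2 := bnd _ s2.
  rewrite !inordK; try by rewrite ltnS; lia.
  by move=> E; apply: (subset_sum_inj dA) => //; lia.
by rewrite -(card_in_imset finj); apply: leq_trans (max_card _) _; rewrite card_ord.
Qed.

(* [A] is a largest dissociated subset of [B]: adding [s] to it creates a relation. *)
Lemma diss_span (S : finType) (k : S -> int) (C : nat) (B : {set S}) :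
  (0 < C)%N -> exists A : {set S}, [/\ A \subset B, diss k C A &
    forall s, s \in B -> exists c : nat, exists y : S -> int,
      [/\ (0 < c <= C)%N, (forall a, `|y a| <= C%:Z) &
        c%:Z * k s = \sum_(a in A) y a * k a]].
Proof.
move=> C0.
pose P (A : {set S}) := (A \subset B) && `[< diss k C A >].
have P0 : P finset.set0.
  by rewrite /P sub0set /=; apply/asboolP => y _ _ s; rewrite inE.
case: (arg_maxnP (fun A : {set S} => #|A|) P0) => A /andP[AB /asboolP dA] Amax.
exists A; split=> // s sB; case: (boolP (s \in A)) => sA.
  exists 1%N, (fun a => (a == s)%:R); split=> //.
    by move=> a; case: (_ == _).
  rewrite (bigD1 s) //= eqxx big1 ?addr0 // => i /andP[_ /negbTE->].
  by rewrite mul0r.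
have : ~ diss k C (s |: A).
  move=> d; have := Amax (s |: A); rewrite /P subUset sub1set sB AB /=.
  have d' : `[< diss k C (s |: A) >] by apply/asboolP.
  by move/(_ d'); rewrite /= cardsU1 sA add1n ltnn.
move=> /existsNP[y] /not_implyP[yC] /not_implyP[].
rewrite big_setU1 //= => y0 /existsNP[t] /not_implyP[tA yt].
have ys : y s != 0.
  apply/eqP => ys; apply: yt; move: tA; rewrite !inE => /orP[/eqP->//|].
  by move: y0; rewrite ys mul0r add0r => /(dA y yC); apply.
exists `|y s|%N, (fun a => - (Num.sg (y s) * y a)); split.
- by rewrite absz_gt0 ys /=; have := yC s; lia.
- move=> a; rewrite normrN normrM; have := yC a.
  by rewrite normr_sg ys mul1r.
- rewrite (eq_bigr (fun a => - Num.sg (y s) * (y a * k a))); last by move=> i _; ring.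
  rewrite -mulr_sumr.
  have -> : \sum_(i in A) y i * k i = - (y s * k s) by apply/eqP; rewrite -addr_eq0 addrC y0.
  have -> : `|y s|%N%:Z = Num.sg (y s) * y s by rewrite abszE -normrEsg.
  ring.
Qed.

(** The vectors [\sum_(d in B) Y d] separate the subsets [B] of [D], and each coordinate takes at
    most [2 * #|D| * M + 1] values. So a family spanning [D] with bounded coefficients is smaller
    than [D] by a logarithmic factor at most. *)
Lemma diss_vec_card (S T : finType) (k : S -> int) (k' : T -> int)
    (D : {set S}) (E : {set T}) (c : int) (M : nat) (Y : S -> T -> int) :
  diss k 1 D -> c != 0 -> (forall d e, d \in D -> `|Y d e| <= M%:Z) ->
  (forall d, d \in D -> c * k d = \sum_(e in E) Y d e * k' e) ->
  (2 ^ #|D| <= (2 * #|D| * M).+1 ^ #|E|)%N.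
Proof.
move=> dD c0 YM EY; rewrite -card_powerset.
pose f (B : {set S}) : {ffun {e | e \in E} -> 'I_(2 * #|D| * M).+1} :=
  [ffun e => inord `|(\sum_(d in B) Y d (val e) + (#|D| * M)%:Z)%R|%N].
have bnd (B : {set S}) e : B \subset D -> `|\sum_(d in B) Y d e| <= (#|D| * M)%:Z.
  move=> sB; apply: le_trans (ler_norm_sum _ _ _) _.
  apply: le_trans (_ : \sum_(s in B) M%:Z <= _).
    by apply: ler_sum => s /(fintype.subsetP sB) sD; exact: YM.
  by rewrite sumr_const -mulr_natl natz -PoszM lez_nat leq_mul2r subset_leq_card ?orbT.
have finj : {in powerset D &, injective f}.
  move=> B1 B2; rewrite !inE => s1 s2 /ffunP E12.
  apply: (subset_sum_inj dD) => //.
  apply: (mulfI c0); rewrite !mulr_sumr.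
  have h (B : {set S}) : B \subset D -> \sum_(i in B) c * k i =
      \sum_(e in E) (\sum_(d in B) Y d e) * k' e.
    move=> sB; under [RHS]eq_bigr => e _ do rewrite mulr_suml.
    rewrite exchange_big /=; apply: eq_bigr => d dB; apply: EY.
    exact: (fintype.subsetP sB).
  rewrite !h //; apply: eq_bigr => e eE; congr (_ * _).
  have := E12 (exist _ e eE); rewrite !ffunE /= => /(congr1 val) /=.
  have := bnd _ e s1; have := bnd _ e s2.
  set s1_ := \sum_(d in B1) _; set s2_ := \sum_(d in B2) _ => ? ?; rewrite !inordK ?ltnS; lia.
rewrite -(card_in_imset finj); apply: leq_trans (max_card _) _.
by rewrite card_ffun card_ord card_sig.
Qed.

(** * Sign vectors whose signed sum is a multiple of a given integer *)

Section SignedSums.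
Variables (T : finType) (x : T -> nat).
Implicit Types (e : {ffun T -> 'I_3}).

(* The value [1 : 'I_3] codes the sign 0, so that [e] codes a vector of signs. *)
Definition sgn3 (j : 'I_3) : int := (j : nat)%:Z - 1.
Definition supp3 e : {set T} := [set i | e i != 1 :> nat].
Definition signed_sum e : int := \sum_i sgn3 (e i) * (x i)%:Z.

Lemma sgn3_inj : injective sgn3.
Proof. by move=> a b h; apply/val_inj; move: h; rewrite /sgn3 /=; lia. Qed.

Lemma sgn3_bound j : `|sgn3 j| <= 1.
Proof. by case: j => -[|[|[|j]]]. Qed.

Lemma sgn3_out e i : i \notin supp3 e -> sgn3 (e i) = 0.
Proof. by rewrite inE negbK /sgn3 => /eqP->. Qed.

Lemma signed_sumE (E : {set T}) e : supp3 e \subset E ->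
  signed_sum e = \sum_(i in E) sgn3 (e i) * (x i)%:Z.
Proof.
move=> sE; rewrite /signed_sum (bigID (mem E)) /= [X in _ + X]big1 ?addr0 // => i iE.
by rewrite sgn3_out ?mul0r //; apply: contraNN iE; apply: fintype.subsetP.
Qed.

(** A sign vector with support of size at most [J] in [U] is coded by a word of length [J] over the
    signed elements of [U] and a blank. *)
Lemma card_small_supp (U : {set T}) (J : nat) (W : {set {ffun T -> 'I_3}}) :
  (forall e, e \in W -> supp3 e \subset U /\ (#|supp3 e| <= J)%N) ->
  (#|W| <= (2 * #|U|).+1 ^ J)%N.
Proof.
move=> hW.
pose C : {set option (T * bool)} :=
  None |: (Some @: (finset.setX U [set: bool])).
have cC : (#|C| = (2 * #|U|).+1)%N.
  rewrite cardsU1 card_imset; last by move=> ? ? [].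
  rewrite cardsX cardsT card_bool mulnC; case: imsetP => [[]//|_].
  by rewrite add1n.
pose dec (g : {ffun 'I_J -> option (T * bool)}) : {ffun T -> 'I_3} :=
  [ffun i => if Some (i, true) \in codom g then inord 2
             else if Some (i, false) \in codom g then inord 0 else inord 1].
pose W' := [set g : {ffun 'I_J -> option (T * bool)} | g \in ffun_on (mem C)].
have sub : W \subset dec @: W'.
  apply/fintype.subsetP => e /hW[eU eJ]; apply/imsetP.
  pose code i := Some (i, e i == 2 :> nat).
  pose g : {ffun 'I_J -> option (T * bool)} :=
    [ffun j : 'I_J => nth None [seq code i | i <- enum (supp3 e)] j].
  have gin o : (Some o \in codom g) = (Some o \in [seq code i | i <- enum (supp3 e)]).
    apply/idP/idP.
      case/codomP => j; rewrite ffunE => E; rewrite E.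
      by apply: mem_nth; rewrite ltnNge; apply/negP => h; rewrite nth_default in E.
    move=> h; have := h; rewrite -index_mem size_map -cardE => /leq_trans/(_ eJ) hj.
    by apply/codomP; exists (Ordinal hj); rewrite ffunE nth_index.
  exists g.
    rewrite inE; apply/ffun_onP => j; rewrite ffunE.
    have [h|h] := ltnP j (size (enum (supp3 e))); last first.
      by rewrite nth_default ?size_map // !inE.
    have := mem_nth None (_ : (j < size [seq code i | i <- enum (supp3 e)])%N).
    rewrite size_map => /(_ h) /mapP[i]; rewrite mem_enum => iS ->.
    by rewrite !inE; apply/orP; right; apply/imsetP; exists (i, e i == 2 :> nat); rewrite // !inE (fintype.subsetP eU).
  have inj b i : (Some (i, b) \in [seq code i | i <- enum (supp3 e)]) =
      (i \in supp3 e) && ((e i == 2 :> nat) == b).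
    apply/idP/idP => [/mapP[i']|/andP[h /eqP hb]].
      by rewrite mem_enum => h [-> ->]; rewrite h eqxx.
    by apply/mapP; exists i; rewrite ?mem_enum // /code hb.
  apply/ffunP => i; rewrite ffunE !gin !inj; apply/val_inj.
  rewrite inE; case: (e i) => -[|[|[|k]]] ki //=; by rewrite inordK.
apply: leq_trans (subset_leq_card sub) _.
apply: leq_trans (leq_imset_card _ _) _.
by rewrite cardsE card_ffun_on cC card_ord.
Qed.

Variables (E : {set T}) (C X lam v : nat).
Hypotheses (lam0 : (0 < lam)%N) (v0 : (0 < v)%N).

(* A maximal dissociated family [A] of quotients [kap e] has at most [r] members,
   and each other [kap e] is a signed sum of these. As [E] is dissociated at
   level [C > r], the sign vector [e] is the same signed sum of sign vectors, so
   its support lies in the union of those of the members of [A]. *)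
Lemma multiples_card (r J : nat) (W : {set {ffun T -> 'I_3}})
    (kap : {ffun T -> 'I_3} -> int) :
  diss (fun i => (x i)%:Z) C E -> (r < C)%N ->
  (forall r', (2 ^ r' <= r' * (2 * X) + 1)%N -> (r' <= r)%N) ->
  (forall e, e \in W -> [/\ supp3 e \subset E, (#|supp3 e| <= J)%N, `|kap e| <= X%:Z &
      lam%:Z * signed_sum e = kap e * v%:Z]) ->
  (#|W| <= (2 * (r * J)).+1 ^ J)%N.
Proof.
move=> dE rC rX hW.
have [A [AW dA spanA]] := diss_span kap W (ltn0Sn 0).
have cA : (#|A| <= r)%N.
  apply: rX; apply: (diss_card dA) => e /(fintype.subsetP AW) /hW[_ _ h _].
  exact: h.
pose U := (\bigcup_(e in A) supp3 e)%SET.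
have cU : (#|U| <= r * J)%N.
  apply: leq_trans (_ : \sum_(e in A) #|supp3 e| <= _)%N.
    rewrite /U; elim/big_rec2: _ => [|e n V _ h]; first by rewrite cards0.
    by apply: leq_trans (leq_card_setU _ _) _; rewrite leq_add2l.
  apply: leq_trans (_ : \sum_(e in A) J <= _)%N.
    by apply: leq_sum => e /(fintype.subsetP AW) /hW[].
  by rewrite sum_nat_const leq_mul2r cA orbT.
apply: leq_trans (card_small_supp (U := U) (J := J) _) _; last first.
  have [->//|J0] := posnP J; by rewrite leq_exp2r // ltnS leq_mul2l cU orbT.
move=> e eW; have [sE sJ kX kE] := hW e eW; split=> //.
have [c [y [c1 yb yE]]] := spanA e eW.
have {c1 c yE} yE : kap e = \sum_(a in A) y a * kap a.
  have c1' : c = 1%N by lia.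
  by move: yE; rewrite c1' mul1r.
have mE : signed_sum e = \sum_(a in A) y a * signed_sum a.
  have l0 : lam%:Z != 0 by lia.
  apply: (mulfI l0); rewrite kE yE mulr_suml mulr_sumr; apply: eq_bigr => a aA.
  have [_ _ _ ka] := hW a (fintype.subsetP AW _ aA).
  by rewrite -mulrA -ka; ring.
pose z i : int := sgn3 (e i) - \sum_(a in A) y a * sgn3 (a i).
have z0 : forall i, i \in E -> z i = 0.
  apply: dE => [i|].
    apply: le_trans (ler_normB _ _) _.
    apply: le_trans (_ : 1 + \sum_(a in A) 1 <= _).
      apply: lerD; first exact: sgn3_bound.
      apply: le_trans (ler_norm_sum _ _ _) _; apply: ler_sum => a _.
      by rewrite normrM -[leRHS]mulr1; apply: ler_pM => //; exact: sgn3_bound.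
    rewrite sumr_const natz; lia.
  under eq_bigr => i _ do rewrite /z mulrBl mulr_suml.
  rewrite sumrB exchange_big /= -(signed_sumE sE) mE; apply/eqP; rewrite subr_eq0; apply/eqP.
  apply: eq_bigr => a aA; rewrite (signed_sumE (E := E)); last first.
    by have [] := hW a (fintype.subsetP AW _ aA).
  by rewrite mulr_sumr; apply: eq_bigr => i _; rewrite mulrA.
apply/fintype.subsetP => i ie; apply: contraTT ie => iU.
have iA a : a \in A -> sgn3 (a i) = 0.
  move=> aA; apply: sgn3_out; apply: contraNN iU => h; apply/bigcupP; by exists a.
case: (boolP (i \in E)) => iE; last first.
  by apply: contraNN iE; apply: fintype.subsetP.
move: (z0 i iE); rewrite /z big1 ?subr0; last by move=> a aA; rewrite iA // mulr0.
by rewrite inE negbK /sgn3 => h; apply/eqP; lia.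
Qed.

(** At level 2 a signed sum over [E] determines its sign vector, so [kap] is injective on [W]. This
    serves for large supports, where the small weight of a term makes up for the cruder count. *)
Lemma multiples_card_trivial (W : {set {ffun T -> 'I_3}})
    (kap : {ffun T -> 'I_3} -> int) :
  diss (fun i => (x i)%:Z) 2 E ->
  (forall e, e \in W -> [/\ supp3 e \subset E, `|kap e| <= X%:Z &
      lam%:Z * signed_sum e = kap e * v%:Z]) ->
  (#|W| <= (2 * X).+1)%N.
Proof.
move=> dE hW.
pose f (e : {ffun T -> 'I_3}) : 'I_(2 * X).+1 := inord `|(kap e + X%:Z)%R|%N.
have f_inj : {in W &, injective f}.
  move=> e1 e2 /hW[s1 k1 m1] /hW[s2 k2 m2] /(congr1 val) /=.
  rewrite !inordK; try by lia.
  move=> E12; have k12 : kap e1 = kap e2 by lia.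
  have l0 : lam%:Z != 0 by lia.
  have m12 : signed_sum e1 = signed_sum e2 by apply: (mulfI l0); rewrite m1 m2 k12.
  have z0 : forall i, i \in E -> sgn3 (e1 i) - sgn3 (e2 i) = 0.
    apply: dE => [i|].
      by apply: le_trans (ler_normB _ _) _; rewrite (_ : 2%:Z = 1 + 1) //; apply: lerD; exact: sgn3_bound.
    under eq_bigr => i _ do rewrite mulrBl.
    by rewrite sumrB -!signed_sumE // m12 subrr.
  apply/ffunP => i; apply: sgn3_inj; apply/eqP; rewrite -subr_eq0; apply/eqP.
  case: (boolP (i \in E)) => [/z0//|iE].
  by rewrite !sgn3_out ?subr0 //; apply: contraNN iE; apply: fintype.subsetP.
by rewrite -(card_in_imset f_inj); apply: leq_trans (max_card _) _; rewrite card_ord.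
Qed.
End SignedSums.

Lemma pow2_linear_bound r h : (2 ^ r <= r * 2 ^ h + 1)%N -> (r <= (2 * h + 4))%N.
Proof.
move=> H; rewrite leqNgt; apply/negP => rh.
have [t rE] : exists t, r = (h + t)%N by exists (r - h)%N; lia.
have t4 : (r.+1 < 2 ^ t)%N.
  have : (2 * t + 1 < 2 ^ t)%N.
    have : (4 < t)%N by lia.
    have [u ->] : exists u, t = (5 + u)%N by exists (t - 5)%N; lia.
    by clear; elim: u => // u IH _; rewrite (addnS 5) expnS; have := IH isT; lia.
  lia.
move: H; rewrite {1}rE expnD.
have h0 : (0 < 2 ^ h)%N by rewrite expn_gt0.
nia.
Qed.

(* The Fourier coefficient of [t |-> \sum_i f (x i * t)] at frequency [m], where
   [f y] is [cf 0 + 2 * \sum_(0 < k < H) cf k * cos (2 * pi * k * y)]. *)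
Definition fourier (R : nmodType) (T : finType) (x : T -> nat) (H : nat)
    (cf : nat -> R) (m : nat) : R :=
  \sum_i \sum_(k < H | (k * x i == m)%N) cf k.

(** * Spectrum and divisors *)

Section Tree.
Variables (R : realFieldType) (T : finType) (x : T -> nat).
Hypothesis x0 : forall i, (0 < x i)%N.
Hypothesis x_inj : injective x.
Variables (h : nat) (cf : nat -> R) (gam : R).
Let H := (2 ^ h)%N.
Hypothesis gam0 : 0 <= gam.
Hypothesis cf_large : forall k, (H <= k)%N -> cf k = 0.
Hypothesis cf_decay : forall k, (0 < k)%N -> `|cf k| <= k%:R^-1.
Hypothesis cf_ge : forall k, k%:R * gam <= 1 / 2 -> (2 * k <= H)%N -> gam / 4 <= cf k.

(* The multiple [l * x w] is divisible by [x i], with a small quotient, only if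
   [x w] already is. *)
Definition flat_at (w : T) (l : nat) : Prop :=
  forall i k, (k < H)%N -> (k * x i = l * x w)%N -> (l %| k)%N.

Definition close_divisors (w : T) : {set T} :=
  [set i | ((x i %| x w)%N) && (x w %/ x i <= H)%N].

Lemma fourier_flat w l : (0 < l)%N -> flat_at w l ->
  fourier x H cf (l * x w) = \sum_(i | (x i %| x w)%N) cf (l * (x w %/ x i))%N.
Proof.
move=> l0 fl; rewrite /fourier [RHS]big_mkcond; apply: eq_bigr => i _.
have [/dvdnP[r xw]|nd] := boolP ((x i %| x w)%N); last first.
  apply: big1 => k /eqP E; have /dvdnP[r kE] := fl i k (ltn_ord k) E.
  case/negP: nd; apply/dvdnP; exists r.
  by apply/eqP; rewrite -(eqn_pmul2l l0) -E kE; apply/eqP; lia.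
have E : (x w %/ x i = r)%N by rewrite xw mulnK.
rewrite E; have [lr|lr] := ltnP (l * r) H.
  rewrite (bigD1 (Ordinal lr)) /=; last by rewrite xw mulnA.
  rewrite big1 ?addr0 // => k /andP[/eqP kE /eqP nk].
  case: nk; apply/val_inj => /=; apply/eqP.
  by rewrite -(eqn_pmul2r (x0 i)) kE xw mulnA.
rewrite cf_large // big1 // => k /eqP kE; exfalso.
have : (k : nat) = (l * r)%N by apply/eqP; rewrite -(eqn_pmul2r (x0 i)) kE xw mulnA.
by have := ltn_ord k; lia.
Qed.

(** The least [j] with [r <= 2 ^ j] satisfies [2 ^ j < 2 * r]. Sums of inverses thus turn into
    counts of the [r] below [2 ^ j]. *)
Lemma inv_le_dyadic (j0 r : nat) : (2 ^ j0 < r)%N -> (r <= H)%N ->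
  r%:R^-1 <= 2 * \sum_(j0.+1 <= j < h.+1 | (r <= 2 ^ j)%N) (2 ^+ j)^-1 :> R.
Proof.
move=> r1 r2; have ex : exists j, (r <= 2 ^ j)%N by exists h.
case: (ex_minnP ex) => j rj jmin.
have r0 : (0 < r)%N by lia.
have jj0 : (j0 < j)%N.
  rewrite ltnNge; apply/negP => jj; have := leq_pexp2l (isT : (0 < 2)%N) jj; lia.
have jh : (j <= h)%N by exact: jmin.
have rj' : (2 ^ j.-1 < r)%N.
  by rewrite ltnNge; apply/negP => /jmin; lia.
apply: (@le_trans _ _ (2 * (2 ^+ j)^-1)).
  have -> : 2 * (2 ^+ j)^-1 = (2 ^+ j.-1)^-1 :> R.
    by case: (j) jj0 => // j' _; rewrite /= exprS invfM mulVKf ?pnatr_eq0.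
  by rewrite lef_pV2 ?posrE ?ltr0n ?exprn_gt0 // -natrX ler_nat ltnW.
rewrite ler_pM2l // -big_filter (bigD1_seq j) /=; first last.
- by rewrite filter_uniq // iota_uniq.
- by rewrite mem_filter rj mem_index_iota; lia.
- by rewrite lerDl; apply: sumr_ge0 => i _; rewrite invr_ge0 exprn_ge0.
Qed.

(** The full series sums to [(kap - 1) / (1 - kap / 2)], with denominator at least [1 / 4], and the
    missing tail is nonnegative. *)
Lemma geometric_gap (kap : R) m : 1 <= kap -> kap <= 3 / 2 ->
  \sum_(l < m) (kap ^+ l.+1 - 1) / 2 ^+ l.+1 <= 4 * (kap - 1).
Proof.
move=> k1 k2; have r1 : 1 - kap / 2 != 0 by rewrite gt_eqF //; lra.
have E : \sum_(l < m) (kap ^+ l.+1 - 1) / 2 ^+ l.+1 =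
    (kap - 1) / (1 - kap / 2) - ((kap / 2) ^+ m.+1 / (1 - kap / 2) - 2 ^- m).
  elim: m => [|m IH].
    by rewrite big_ord0 expr1 expr0 invr1; field; rewrite gt_eqF //; lra.
  rewrite big_ord_recr /= IH !exprMn !exprVn !exprS; field.
  by rewrite expf_neq0 //= gt_eqF //; lra.
rewrite E.
have a : (kap - 1) / (1 - kap / 2) <= 4 * (kap - 1).
  by rewrite ler_pdivrMr; [nra | lra].
have b : 2 ^- m <= (kap / 2) ^+ m.+1 / (1 - kap / 2).
  rewrite ler_pdivlMr; last by lra.
  rewrite exprS -exprVn.
  have : 2^-1 ^+ m <= (kap / 2) ^+ m by apply: lerXn2r; rewrite ?nnegrE; lra.
  have : 0 <= 2^-1 ^+ m :> R by apply: exprn_ge0; lra.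
  set u := 2^-1 ^+ m; set v := (_ / 2) ^+ m; nra.
lra.
Qed.

Variable Q : nat.
Hypothesis QE : Q%:R = 2 ^+ 14 :> R.

(* With [N j] the number of divisors [x i] of [x w] with [x w / x i <= 2 ^ j], choose
   [j] maximizing [N j / kap ^ j]. If [j <= Q g], the scale [s = j] makes the terms
   with quotient at most [2 ^ j] dominate the others; otherwise [2 ^ g <= N j]. *)
Lemma dichotomy (w : T) (lam : nat -> nat) (g : nat) :
  (Q * g <= h)%N ->
  (forall s, (s <= Q * g)%N -> [/\ flat_at w (lam s), (0 < lam s)%N,
     (lam s * 2 ^ s)%:R * gam <= 1 / 2, (2 * (lam s * 2 ^ s) <= H)%N &
     1 <= (lam s * 2 ^ (s + 8))%:R * gam]) ->
  (exists2 s, (s <= Q * g)%N & gam / 8 <= fourier x H cf (lam s * x w)) \/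
  (2 ^ g <= #|close_divisors w|)%N.
Proof.
move=> gh hl.
pose N j := #|[set i | (x i %| x w)%N && (x w %/ x i <= 2 ^ j)%N]|.
have N0 : (1 <= N 0)%N.
  by apply/card_gt0P; exists w; rewrite inE dvdnn divnn x0.
have Nmono j j' : (j <= j')%N -> (N j <= N j')%N.
  move=> jj; apply: subset_leq_card; apply/subsetP => i; rewrite !inE => /andP[-> h1] /=.
  by apply: leq_trans h1 _; rewrite leq_exp2l.
(* Over [Q] scales, growth at rate [kap] at least doubles [N]; over [Q * g] scales it reaches
   [2 ^ g]. *)
pose kap : R := 1 + Q%:R^-1.
have Q0 : 0 < Q%:R :> R by rewrite QE exprn_gt0.
have QV : 0 < Q%:R^-1 :> R by rewrite invr_gt0.
have kap0 : 0 < kap by rewrite /kap; lra.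
have kap1 : 1 <= kap by rewrite /kap; lra.
have kapQ : 2 <= kap ^+ Q.
  have bern m : 1 + Q%:R^-1 *+ m <= kap ^+ m.
    elim: m => [|m IH]; first by rewrite mulr0n addr0 expr0.
    have km : 1 <= kap ^+ m by apply: exprn_ege1.
    rewrite exprS mulrSr {1}/kap mulrDl mul1r addrA; apply: lerD => //.
    by rewrite -[leLHS]mulr1 ler_pM2l.
  have := bern Q.
  by rewrite -(mulr_natr Q%:R^-1 Q) mulVf ?gt_eqF.
have [js _ jsmax] := @arg_maxP _ _ 'I_h.+1 ord0 xpredT (fun j : 'I_h.+1 => (N j)%:R / kap ^+ j : R) isT.
have jmax j : (j <= h)%N -> (N j)%:R <= (N js)%:R / kap ^+ js * kap ^+ j :> R.
  move=> jh; have := jsmax (Ordinal (jh : (j < h.+1)%N)) isT.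
  by rewrite /= ler_pdivrMr ?exprn_gt0.
have [jI|jI] := leqP js (Q * g).
  left; exists js => //.
  have [fl l0 l1 l2 l3] := hl js jI; set l := lam js in fl l0 l1 l2 l3 *.
  rewrite fourier_flat //.
  have Ns0 : 1 <= (N js)%:R :> R.
    by rewrite ler1n; apply: leq_trans N0 _; exact: Nmono.
  have lR : 0 < l%:R :> R by rewrite ltr0n.
  pose t i := (x w %/ x i)%N.
  have t0 i : (x i %| x w)%N -> (0 < t i)%N by move=> /dvdn_leq; rewrite divn_gt0 //; apply; rewrite ?x0.
  have P1 : (N js)%:R * (gam / 4) <= \sum_(i | ((x i %| x w)%N) && (t i <= 2 ^ js)%N) cf (l * t i).
    rewrite mulr_natl /N -sumr_const big_mkcond [leRHS]big_mkcond; apply: ler_sum => i _.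
    rewrite inE -/(t i); case: ifP => // /andP[iw it]; apply: cf_ge.
      apply: le_trans l1; rewrite ler_wpM2r // ler_nat leq_mul2l it orbT //.
    by apply: leq_trans l2; rewrite !leq_mul2l it !orbT.
  have P2 : - (gam * (N js)%:R / 8) <= \sum_(i | ((x i %| x w)%N) && ~~ (t i <= 2 ^ js)%N) cf (l * t i).
    rewrite lerNl -sumrN.
    apply: (@le_trans _ _ (\sum_(i | ((x i %| x w)%N) && ~~ (t i <= 2 ^ js)%N)
       l%:R^-1 * (2 * \sum_(js.+1 <= j < h.+1 | (t i <= 2 ^ j)%N) (2 ^+ j)^-1))).
      apply: ler_sum => i /andP[iw]; rewrite -ltnNge => it.
      have [tH|tH] := leqP (t i) H.
        apply: le_trans (ler_norm _) _; rewrite normrN.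
        have lt0 : (0 < l * t i)%N by rewrite muln_gt0 l0 t0.
        apply: le_trans (cf_decay lt0) _; rewrite natrM invfM ler_pM2l ?invr_gt0 //.
        exact: inv_le_dyadic.
      rewrite cf_large; last by apply: leq_trans (ltnW tH) _; rewrite leq_pmull.
      rewrite oppr0; apply: mulr_ge0; first by rewrite invr_ge0 ltW.
      by apply: mulr_ge0 => //; apply: sumr_ge0 => j _; rewrite invr_ge0 exprn_ge0.
    rewrite -mulr_sumr -mulr_sumr.
    (* Summation by parts: the divisors counted at [j] are those with quotient in
       [(2 ^ js, 2 ^ j]]. *)
    have -> : \sum_(i | ((x i %| x w)%N) && ~~ (t i <= 2 ^ js)%N)
        \sum_(js.+1 <= j < h.+1 | (t i <= 2 ^ j)%N) (2 ^+ j)^-1 =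
      \sum_(js.+1 <= j < h.+1) ((N j)%:R - (N js)%:R) * (2 ^+ j)^-1 :> R.
      under eq_bigr => i _ do rewrite big_mkcond /=.
      rewrite exchange_big /=; apply: eq_big_nat => j /andP[j1 j2].
      rewrite -big_mkcondr /= sumr_const -natrB; last by apply: Nmono; lia.
      rewrite mulr_natl; congr (_ *+ _).
      rewrite /N -cardsDS; last first.
        apply/subsetP => i; rewrite !inE => /andP[-> h1] /=.
        by apply: leq_trans h1 _; rewrite leq_exp2l //; lia.
      apply: eq_card => i; rewrite in_setD !in_set -/(t i) [LHS]/in_mem /=.
      by case: ((x i %| x w)%N) => //=; rewrite andbC.
    apply: (@le_trans _ _ (l%:R^-1 * (2 * ((N js)%:R / 2 ^+ js * (4 * (kap - 1)))))).
      rewrite ler_pM2l ?invr_gt0 // ler_pM2l //.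
      apply: (@le_trans _ _ ((N js)%:R / 2 ^+ js * \sum_(u < h - js) (kap ^+ u.+1 - 1) / 2 ^+ u.+1)).
        rewrite mulr_sumr -{1}(add0n js.+1) big_addn big_mkord subSS.
        apply: ler_sum => u _.
        have uh : (u + js.+1 <= h)%N by have := ltn_ord u; lia.
        have := jmax _ uh; rewrite addnS -addSn exprD mulrCA divfK ?expf_neq0 ?gt_eqF // => jm.
        rewrite [2 ^+ (u.+1 + js)]exprD invfM.
        have p1 : 0 < (2 ^+ u.+1)^-1 :> R by rewrite invr_gt0 exprn_gt0.
        have p2 : 0 < (2 ^+ js)^-1 :> R by rewrite invr_gt0 exprn_gt0.
        have : ((N (u.+1 + js))%:R - (N js)%:R) * ((2 ^+ u.+1)^-1 * (2 ^+ js)^-1) <=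
           ((N js)%:R * (kap ^+ u.+1 - 1)) * ((2 ^+ u.+1)^-1 * (2 ^+ js)^-1).
          rewrite ler_pM2r ?mulr_gt0 //; lra.
        by move/le_trans; apply; rewrite le_eqVlt; apply/orP; left; apply/eqP; ring.
      apply: ler_wpM2l; first by rewrite divr_ge0 ?ler0n ?exprn_ge0.
      apply: geometric_gap => //; rewrite /kap.
      have : Q%:R^-1 <= 2^-1 :> R by rewrite QE lef_pV2 ?posrE ?exprn_gt0 // -[leLHS]expr1 ler_weXn2l // ler1n.
      lra.
    have -> : kap - 1 = Q%:R^-1 by rewrite /kap; lra.
    have l3' : l%:R^-1 <= gam * 2 ^+ js * 2 ^+ 8.
      rewrite -[l%:R^-1]mul1r ler_pdivrMr //; apply: le_trans l3 _.
      by rewrite natrM natrX exprD le_eqVlt; apply/orP; left; apply/eqP; ring.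
    set B := (2 * _); have B0 : 0 <= B.
      rewrite /B; apply: mulr_ge0 => //; apply: mulr_ge0; last by apply: mulr_ge0 => //; apply: ltW.
      by rewrite divr_ge0 ?ler0n ?exprn_ge0.
    (* Origin of [Q = 2 ^ 14]: the factors [2 ^ 8] from the window of [l], [2] from [inv_le_dyadic]
       and [4] from [geometric_gap] leave a loss of [gam * N js / 8], half of the main term. *)
    apply: le_trans (ler_wpM2r B0 l3') _.
    rewrite /B le_eqVlt; apply/orP; left; apply/eqP.
    by rewrite QE; field; rewrite expf_neq0 ?pnatr_eq0.
  rewrite (bigID (fun i => t i <= 2 ^ js)%N) /=.
  apply: le_trans (lerD P1 P2); have : 0 <= gam * ((N js)%:R - 1) by apply: mulr_ge0 => //; lra.
  by set u := (N js)%:R; lra.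
right.
have : 2 ^+ g <= (N js)%:R :> R.
  have := jmax 0%N isT; rewrite expr0 mulr1 => j0.
  have : 1 <= (N js)%:R / kap ^+ js.
    by apply: le_trans j0; rewrite ler1n.
  rewrite ler_pdivlMr ?exprn_gt0 // mul1r; apply: le_trans.
  apply: (@le_trans _ _ (kap ^+ (Q * g))).
    by rewrite exprM lerXn2r ?nnegrE // exprn_ge0 // ltW.
  by rewrite ler_weXn2l // ltnW.
rewrite -natrX ler_nat => /leq_trans; apply; apply: leq_trans (Nmono js h _) _.
  by rewrite -ltnS.
by apply: subset_leq_card; apply/subsetP => i; rewrite !inE.
Qed.

Fixpoint descent (d : T) (s : nat) : {set T} :=
  if s is s'.+1 then [set i | [exists w in descent d s', i \in close_divisors w]]
  else [set d].

Lemma descentP d s w : w \in descent d s ->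
  exists2 K, (K <= H ^ s)%N & (x d = K * x w)%N.
Proof.
elim: s w => [|s IH] w /=.
  by rewrite inE => /eqP->; exists 1%N; rewrite ?mul1n.
rewrite inE => /existsP[v /andP[/IH[K KH xd]]]; rewrite inE => /andP[/dvdnP[r xv] vw].
exists (K * r)%N; last by rewrite xd xv mulnA.
by rewrite expnSr leq_mul //; move: vw; rewrite xv mulnK.
Qed.

(* Edges [w -> i] with [x i | x w] leave each vertex in great number, while
   those arriving at [i] correspond to divisors of [x d / x i]. *)
Lemma bounded_descent (d : T) (S : pred T) (b G tau : nat) :
  (forall w K, (K <= H ^ b)%N -> x d = (K * x w)%N -> ~~ S w ->
     (G <= #|close_divisors w|)%N) ->
  (forall K, (0 < K)%N -> (K <= H ^ b)%N -> (size (divisors K) <= tau)%N) ->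
  (#|T| * tau ^ b < G ^ b)%N ->
  exists w K, [/\ S w, (K <= H ^ b)%N & x d = (K * x w)%N].
Proof.
move=> hG htau hb; have H1 : (0 < H)%N by rewrite expn_gt0.
case: (boolP [exists w, S w && [exists K : 'I_(H ^ b).+1, x d == (K * x w)%N]]).
  case/existsP => w /andP[Sw /existsP[K /eqP xd]].
  by exists w, K; split=> //; rewrite -ltnS.
move=> no; exfalso.
have nS s w : (s <= b)%N -> w \in descent d s -> ~~ S w /\
    exists2 K, (K <= H ^ b)%N & (x d = K * x w)%N.
  move=> sb /descentP[K KH xd]; have KHb : (K <= H ^ b)%N.
    by apply: leq_trans KH _; rewrite leq_pexp2l.
  split; last by exists K.
  apply: contraNN no => Sw; apply/existsP; exists w; rewrite Sw /=.
  by apply/existsP; exists (Ordinal (KHb : (K < (H ^ b).+1)%N)); apply/eqP.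
suff /(_ b (leqnn b)) : forall s, (s <= b)%N -> (G ^ s <= #|descent d s| * tau ^ s)%N.
  rewrite leqNgt => /negP; apply; apply: leq_ltn_trans hb.
  by rewrite leq_mul2r max_card orbT.
elim=> [_|s IH sb]; first by rewrite !expn0 cards1.
have {}IH := IH (ltnW sb); rewrite !expnSr.
apply: leq_trans (leq_mul IH (leqnn G)) _.
rewrite mulnAC mulnA [leqRHS]mulnAC leq_mul2r; apply/orP; right.
have -> : (#|descent d s| * G = \sum_(w in descent d s) G)%N by rewrite sum_nat_const.
apply: leq_trans (_ : \sum_(w in descent d s) #|close_divisors w| <= _)%N.
  apply: leq_sum => w ws; have [nw [K KH xd]] := nS s w (ltnW sb) ws.
  exact: hG xd nw.
have -> : (\sum_(w in descent d s) #|close_divisors w| =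
    \sum_(w in descent d s) \sum_(i in descent d s.+1) (i \in close_divisors w))%N.
  apply: eq_bigr => w ws; rewrite -sum1_card big_mkcond [RHS]big_mkcond /=.
  apply: eq_bigr => i _; rewrite [i \in [set _ | _]]inE.
  case: ifP => iw; last by case: ifP.
  by rewrite ifT //; apply/existsP; exists w; rewrite ws.
rewrite exchange_big /= -sum_nat_const; apply: leq_sum => i ii.
have [_ [K KH xd]] := nS _ _ sb ii.
have xdi : (x d %/ x i = K)%N by rewrite xd mulnK.
have K0 : (0 < K)%N by have := x0 d; rewrite xd muln_gt0 => /andP[].
apply: leq_trans (htau K K0 KH).
have -> : (\sum_(w in descent d s) (i \in close_divisors w) =
    #|[set w in descent d s | i \in close_divisors w]|)%N.
  rewrite -sum1_card [RHS]big_mkcond [LHS]big_mkcond /=; apply: eq_bigr => w _.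
  by rewrite [in RHS]inE; case: (w \in descent d s) => //=; case: (i \in _).
rewrite cardE -(size_map (fun w => (x w %/ x i)%N)); apply: uniq_leq_size.
  rewrite map_inj_in_uniq ?enum_uniq // => w1 w2; rewrite !mem_enum !inE.
  move=> /andP[_ /andP[d1 _]] /andP[_ /andP[d2 _]] E.
  by apply: x_inj; rewrite -(divnK d1) -(divnK d2) E.
move=> q /mapP[w]; rewrite mem_enum !inE => /andP[/descentP[K' _ xd'] /andP[dw _]] ->.
rewrite -dvdn_divisors // -xdi xd'.
by rewrite -muln_divA // dvdn_mull.
Qed.

End Tree.

Local Close Scope ring_scope.

(** * Flat primes *)

Lemma mean_pigeonhole (ps : seq nat) (f : nat -> nat) :
  ps != [::] -> exists2 l, l \in ps & f l * size ps <= \sum_(p <- ps) f p.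
Proof.
case: ps => // p0 ps _; have ne : exists m, has (fun p => f p == m) (p0 :: ps).
  by exists (f p0); rewrite /= eqxx.
case: (ex_minnP ne) => m /hasP[l lin /eqP fl] mmin; exists l => //.
rewrite fl -sum1_size big_distrr /= big_seq [leqRHS]big_seq; apply: leq_sum => p pin.
by rewrite muln1; apply: mmin; apply/hasP; exists p.
Qed.

Lemma card_rel_sum (A B : finType) (P : pred A) (Q : pred B) (r : A -> B -> bool) :
  \sum_(a | P a) #|[set b | Q b && r a b]| = \sum_(b | Q b) #|[set a | P a && r a b]|.
Proof.
have E1 a : #|[set b | Q b && r a b]| = \sum_(b | Q b) (r a b : nat).
  rewrite -sum1_card big_mkcond [RHS]big_mkcond; apply: eq_bigr => b _.
  by rewrite inE; case: (Q b) => //=; case: (r a b).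
have E2 b : #|[set a | P a && r a b]| = \sum_(a | P a) (r a b : nat).
  rewrite -sum1_card big_mkcond [RHS]big_mkcond; apply: eq_bigr => a _.
  by rewrite inE; case: (P a) => //=; case: (r a b).
under eq_bigr => a _ do rewrite E1.
by under [RHS]eq_bigr => b _ do rewrite E2; rewrite exchange_big.
Qed.

Lemma count_sum (ps : seq nat) (r : nat -> bool) : count r ps = \sum_(p <- ps) (r p : nat).
Proof. by rewrite -sum1_count big_mkcond; apply: eq_bigr => p _; case: (r p). Qed.

Section Flat.
Variables (T : finType) (x : T -> nat).
Hypothesis x0 : forall i, 0 < x i.

(** The ratio of [x u] and [x v] is a fraction of height at most [Y]. A failure of flatness below
    [d] only involves vertices related to [d] in this way. *)
Definition commens (Y : nat) (u v : T) : bool :=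
  [exists P : 'I_Y.+1, exists Q : 'I_Y.+1,
    [&& 0 < P, 0 < Q & P * x u == Q * x v]].

Lemma commensP Y u v :
  reflect (exists P Q, [/\ 0 < P <= Y, 0 < Q <= Y & P * x u = Q * x v]) (commens Y u v).
Proof.
apply: (iffP existsP) => [[P /existsP[Q /and3P[P0 Q0 /eqP E]]]|[P [Q [/andP[P0 PY] /andP[Q0 QY] E]]]].
  by exists P, Q; split=> //; rewrite ?P0 ?Q0 /= -ltnS ltn_ord.
exists (Ordinal (PY : P < Y.+1)); apply/existsP; exists (Ordinal (QY : Q < Y.+1)).
by rewrite /= P0 Q0 E eqxx.
Qed.

Lemma commens_trans Y u v w : commens Y u v -> commens Y v w -> commens (Y * Y) u w.
Proof.
move=> /commensP[P [Q [/andP[P0 PY] /andP[Q0 QY] E]]].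
move=> /commensP[P' [Q' [/andP[P0' PY'] /andP[Q0' QY'] E']]].
apply/commensP; exists (P' * P), (Q * Q'); split.
- by rewrite muln_gt0 P0 P0' leq_mul.
- by rewrite muln_gt0 Q0 Q0' leq_mul.
- by rewrite -mulnA E mulnCA E' mulnA.
Qed.

Lemma commens_sym Y u v : commens Y u v -> commens Y v u.
Proof. by move=> /commensP[P [Q [hP hQ E]]]; apply/commensP; exists Q, P. Qed.

Lemma logn_ndvd l m : ~~ (l %| m) -> logn l m = 0.
Proof. by rewrite lognE => /negbTE->; rewrite !andbF. Qed.

(** A prime at which the valuations differ divides [P * Q <= 2 ^ (2 * y)], and each further prime at
    least doubles the product. *)
Lemma commens_primes y u v (ps : seq nat) : uniq ps -> all prime ps ->
  commens (2 ^ y) u v ->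
  count (fun l => logn l (x u) != logn l (x v)) ps <= 2 * y.
Proof.
move=> us ap /commensP[P [Q [/andP[P0 PY] /andP[Q0 QY] E]]].
rewrite -size_filter; set qs := seq.filter _ ps.
have qp : all prime qs.
  by apply/allP => l; rewrite mem_filter => /andP[_ /(allP ap)].
have dv : \prod_(l <- qs) l %| P * Q.
  apply: prod_primes_dvd => //; first exact: filter_uniq.
  move=> l; rewrite mem_filter => /andP[lne /(allP ap) pl].
  rewrite Euclid_dvdM //; apply: contraNT lne; rewrite negb_or => /andP[lP lQ].
  have := congr1 (logn l) E; rewrite !lognM //.
  by rewrite (logn_ndvd lP) (logn_ndvd lQ) !add0n => ->.
have : 2 ^ size qs <= 2 ^ (2 * y).
  apply: leq_trans (_ : \prod_(l <- qs) l <= _).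
    elim: qs qp {dv} => [|l qs IH] /=; first by rewrite big_nil.
    by case/andP=> pl /IH h; rewrite big_cons expnS leq_mul // prime_gt1.
  apply: leq_trans (dvdn_leq _ dv) _; first by rewrite muln_gt0 P0.
  by rewrite mul2n -addnn expnD leq_mul.
by rewrite leq_exp2l.
Qed.

Variables (h b y : nat).
Let H := 2 ^ h.
Let Y := 2 ^ y.
Hypothesis HY : H ^ b.+1 <= Y.

(** In [k * x i = l * x w] with [l] not dividing [k], the [l]-adic valuation of [x i] exceeds that
    of [x w] by one. By [commens_primes], a given pair of vertices allows this for few [l] only. *)
Lemma flat_or_jump d w K l : prime l -> l <= Y -> K <= H ^ b -> x d = K * x w ->
  ~ flat_at x h w l ->
  exists i, [/\ commens Y w d, commens Y i d, logn l (x i) != logn l (x w) &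
     exists2 k, k <= Y & k * x i = l * x d].
Proof.
move=> pl lY Kb xd /existsNP[i /existsNP[k /not_implyP[kH /not_implyP[E /negP nl]]]].
have l0 := prime_gt0 pl.
have K0 : 0 < K by have := x0 d; rewrite xd muln_gt0 => /andP[].
have k0 : 0 < k by move: (x0 w) (x0 i) E; case: (k) => // h1 h2; rewrite mul0n; nia.
have Y0 : 0 < Y by rewrite expn_gt0.
have kKY : K * k <= Y.
  by apply: leq_trans HY; rewrite expnSr leq_mul // ltnW.
exists i; split.
- apply/commensP; exists K, 1; split; rewrite ?K0 ?Y0 ?mul1n //=.
  apply: leq_trans HY; apply: leq_trans Kb _; rewrite leq_pexp2l // expn_gt0 //.
- apply/commensP; exists (K * k), l; split; rewrite ?muln_gt0 ?K0 ?k0 ?l0 //=.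
  by rewrite -mulnA E xd mulnCA.
- have := congr1 (logn l) E; rewrite !lognM // (logn_prime l pl) eqxx.
  by rewrite (logn_ndvd nl) add0n => ->; rewrite add1n neq_ltn ltnSn orbT.
- by exists (K * k) => //; rewrite -mulnA E xd mulnCA.
Qed.

Variable D : {set T}.
Hypothesis dD : diss (fun i => Posz (x i)) 1 D.
Variable rho : nat.
Hypothesis rhoP : forall r, 2 ^ r <= r * (2 * Y) + 1 -> r <= rho.

(** The quotients of [l * x d] by [x v] inherit the dissociation of [D] and are at most [Y], so
    [diss_card] limits their number. *)
Lemma card_multiples v l : 0 < l ->
  #|[set d in D | [exists k : 'I_Y.+1, k * x v == l * x d]]| <= rho.
Proof.
move=> l0; set A := [set d in D | _]; apply: rhoP.
pose k d := l * x d %/ x v.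
have kE d : d \in A -> k d * x v = l * x d /\ k d <= Y.
  rewrite inE => /andP[_ /existsP[j /eqP E]].
  by rewrite /k -E mulnK // -ltnS ltn_ord.
apply: (@diss_card _ (fun d => Posz (k d))) => [|d /kE[_ kY]]; last by rewrite lez_nat.
have dA : diss (fun i => Posz (x i)) 1 A.
  by apply: diss_subset dD; apply/subsetP => d; rewrite inE => /andP[].
move=> z zb z0; apply: dA => //.
have lne : (Posz l != 0)%R by lia.
apply: (mulfI lne); rewrite mulr0 mulr_sumr.
have := congr1 (fun t => (t * Posz (x v))%R) z0; rewrite mul0r mulr_suml => E2; rewrite -[RHS]E2.
by apply: eq_bigr => d dA'; have [E _] := kE d dA'; rewrite -mulrA -PoszM E PoszM; ring.
Qed.

Variables (I r1 vb : nat) (ps : nat -> seq nat).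
Hypothesis psU : forall s, uniq (ps s).
Hypothesis psP : forall s, all prime (ps s).
Hypothesis psY : forall s l, s <= I -> l \in ps s -> l <= Y.
Hypothesis psN : forall s, s <= I -> ps s != [::].
Hypothesis yA : forall s, s <= I -> 4 * I.+1 * (r1 * y) <= size (ps s).
Hypothesis yB : forall s, s <= I -> #|T| * (4 * y) <= vb * size (ps s).

Definition flat_below d l : Prop :=
  forall w K, K <= H ^ b -> x d = K * x w -> flat_at x h w l.

Let nonflat d l := ~~ `[< flat_below d l >].

Lemma nonflatP d l : prime l -> l <= Y -> nonflat d l ->
  exists w i, [/\ commens Y w d, commens Y i d, logn l (x i) != logn l (x w),
    (exists2 k, k <= Y & k * x i = l * x d) & exists2 k, k <= Y & k * x w = x d].
Proof.
move=> pl lY /asboolPn /existsNP[w /existsNP[K /not_implyP[Kb /not_implyP[xd nf]]]].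
have [i [h1 h2 h3 h4]] := flat_or_jump pl lY Kb xd nf.
exists w, i; split=> //; exists K => //.
by apply: leq_trans Kb _; apply: leq_trans HY; rewrite leq_pexp2l // expn_gt0.
Qed.

Lemma remove_nonflat (D0 : {set T}) (lam : nat -> nat) (m : nat) :
  (forall s, s <= I -> #|[set d in D0 | nonflat d (lam s)]| <= m) ->
  exists2 D' : {set T}, D' \subset D0 & #|D0| <= #|D'| + I.+1 * m /\
    forall d s, d \in D' -> s <= I -> flat_below d (lam s).
Proof.
move=> hm; pose bad := \bigcup_(s < I.+1) [set d in D0 | nonflat d (lam s)].
exists (D0 :\: bad); first exact: subsetDl.
split.
  have cb : #|bad| <= I.+1 * m.
    apply: leq_trans (_ : \sum_(s < I.+1) #|[set d in D0 | nonflat d (lam s)]| <= _).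
      rewrite /bad; elim/big_rec2: _ => [|s k V _ hh]; first by rewrite cards0.
      by apply: leq_trans (leq_card_setU _ _) _; rewrite leq_add2l.
    rewrite -[I.+1 in leqRHS]card_ord -sum_nat_const; apply: leq_sum => s _.
    by apply: hm; rewrite -ltnS.
  rewrite -(cardsID bad D0) addnC leq_add2l; apply: leq_trans cb.
  by rewrite subset_leq_card // subsetIr.
move=> d s; rewrite inE => /andP[nb dD0] sI; apply/asboolP; apply: contraNT nb => nf.
by apply/bigcupP; exists (Ordinal (sI : s < I.+1)) => //; rewrite inE dD0.
Qed.

Let related d : {set T} := [set v | commens Y v d].

(* If each [d] is commensurable to few [x v], then averaging over the primes of a
   scale yields one at which few [d] fail to be flat. *)
Lemma select_sparse (D0 : {set T}) : (forall d, d \in D0 -> #|related d| <= r1) ->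
  exists lam, (forall s, s <= I -> lam s \in ps s) /\
  exists2 D' : {set T}, D' \subset D0 & #|D0| <= 2 * #|D'| /\
    forall d s, d \in D' -> s <= I -> flat_below d (lam s).
Proof.
move=> hD0.
pose f l := #|[set d in D0 | nonflat d l]|.
have hf s : s <= I -> \sum_(l <- ps s) f l <= #|D0| * (r1 * (2 * y)).
  move=> sI; apply: leq_trans (_ : \sum_(d in D0) count (nonflat d) (ps s) <= _).
    rewrite (eq_bigr (fun l => \sum_(d in D0) (nonflat d l : nat))); last first.
      move=> l _; rewrite /f -sum1_card big_mkcond [RHS]big_mkcond; apply: eq_bigr => d _.
      by rewrite inE; case: (d \in D0) => //=; case: (nonflat d l).
    by rewrite exchange_big; apply: leq_sum => d _; rewrite count_sum.
  rewrite -sum_nat_const; apply: leq_sum => d dD0.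
  apply: leq_trans (_ : \sum_(v in related d) count (fun l => logn l (x v) != logn l (x d)) (ps s) <= _).
    rewrite count_sum; under [leqRHS]eq_bigr => v _ do rewrite count_sum.
    rewrite exchange_big /= big_seq [leqRHS]big_seq; apply: leq_sum => l lps.
    have pl := allP (psP s) _ lps.
    case nf : (nonflat d l) => //.
    have [w [i [hw hi ne _ _]]] := nonflatP pl (psY sI lps) nf.
    (* The valuations at [w] and [i] differ, so one of them differs from that at [d]; the prime [l]
       is charged to that vertex. *)
    have [e|e] := eqVneq (logn l (x w)) (logn l (x d)).
      by rewrite (bigD1 i) ?inE //= -e ne leq_addr.
    by rewrite (bigD1 w) ?inE //= e leq_addr.
  apply: leq_trans (_ : \sum_(v in related d) 2 * y <= _).
    by apply: leq_sum => v; rewrite inE => hv; exact: commens_primes.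
  by rewrite sum_nat_const leq_mul2r hD0 ?orbT.
have ch s : exists l, s <= I -> l \in ps s /\ f l * size (ps s) <= #|D0| * (r1 * (2 * y)).
  case: (leqP s I) => sI; last by exists 0.
  have [l lin hl] := mean_pigeonhole f (psN sI).
  by exists l => _; split=> //; apply: leq_trans hl (hf s sI).
have [lam hlam] := choice ch; exists lam; split; first by move=> s /hlam[].
(* Removing this many elements at each of the [I.+1] scales leaves at least half of [D0]. *)
have [s sI|D' sD' [cD' fl]] := @remove_nonflat D0 lam (#|D0| %/ (2 * I.+1)).
  rewrite leq_divRL // -/(f (lam s)); have [lin hl] := hlam s sI; have hA := yA sI.
  have sz : 0 < size (ps s) by case: (ps s) lin.
  have [z|ry] := posnP (r1 * y).
    have -> : f (lam s) = 0; last by rewrite mul0n.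
    move: hl; rewrite [r1 * _]mulnCA z !muln0 leqn0 muln_eq0 => /orP[/eqP//|/eqP z2].
    by rewrite z2 in sz.
  rewrite -(leq_pmul2r ry) -(leq_pmul2r (isT : 0 < 2)).
  apply: leq_trans (_ : f (lam s) * (4 * I.+1 * (r1 * y)) <= _); first by rewrite leq_eqVlt; apply/orP; left; apply/eqP; ring.
  apply: leq_trans (leq_mul (leqnn _) hA) _; apply: leq_trans hl _.
  by rewrite leq_eqVlt; apply/orP; left; apply/eqP; ring.
exists D' => //; split=> //.
have : I.+1 * (#|D0| %/ (2 * I.+1)) * 2 <= #|D0|.
  by rewrite mulnAC mulnC [_ * 2]mulnC leq_trunc_div.
lia.
Qed.

(* If all of [D0] is commensurable to [c], the vertices [v] whose [l]-adic
   valuation differs from that of [c] are few for a suitable prime [l]; each of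
   them spoils the flatness of at most [2 * rho] elements, as [D] is dissociated. *)
Lemma select_dense (D0 : {set T}) (c : T) : D0 \subset D ->
  (forall d, d \in D0 -> commens Y d c) ->
  exists lam, (forall s, s <= I -> lam s \in ps s) /\
  exists2 D' : {set T}, D' \subset D0 & #|D0| <= #|D'| + I.+1 * (2 * rho * vb) /\
    forall d s, d \in D' -> s <= I -> flat_below d (lam s).
Proof.
move=> sD0 hD0.
pose B l := [set v | commens (Y * Y) v c && (logn l (x v) != logn l (x c))].
have hf s : s <= I -> \sum_(l <- ps s) #|B l| <= #|T| * (4 * y).
  move=> sI; apply: leq_trans (_ : \sum_(v | commens (Y * Y) v c) count (fun l => logn l (x v) != logn l (x c)) (ps s) <= _).
    rewrite (eq_bigr (fun l => \sum_(v | commens (Y * Y) v c) (logn l (x v) != logn l (x c) : nat))); last first.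
      move=> l _; rewrite /B -sum1_card big_mkcond [RHS]big_mkcond; apply: eq_bigr => v _.
      by rewrite inE; case: (commens _ _ _) => //=; case: (_ != _).
    by rewrite exchange_big; apply: leq_sum => d _; rewrite count_sum.
  apply: leq_trans (_ : \sum_(v : T | commens (Y * Y) v c) (4 * y) <= _).
    apply: leq_sum => v hv; rewrite (_ : 4 * y = 2 * (y + y)); last by lia.
    by apply: commens_primes => //; rewrite expnD.
  by rewrite sum_nat_const leq_mul2r max_card orbT.
have ch s : exists l, s <= I -> l \in ps s /\ #|B l| <= vb.
  case: (leqP s I) => sI; last by exists 0.
  have [l lin hl] := mean_pigeonhole (fun l => #|B l|) (psN sI).
  exists l => _; split=> //; have sz : 0 < size (ps s) by case: (ps s) lin.
  by rewrite -(leq_pmul2r sz); apply: leq_trans hl _; apply: leq_trans (hf s sI) (yB sI).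
have [lam hlam] := choice ch; exists lam; split; first by move=> s /hlam[].
have [s sI|D' sD' [cD' fl]] := @remove_nonflat D0 lam (2 * rho * vb); last by exists D'.
have [lin hB] := hlam s sI; set l := lam s in lin hB *.
have pl := allP (psP s) _ lin; have lY := psY sI lin.
pose M v m := [set d in D | [exists k : 'I_Y.+1, k * x v == m * x d]].
have sub : [set d in D0 | nonflat d l] \subset \bigcup_(v in B l) (M v 1 :|: M v l).
  apply/subsetP => d; rewrite inE => /andP[dD0 /(nonflatP pl lY)[w [i [hw hi ne [k1 k1Y E1] [k2 k2Y E2]]]]].
  have dDD := subsetP sD0 _ dD0; have dc := hD0 d dD0.
  have hwc := commens_trans hw dc; have hic := commens_trans hi dc.
  have [e|e] := eqVneq (logn l (x w)) (logn l (x c)).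
    apply/bigcupP; exists i; first by rewrite inE hic -e ne.
    rewrite !inE dDD /=; apply/orP; right; apply/existsP.
    by exists (Ordinal (k1Y : k1 < Y.+1)); rewrite /= E1.
  apply/bigcupP; exists w; first by rewrite inE hwc e.
  rewrite !inE dDD /=; apply/orP; left; apply/existsP.
  by exists (Ordinal (k2Y : k2 < Y.+1)); rewrite /= E2 mul1n.
apply: leq_trans (subset_leq_card sub) _.
apply: leq_trans (_ : \sum_(v in B l) (2 * rho) <= _); last first.
  by rewrite sum_nat_const mulnC leq_mul2l hB orbT.
apply: leq_trans (_ : \sum_(v in B l) #|M v 1 :|: M v l| <= _).
  elim/big_rec2: _ => [|v k V _ hh]; first by rewrite cards0.
  by apply: leq_trans (leq_card_setU _ _) _; rewrite leq_add2l.
apply: leq_sum => v _; apply: leq_trans (leq_card_setU _ _) _.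
by rewrite mul2n -addnn leq_add // card_multiples // prime_gt0.
Qed.

(** Either at least half of [D] has few commensurable vertices, or double counting of commensurable
    pairs yields a [c] related to many elements of the other part. In the second case the size
    hypothesis absorbs the elements lost. *)
Lemma select_flat : r1 <= #|T| -> 8 * #|T| * (I.+1 * (2 * rho * vb)) <= #|D| * r1 ->
  exists lam, (forall s, s <= I -> lam s \in ps s) /\
  exists2 D' : {set T}, D' \subset D & #|D| * r1 <= 4 * #|T| * #|D'| /\
    forall d s, d \in D' -> s <= I -> flat_below d (lam s).
Proof.
move=> r1T hD.
pose DA := [set d in D | #|related d| <= r1]; pose DB := D :\: DA.
have cAB : #|D| = #|DA| + #|DB|.
  rewrite -(cardsID DA D); congr (_ + _); apply: eq_card => d.
  by rewrite !inE; case: (d \in D).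
have sA : DA \subset D by apply/subsetP => d; rewrite inE => /andP[].
have sB : DB \subset D by exact: subsetDl.
case: (leqP #|DB| #|DA|) => cmp.
  have [d|lam [hlam [D' sD' [cD' fl]]]] := @select_sparse DA; first by rewrite inE => /andP[].
  exists lam; split=> //; exists D'; first exact: fintype.subset_trans sD' sA.
  split=> //; rewrite mulnC; apply: leq_trans (leq_mul r1T (_ : _ <= 4 * #|D'|)) _; lia.
have T0 : 0 < #|T| by apply: leq_trans (max_card DB); exact: leq_ltn_trans (leq0n _) cmp.
have [c hc] : exists c, #|DB| * r1 <= #|T| * #|[set d in DB | commens Y c d]|.
  apply/existsP; apply: contraTT (isT : true); rewrite negb_exists => /forallP nh.
  have h1 : \sum_(d in DB) #|[set v | true && commens Y v d]| >= #|DB| * r1.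
    rewrite -sum_nat_const; apply: leq_sum => d; rewrite !inE => /andP[nd dDD].
    by move: nd; rewrite dDD /= -ltnNge => /ltnW.
  move: h1; rewrite (card_rel_sum (fun d => d \in DB) xpredT (fun d v => commens Y v d)).
  rewrite leqNgt => /negP; case.
  have h2 v : #|T| * #|[set d in DB | commens Y v d]| < #|DB| * r1 by rewrite ltnNge nh.
  rewrite -(ltn_pmul2l T0) big_distrr /=.
  have [v0 _] : exists v0 : T, v0 \in T by apply/card_gt0P.
  rewrite (bigD1 v0) //= [X in _ < X * _](cardD1 v0) inE mulnDl mul1n.
  rewrite -addSn leq_add //.
  have -> : #|[predD1 T & v0]| * (#|DB| * r1) = \sum_(v | v != v0) #|DB| * r1.
    by rewrite sum_nat_const; congr (_ * _); apply: eq_card => v; rewrite !inE andbT.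
  by apply: leq_sum => v _; apply/ltnW/h2.
set Dc := [set d in DB | _] in hc.
have sDc : Dc \subset D by apply: fintype.subset_trans sB; apply/subsetP => d; rewrite inE => /andP[].
have [d|lam [hlam [D' sD' [cD' fl]]]] := @select_dense Dc c sDc.
  by rewrite inE => /andP[_ /commens_sym].
exists lam; split=> //; exists D'; first exact: fintype.subset_trans sD' sDc.
split=> //; move: (I.+1 * (2 * rho * vb)) hD cD' => X hD cD'.
have h1 : #|D| * r1 <= 2 * (#|T| * #|Dc|).
  by apply: leq_trans (leq_mul (leqnn 2) hc); rewrite mulnA leq_mul2r; apply/orP; right; lia.
have h2 : #|T| * #|Dc| <= #|T| * #|D'| + #|T| * X by rewrite -mulnDr leq_mul2l cD' orbT.
lia.
Qed.
End Flat.

Local Open Scope ring_scope.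

From mathcomp Require Import finmap all_classical all_reals all_analysis.
From mathcomp Require complex.
Import Order.TTheory GRing.Theory Num.Theory numFieldNormedType.Exports.

(** * Trigonometric sums *)

Section Trig.
Local Open Scope classical_set_scope.
Variable R : realType.
Implicit Types (x y a b h t : R).

Lemma sin_le_id x : 0 <= x -> sin x <= x.
Proof.
move=> x0; have [->|xn] := eqVneq x 0; first by rewrite sin0.
have {x0 xn}x0 : 0 < x by rewrite lt_neqAle eq_sym xn.
have cs : {within `[0, x], continuous sin} by apply: continuous_subspaceT => z; exact: continuous_sin.
have [c _] := MVT x0 (fun z _ => is_derive_sin z) cs.
rewrite sin0 !subr0 => ->; rewrite -[leRHS]mul1r ler_pM2r //; exact: cos_le1.
Qed.

Lemma cos_le x y : 0 <= x -> x <= y -> y <= pi -> cos y <= cos x.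
Proof.
by move=> x0 xy yp; rewrite leNgt ltr_cos ?in_itv /= -?leNgt //; apply/andP; split; lra.
Qed.

(** By duplication and the mean value theorem, [sin x] is [x] times two cosines at points of
    [[0, pi / 4]], each at least [cos (pi / 4)]. *)
Lemma sin_ge_half x : 0 <= x <= pi / 2 -> x / 2 <= sin x.
Proof.
move=> /andP[x0 xp].
have [->|xn] := eqVneq x 0; first by rewrite sin0 mul0r.
have {x0 xn}x0 : 0 < x by rewrite lt_neqAle eq_sym xn.
have p2 : pi / 2 < 2 :> R := pihalf_lt2 R.
have pi2 := pi_ge2 R.
have h0 : 0 < x / 2 by lra.
have cs : {within `[0, x / 2], continuous sin} by apply: continuous_subspaceT => z; exact: continuous_sin.
have [c] := MVT h0 (fun z _ => is_derive_sin z) cs.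
rewrite sin0 !subr0 in_itv /= => /andP[c0 cx] E.
have S : sin x = 2 * (sin (x / 2) * cos (x / 2)).
  by have := sinD (x / 2) (x / 2); rewrite -splitr => ->; ring.
have hc : cos (x / 2) <= cos c.
  by apply: cos_le; lra.
have hq : cos (pi / 4) <= cos (x / 2).
  by apply: cos_le; lra.
have q0 : 0 < cos (pi / 4) :> R by apply: cos_gt0_pihalf; apply/andP; split; lra.
have q2 : cos (pi / 4) ^+ 2 = 1 / 2 :> R.
  have := @cos_mulr2n R (pi / 4).
  have -> : (pi / 4) *+ 2 = pi / 2 :> R by rewrite mulr2n; lra.
  by rewrite cos_pihalf mulr2n; lra.
have c2 : 1 / 2 <= cos (x / 2) ^+ 2 by rewrite -q2 ler_sqr ?nnegrE; lra.
rewrite S E; set u := cos (x / 2) in hc hq c2 *; set v := cos c in hc *.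
have : u ^+ 2 <= v * u by rewrite expr2 ler_pM2r //; lra.
nra.
Qed.

Lemma sum_cos_telescope b h n :
  2 * sin (h / 2) * \sum_(s < n) cos (b + s%:R * h) =
  sin (b + n%:R * h - h / 2) - sin (b - h / 2).
Proof.
elim: n => [|n IH]; first by rewrite big_ord0 mul0r addr0 subrr mulr0.
rewrite big_ord_recr /= mulrDr IH.
have -> : b + n.+1%:R * h - h / 2 = (b + n%:R * h) + h / 2 by rewrite -natr1; lra.
rewrite !(sinD (b + n%:R * h)) sinN cosN; ring.
Qed.

Lemma sum_sin_telescope b h n :
  2 * sin (h / 2) * \sum_(s < n) sin (b + s%:R * h) =
  cos (b - h / 2) - cos (b + n%:R * h - h / 2).
Proof.
elim: n => [|n IH]; first by rewrite big_ord0 mul0r addr0 subrr mulr0.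
rewrite big_ord_recr /= mulrDr IH.
have -> : b + n.+1%:R * h - h / 2 = (b + n%:R * h) + h / 2 by rewrite -natr1; lra.
rewrite !(cosD (b + n%:R * h)) sinN cosN; ring.
Qed.

Definition cosq y := cos (2 * pi * y).
Definition sinq y := sin (2 * pi * y).

Lemma cosq_mul x y : cosq x * cosq y = (cosq (x + y) + cosq (x - y)) / 2.
Proof. by rewrite /cosq (mulrBr (2 * pi)) (mulrDr (2 * pi)) !cosD sinN cosN; field. Qed.

Lemma sin_int (m : int) : sin (pi * m%:~R) = 0 :> R.
Proof.
have h (k : nat) : sin (pi * k%:R) = 0 :> R.
  elim: k => [|k IH]; first by rewrite mulr0 sin0.
  by rewrite -natr1 mulrDr mulr1 sinD IH sinpi mul0r mulr0 addr0.
case: m => k; first exact: h.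
by rewrite NegzE mulrNz mulrN sinN h oppr0.
Qed.

Lemma sinD_int y (m : int) : `|sin (y + pi * m%:~R)| = `|sin y|.
Proof.
rewrite sinD sin_int mulr0 addr0 normrM.
by rewrite (sin0cos1 (sin_int m)) mulr1.
Qed.

Lemma cosq_int (m : int) : cosq m%:~R = 1.
Proof.
rewrite /cosq (_ : 2 * pi * m%:~R = (pi * m%:~R) *+ 2); last by rewrite mulr2n; ring.
by rewrite cos_mulr2n cos2sin2 sin_int expr0n subr0 mulr2n addrK.
Qed.

Lemma sinq_int (m : int) : sinq m%:~R = 0.
Proof. by rewrite /sinq -mulrA mulrCA -[2]/(2%:~R) -intrM sin_int. Qed.

(** Discrete orthogonality: since [|m| < N], only [m = 0] is a multiple of [N]. Grid averages thus
    replace integrals exactly for trigonometric polynomials of degree below [N]. *)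
Lemma mean_cosq (N : nat) (m : int) a : (`|m| < N)%N ->
  \sum_(s < N) cosq (a + m%:~R * (s%:R / N%:R)) = if m == 0 then N%:R * cosq a else 0.
Proof.
move=> mN; case: eqP => [->|/eqP m0].
  under eq_bigr => s _ do rewrite mul0r addr0.
  by rewrite sumr_const card_ord mulr_natl.
have N0 : N%:R != 0 :> R by rewrite pnatr_eq0; lia.
pose h : R := 2 * pi * (m%:~R / N%:R).
have sh : sin (h / 2) != 0.
  have -> : h / 2 = pi * (m%:~R / N%:R) by rewrite /h; field.
  wlog mp : m m0 mN {h} / 0 < m.
    move=> W; have [|mn] := ltP 0 m; first exact: W.
    have := W (- m); rewrite oppr_eq0 abszN oppr_gt0 => /(_ m0 mN) /=.
    rewrite mulrNz mulNr mulrN sinN oppr_eq0; apply; lia.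
  have mr : 0 < m%:~R :> R by rewrite ltr0z.
  have NR : 0 < N%:R :> R by rewrite ltr0n; lia.
  have mN' : m%:~R < N%:R :> R by rewrite -[N%:R]/(N%:Z%:~R) ltr_int; lia.
  rewrite gt_eqF // sin_gt0_pi //; rewrite mulr_gt0 ?pi_gt0 ?divr_gt0 //=.
  by rewrite gtr_pMr ?pi_gt0 // ltr_pdivrMr // mul1r.
have E := sum_cos_telescope (2 * pi * a) h N.
have h2 : 2 * sin (h / 2) != 0 by rewrite mulf_neq0.
apply: (mulfI h2); rewrite mulr0; move: E.
have -> : 2 * pi * a + N%:R * h - h / 2 = 2 * pi * m%:~R + (2 * pi * a - h / 2).
  by rewrite /h; field.
rewrite (sinD (2 * pi * m%:~R)) -/(sinq m%:~R) -/(cosq m%:~R) sinq_int cosq_int mul0r mul1r add0r subrr => E; rewrite -[RHS]E.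
congr (_ * _); apply: eq_bigr => s _; rewrite /cosq; congr cos; rewrite /h; field.
exact: N0.
Qed.
End Trig.

(** * The majorant *)

Section Kernel.
Variable R : realType.
Implicit Types (x y a b h t : R).

Lemma dist_int_le_sin y : dist_int y <= `|sin (pi * y)|.
Proof.
pose m := Num.floor (y + 1 / 2); pose u := y - m%:~R.
have mf : m%:~R <= y + 1 / 2 :> R by exact: floor_le_tmp.
have mf2 : y + 1 / 2 < m%:~R + 1 by rewrite -[1]/(1%:~R) -intrD floorD1_gt.
have yE : y = u + m%:~R by rewrite /u subrK.
have uh : `|u| <= 1 / 2 by rewrite /u ler_norml; apply/andP; split; lra.
apply: (@le_trans _ _ `|u|); first by rewrite /u; exact: dist_int_le.
rewrite yE mulrDr sinD_int.
have pi2 := pi_ge2 R.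
wlog u0 : u uh {yE} / 0 <= u.
  move=> W; have [|un] := leP 0 u; first exact: W.
  have := W (- u); rewrite normrN mulrN sinN normrN; apply => //; lra.
rewrite ger0_norm // in uh *.
apply: le_trans (ler_norm _); apply: le_trans (sin_ge_half _); first by nra.
by apply/andP; split; [apply: mulr_ge0 => //; lra | nra].
Qed.

Lemma dsum_dist (f : nat -> R) H :
  \sum_(i < H) \sum_(j < H) f `|i%:Z - j%:Z|%N =
  f 0%N *+ H + \sum_(1 <= k < H) f k *+ (H - k) *+ 2.
Proof.
elim: H => [|H IH]; first by rewrite big_ord0 big_geq // addr0.
rewrite big_ord_recr /=; under eq_bigr => i _ do rewrite big_ord_recr /=.
rewrite big_split /= IH big_ord_recr /= subrr absz0.
have E1 : \sum_(i < H) f `|i%:Z - H%:Z|%N = \sum_(1 <= k < H.+1) f k.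
  rewrite big_add1 big_mkord (reindex_inj rev_ord_inj) /=.
  by apply: eq_bigr => i _; congr f; have := ltn_ord i; lia.
have E2 : \sum_(i < H) f `|H%:Z - i%:Z|%N = \sum_(1 <= k < H.+1) f k.
  by rewrite -E1; apply: eq_bigr => i _; congr f; lia.
rewrite E1 E2.
have -> : \sum_(1 <= k < H.+1) f k *+ (H.+1 - k) *+ 2 =
   \sum_(1 <= k < H) f k *+ (H - k) *+ 2 + (\sum_(1 <= k < H.+1) f k) *+ 2.
  have -> : \sum_(1 <= k < H) f k *+ (H - k) *+ 2 = \sum_(1 <= k < H.+1) f k *+ (H - k) *+ 2.
    case: (H) => [|H']; first by rewrite !big_geq.
    by rewrite [RHS]big_nat_recr //= subnn mulr0n mul0rn addr0.
  rewrite -sumrMnl -big_split /=; apply: eq_big_nat => k /andP[k1 k2].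
  by rewrite subSn // (mulrSr _ (H - k)) mulrnDl.
rewrite (mulrSr _ H) mulr2n; set u := f 0%N *+ H; set v := \sum_(_ <= _ < H) _.
by set w := \sum_(_ <= _ < H.+1) _; ring.
Qed.

Variables (L M H : nat).
Hypotheses (H0 : (0 < H)%N) (HL : (2 * H <= L)%N) (ML : (2 * M + 2 <= L)%N).

Let L0 : (0 < L)%N. Proof. lia. Qed.
Let LR : 0 < L%:R :> R. Proof. by rewrite ltr0n. Qed.
Let HR : 0 < H%:R :> R. Proof. by rewrite ltr0n. Qed.

(** The Fejer kernel, written as the squared modulus of [\sum_(j < H) e^(2 pi i j y)] over [H],
    which makes its nonnegativity visible. *)
Definition fejer y : R :=
  ((\sum_(j < H) cosq (j%:R * y)) ^+ 2 + (\sum_(j < H) sinq (j%:R * y)) ^+ 2) / H%:R.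

Lemma fejer_ge0 y : 0 <= fejer y.
Proof. by rewrite divr_ge0 // addr_ge0 // sqr_ge0. Qed.

Lemma fejerE y : fejer y =
  1 + \sum_(1 <= k < H) 2 * ((H - k)%:R / H%:R) * cosq (k%:R * y).
Proof.
rewrite /fejer !expr2 !big_distrlr /= -big_split /=.
under eq_bigr => i _ do rewrite -big_split /=.
have E (i j : nat) : cosq (i%:R * y) * cosq (j%:R * y) + sinq (i%:R * y) * sinq (j%:R * y)
    = cosq (`|i%:Z - j%:Z|%N%:R * y).
  rewrite /cosq /sinq -cosB -mulrBr -mulrBl.
  have [ij|ij] := leqP i j.
    rewrite -cosN -mulrN -mulNr opprB -natrB //.
    by congr cos; congr (_ * (_%:R * _)); lia.
  rewrite -natrB; last by lia.
  by congr cos; congr (_ * (_%:R * _)); lia.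
under eq_bigr => i _ do under eq_bigr => j _ do rewrite E.
rewrite (dsum_dist (fun k => cosq (k%:R * y))) mul0r /cosq mulr0 cos0.
rewrite mulrDl divff ?gt_eqF //; congr (_ + _).
rewrite mulr_suml; apply: eq_bigr => k _.
rewrite -(mulr_natl _ 2) -(mulr_natl _ (H - k)); field.
by rewrite gt_eqF.
Qed.

(** Multiplied by [2 * sin (pi * y)], both sums telescope to a difference of two sines or cosines,
    of size at most 2. *)
Lemma fejer_le y d : 0 < d -> d <= dist_int y -> fejer y <= 2 / (H%:R * d ^+ 2).
Proof.
move=> d0 dy; have sy : d <= `|sin (pi * y)| := le_trans dy (dist_int_le_sin y).
have yE j : 2 * pi * (j%:R * y) = 0 + j%:R * (2 * (pi * y)) :> R by ring.
have C : (2 * sin (pi * y) * \sum_(j < H) cosq (j%:R * y)) ^+ 2 <= 4.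
  rewrite /cosq; under eq_bigr => j _ do rewrite yE.
  have := sum_cos_telescope 0 (2 * (pi * y)) H.
  rewrite [2 * (pi * y) / 2](_ : _ = pi * y); last by lra.
  move=> ->; set u := sin _; set v := sin _.
  have : `|u - v| <= 2 by apply: le_trans (ler_normB _ _) _; rewrite (_ : 2 = 1 + 1); [apply: lerD; exact: sin_max | lra].
  by rewrite ler_norml => /andP[? ?]; nra.
have S : (2 * sin (pi * y) * \sum_(j < H) sinq (j%:R * y)) ^+ 2 <= 4.
  rewrite /sinq; under eq_bigr => j _ do rewrite yE.
  have := sum_sin_telescope 0 (2 * (pi * y)) H.
  rewrite [2 * (pi * y) / 2](_ : _ = pi * y); last by lra.
  move=> ->; set u := cos _; set v := cos _.
  have : `|u - v| <= 2 by apply: le_trans (ler_normB _ _) _; rewrite (_ : 2 = 1 + 1); [apply: lerD; exact: cos_max | lra].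
  by rewrite ler_norml => /andP[? ?]; nra.
rewrite /fejer ler_pdivrMr //; set c := (\sum_(j < H) cosq _) in C *; set s := (\sum_(j < H) sinq _) in S *.
rewrite invfM mulrA mulrAC divfK ?gt_eqF // ler_pdivlMr ?exprn_gt0 //.
have s2 : d ^+ 2 <= sin (pi * y) ^+ 2.
  by rewrite -[leRHS]real_normK ?num_real // lerXn2r ?nnegrE // ltW.
set w := sin (pi * y) in C S s2.
have : (c ^+ 2 + s ^+ 2) * d ^+ 2 <= (c ^+ 2 + s ^+ 2) * w ^+ 2.
  by rewrite ler_wpM2l // addr_ge0 ?sqr_ge0.
nra.
Qed.

(** The Fourier coefficient of the uniform measure of mass [(2 M + 1) / L] on the points
    [(s - M) / L]. The factor [(H - k) / H] in [coef] is that of the Fejer kernel, so [coef] belongs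
    to their convolution, [majorant]. *)
Definition beta (k : nat) : R :=
  L%:R^-1 * \sum_(s < 2 * M + 1) cosq (k%:R * ((s%:R - M%:R) / L%:R)).

Definition coef (k : nat) : R := if (k < H)%N then (H - k)%:R / H%:R * beta k else 0.

Definition gam : R := (2 * M + 1)%:R / L%:R.

Lemma coef0 : coef 0 = gam.
Proof.
rewrite /coef H0 subn0 divff ?gt_eqF // mul1r /beta.
under eq_bigr => s _ do rewrite mul0r /cosq mulr0 cos0.
by rewrite sumr_const card_ord mulrC.
Qed.

Lemma beta_sum y k :
  L%:R^-1 * \sum_(s < 2 * M + 1) cosq (k%:R * (y - (s%:R - M%:R) / L%:R)) =
  beta k * cosq (k%:R * y).
Proof.
rewrite /beta.
set A := \sum_(s < _) cosq (k%:R * (y - _)); set B := \sum_(s < _) _.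
have E : A = \sum_(s < 2 * M + 1) cosq (k%:R * (y + (s%:R - M%:R) / L%:R)).
  rewrite /A (reindex_inj rev_ord_inj) /=; apply: eq_bigr => s _.
  congr (cosq (_ * (_ + _))); rewrite -mulNr; congr (_ / _).
  rewrite natrB; last by have := ltn_ord s; lia.
  move: (s : nat) => s0; rewrite mul2n -addnn -[s0.+1]addn1 !natrD; lra.
have : A + A = 2 * B * cosq (k%:R * y).
  rewrite {2}E /A -big_split /= /B mulrC mulrA mulr_sumr; apply: eq_bigr => s _.
  by rewrite [cosq _ * 2]mulrC -mulrA cosq_mul mulrBr mulrDr; lra.
by move=> h; rewrite -mulrA; congr (_ * _); lra.
Qed.

(* Smoothing over [2 M + 1] translates of the Fejer kernel by multiples of [1 / L]
   makes this close to 1 where [dist_int y] is less than about [M / L]. *)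
Definition majorant y : R :=
  L%:R^-1 * \sum_(s < 2 * M + 1) fejer (y - (s%:R - M%:R) / L%:R).

Lemma majorant_ge0 y : 0 <= majorant y.
Proof. by rewrite mulr_ge0 ?invr_ge0 ?ler0n // sumr_ge0 // => s _; exact: fejer_ge0. Qed.

Lemma majorantE y :
  majorant y = coef 0 + \sum_(1 <= k < H) 2 * coef k * cosq (k%:R * y).
Proof.
rewrite /majorant; under eq_bigr => s _ do rewrite fejerE.
rewrite big_split /= sumr_const card_ord mulrDr coef0; congr (_ + _); first by rewrite mulrC.
rewrite exchange_big /= mulr_sumr; apply: eq_big_nat => k /andP[k1 kH].
rewrite -mulr_sumr mulrCA beta_sum /coef kH; ring.
Qed.

Lemma fejer_mean y : \sum_(s < L) fejer (y - (s%:R - M%:R) / L%:R) = L%:R.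
Proof.
under eq_bigr => s _ do rewrite fejerE.
rewrite big_split /= sumr_const card_ord -[RHS]addr0; congr (_ + _).
rewrite exchange_big /= big_nat_cond big1 // => k /andP[/andP[k1 kH] _].
rewrite -mulr_sumr.
rewrite (eq_bigr (fun s : 'I_L => cosq (k%:R * (y + M%:R / L%:R) + (- k%:Z)%:~R * (s%:R / L%:R)))); last first.
  move=> s _; congr cosq; rewrite mulrNz /= -pmulrn; field.
  by rewrite gt_eqF.
rewrite mean_cosq; last by rewrite abszN absz_nat; lia.
by rewrite oppr_eq0; case: eqP => [|_]; [lia | rewrite mulr0].
Qed.

(** All [L] translates sum to exactly [L]. Those outside the window are centred at distance at least
    [w] from [y], hence are small there, so the window carries nearly the whole sum. *)
Lemma majorant_ge y w : 0 < w -> dist_int y + w <= (M.+1)%:R / L%:R ->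
  1 - 2 / (H%:R * w ^+ 2) <= majorant y.
Proof.
move=> w0 yw; rewrite /majorant.
have E := fejer_mean y.
rewrite -(big_mkord xpredT (fun s => fejer (y - (s%:R - M%:R) / L%:R))) in E.
rewrite (@big_cat_nat _ _ _ (2 * M + 1)) //= in E; last by lia.
rewrite big_mkord in E; move: E; set A := \sum_(s < _) _; set B := \sum_(_ <= s < _) _ => E.
have hB : B <= L%:R * (2 / (H%:R * w ^+ 2)).
  have pos : 0 <= 2 / (H%:R * w ^+ 2) :> R by apply: divr_ge0 => //; apply: mulr_ge0; [exact: ler0n | exact: sqr_ge0].
  apply: (@le_trans _ _ (\sum_(2 * M + 1 <= s < L) 2 / (H%:R * w ^+ 2))); last first.
    by rewrite sumr_const_nat -(mulr_natl _ (L - (2 * M + 1))) ler_wpM2r // ler_nat leq_subr.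
  apply: ler_sum_nat => s /andP[s1 s2].
  apply: fejer_le => //.
  set z := (s%:R - M%:R) / L%:R.
  have dz : (M.+1)%:R / L%:R <= dist_int z.
    apply: le_dist_int => m.
    have sM : (s%:R - M%:R : R) = (s - M)%N%:R by rewrite natrB //; lia.
    rewrite /z sM ler_pdivrMr //.
    rewrite -[X in _ <= _ * X](gtr0_norm LR) -normrM mulrBl divfK ?gt_eqF //.
    have -> : (s - M)%N%:R - m%:~R * L%:R = ((s - M)%N%:Z - m * L%:Z)%:~R :> R.
      by rewrite intrB intrM.
    rewrite -intr_norm -[M.+1%:R]/((M.+1)%:Z%:~R) ler_int.
    have [m0|m0] := lerP m 0.
      have : m * L%:Z <= 0 by rewrite mulr_le0_ge0.
      by move: (m * L%:Z) => u; lia.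
    have : L%:Z <= m * L%:Z by rewrite ler_peMl.
    by move: (m * L%:Z) => u; lia.
  have yz : dist_int z - dist_int y <= dist_int (y - z).
    apply: le_dist_int => m; rewrite lerBlDl -(dist_int_periodic z m).
    apply: le_trans (dist_int_lip _ y) _; rewrite lerD2l -normrN.
    by rewrite opprD opprD opprK addrC addrA.
  lra.
rewrite ler_pdivlMl //; nra.
Qed.

Lemma coef_large k : (H <= k)%N -> coef k = 0.
Proof. by rewrite /coef ltnNge => ->. Qed.

Lemma frac_le1 k : 0 <= ((H - k)%:R / H%:R : R) <= 1.
Proof. by rewrite divr_ge0 ?ler0n //= ler_pdivrMr // mul1r ler_nat leq_subr. Qed.

Lemma coef_norm k : `|coef k| <= gam.
Proof.
have g0 : 0 <= gam by rewrite divr_ge0 ?ler0n.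
rewrite /coef; case: ifP => _; last by rewrite normr0.
have /andP[f0 f1] := frac_le1 k.
rewrite normrM (ger0_norm f0) -[gam]mul1r; apply: ler_pM => //.
rewrite /beta normrM ger0_norm ?invr_ge0 ?ler0n // /gam mulrC ler_wpM2r ?invr_ge0 ?ler0n //.
apply: le_trans (ler_norm_sum _ _ _) _; apply: le_trans (_ : \sum_(s < 2 * M + 1) 1 <= _).
  by apply: ler_sum => s _; exact: cos_max.
by rewrite sumr_const card_ord.
Qed.

(** The closed form of the Dirichlet kernel; the decay and the lower bound of [coef] follow by
    comparing sines with their arguments. *)
Lemma beta_closed k : L%:R * sin (pi * (k%:R / L%:R)) * beta k = sin (pi * (k%:R * gam)).
Proof.
have := @sum_cos_telescope R (- (2 * pi * (k%:R * M%:R / L%:R))) (2 * pi * (k%:R / L%:R)) (2 * M + 1).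
have -> : 2 * pi * (k%:R / L%:R) / 2 = pi * (k%:R / L%:R) :> R by field; rewrite gt_eqF.
have -> : \sum_(s < 2 * M + 1) cos (- (2 * pi * (k%:R * M%:R / L%:R)) + s%:R * (2 * pi * (k%:R / L%:R)))
   = L%:R * beta k.
  rewrite /beta mulVKf ?gt_eqF //; apply: eq_bigr => s _; rewrite /cosq; congr cos.
  by field; rewrite gt_eqF.
have -> : - (2 * pi * (k%:R * M%:R / L%:R)) + (2 * M + 1)%:R * (2 * pi * (k%:R / L%:R))
  - pi * (k%:R / L%:R) = pi * (k%:R * gam) :> R.
  by rewrite /gam mul2n -addnn !natrD; field; rewrite gt_eqF.
have -> : - (2 * pi * (k%:R * M%:R / L%:R)) - pi * (k%:R / L%:R) = - (pi * (k%:R * gam)) :> R.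
  by rewrite /gam mul2n -addnn !natrD; field; rewrite gt_eqF.
by rewrite sinN; set u := sin _; set v := sin _ => h; lra.
Qed.

Lemma sin_frac k : (0 < k)%N -> (k < H)%N -> (k%:R / L%:R : R) <= sin (pi * (k%:R / L%:R)).
Proof.
move=> k0 kH; have pi2 := pi_ge2 R.
have kL : k%:R / L%:R <= 1 / 2 :> R.
  by rewrite ler_pdivrMr // mulrAC ler_pdivlMr // mul1r -natrM ler_nat; lia.
have kp : 0 <= k%:R / L%:R :> R by rewrite divr_ge0 ?ler0n.
apply: le_trans (sin_ge_half _); first by nra.
by apply/andP; split; [apply: mulr_ge0 => //; lra | nra].
Qed.

Lemma coef_decay k : (0 < k)%N -> `|coef k| <= k%:R^-1.
Proof.
move=> k0; have kR : 0 < k%:R :> R by rewrite ltr0n.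
rewrite /coef; case: ifP => kH; last by rewrite normr0 invr_ge0 ltW.
have /andP[f0 f1] := frac_le1 k.
rewrite normrM (ger0_norm f0) -[leRHS]mul1r; apply: ler_pM => //.
have sk := sin_frac k0 kH.
have kp : 0 < k%:R / L%:R :> R by rewrite divr_gt0.
have s0 := mulr_gt0 LR (lt_le_trans kp sk).
have E : L%:R * sin (pi * (k%:R / L%:R)) * `|beta k| = `|sin (pi * (k%:R * gam))|.
  by rewrite -beta_closed [in RHS]normrM (gtr0_norm s0).
rewrite -[leRHS]mul1r ler_pdivlMr //.
have : `|beta k| * k%:R <= L%:R * sin (pi * (k%:R / L%:R)) * `|beta k|.
  rewrite mulrC ler_wpM2r //; apply: le_trans (_ : L%:R * (k%:R / L%:R) <= _).
    by rewrite mulrC divfK ?gt_eqF.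
  by rewrite ler_pM2l.
by rewrite E => /le_trans; apply; exact: sin_max.
Qed.

(** [L * sin (pi k / L) <= pi k], and [sin (pi k gam) >= pi k gam / 2] because [k * gam <= 1 / 2];
    so [beta k >= gam / 2], and the Fejer factor is at least [1 / 2]. *)
Lemma coef_ge k : k%:R * gam <= 1 / 2 -> (2 * k <= H)%N -> gam / 4 <= coef k.
Proof.
move=> kg k2; have g0 : 0 <= gam by rewrite divr_ge0 ?ler0n.
have [->|k0] := posnP k; first by rewrite coef0; lra.
have kH : (k < H)%N by lia.
rewrite /coef kH.
have fr : 1 / 2 <= (H - k)%:R / H%:R :> R.
  by rewrite ler_pdivlMr // mulrAC ler_pdivrMr // mul1r -natrM ler_nat; lia.
have sk := sin_frac k0 kH.
have kp : 0 < k%:R / L%:R :> R by rewrite divr_gt0 ?ltr0n.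
have pi0 := pi_gt0 R.
have su : sin (pi * (k%:R / L%:R) : R) <= pi * (k%:R / L%:R) by rewrite sin_le_id // mulr_ge0 // ltW.
have E := beta_closed k.
have sl : pi * (k%:R * gam) / 2 <= sin (pi * (k%:R * gam)).
  apply: sin_ge_half; apply/andP; split; first by rewrite !mulr_ge0 ?ler0n // ltW.
  by rewrite ler_pM2l // -div1r.
have kg0 : 0 <= k%:R * gam by rewrite mulr_ge0 ?ler0n.
have b0 : 0 <= beta k.
  have s0 := mulr_gt0 LR (lt_le_trans kp sk).
  by rewrite -(pmulr_rge0 _ s0) E; apply: le_trans sl; rewrite divr_ge0 // !mulr_ge0 // ltW.
have bl : gam / 2 <= beta k.
  have : pi * (k%:R * gam) / 2 <= pi * k%:R * beta k.
    apply: le_trans sl _; rewrite -E; apply: ler_wpM2r => //.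
    apply: le_trans (_ : L%:R * (pi * (k%:R / L%:R)) <= _); first by rewrite ler_pM2l.
    have -> // : L%:R * (pi * (k%:R / L%:R)) = pi * k%:R :> R.
    by field; rewrite gt_eqF.
  have pk : 0 < pi * k%:R :> R by rewrite mulr_gt0 ?ltr0n.
  by move=> h; rewrite -(ler_pM2l pk); apply: le_trans _ h; rewrite !mulrA.
by nra.
Qed.

Variables (T : finType) (x : T -> nat).
Hypothesis x0 : forall i, (0 < x i)%N.

Local Notation fhat := (fourier x H coef).

Lemma mean_majorant_cosq (N : nat) i (nu : int) :
  (`|nu| + H * x i < N)%N ->
  \sum_(s < N) majorant ((x i)%:R * (s%:R / N%:R)) * cosq (nu%:~R * (s%:R / N%:R)) =
  N%:R * \sum_(k < H | (k * x i == `|nu|)%N) coef k.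
Proof.
move=> NB; have xi := x0 i.
under eq_bigr => s _ do rewrite majorantE mulrDl mulr_suml.
rewrite big_split /= -mulr_sumr.
have E0 : \sum_(s < N) cosq (nu%:~R * (s%:R / N%:R)) = if nu == 0 then N%:R else 0 :> R.
  under eq_bigr => s _ do rewrite -[_ * _]add0r.
  by rewrite mean_cosq ?/cosq ?mulr0 ?cos0 ?mulr1 //; lia.
have Ek k : (0 < k)%N -> (k < H)%N ->
    \sum_(s < N) 2 * coef k * cosq (k%:R * ((x i)%:R * (s%:R / N%:R))) * cosq (nu%:~R * (s%:R / N%:R))
    = if (k * x i == `|nu|)%N then N%:R * coef k else 0.
  move=> k0 kH; have kx : (k * x i < H * x i)%N by rewrite ltn_pmul2r.
  pose a := (k * x i)%N.
  have Es s : 2 * coef k * cosq (k%:R * ((x i)%:R * (s%:R / N%:R))) * cosq (nu%:~R * (s%:R / N%:R)) =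
      coef k * cosq (0 + (a%:Z + nu)%:~R * (s%:R / N%:R)) + coef k * cosq (0 + (a%:Z - nu)%:~R * (s%:R / N%:R)).
    rewrite !add0r [k%:R * _]mulrA -natrM -/a -mulrA cosq_mul -mulrDl -mulrBl intrD intrB /=.
    by field.
  under eq_bigr => s _ do rewrite Es.
  rewrite big_split /= -!mulr_sumr !mean_cosq; try by rewrite /a; lia.
  have a0 : (0 < a)%N by rewrite muln_gt0 k0.
  rewrite -/a /cosq mulr0 cos0 mulr1.
  case: eqP => e1; case: eqP => e2; case: eqP => e3; try (exfalso; lia); ring.
rewrite E0 exchange_big /= (eq_big_nat _ _ (F2 := fun k => if (k * x i == `|nu|)%N then N%:R * coef k else 0)); last first.
  by move=> k /andP[k1 k2]; exact: Ek.
rewrite mulr_sumr [RHS]big_mkcond /= -(big_mkord xpredT (fun k => if (k * x i == `|nu|)%N then N%:R * coef k else 0)).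
rewrite [RHS]big_ltn //; congr (_ + _).
by rewrite mul0n (eq_sym 0%N) absz_eq0; case: ifP => _; rewrite ?mulr0 // mulrC.
Qed.

Lemma mean_cosq0 (N : nat) (nu : int) : (`|nu| < N)%N ->
  \sum_(s < N) cosq (nu%:~R * (s%:R / N%:R)) = if nu == 0 then N%:R else 0 :> R.
Proof.
move=> h; under eq_bigr => s _ do rewrite -[_ * _]add0r.
by rewrite mean_cosq ?/cosq ?mulr0 ?cos0 ?mulr1.
Qed.

(* Averaging [(\sum_i majorant (x i t) - c) * P t >= 0] over a grid fine enough
   to integrate the product exactly. *)
Lemma positivity (c : R) (J : finType) (b : J -> R) (nu : J -> int) :
  (forall t, c <= \sum_i majorant ((x i)%:R * t)) ->
  (forall t, 0 <= \sum_j b j * cosq ((nu j)%:~R * t)) ->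
  c * \sum_(j | nu j == 0) b j <= \sum_j b j * fhat `|nu j|.
Proof.
move=> hc hP.
pose N := (\sum_j `|nu j| + H * \sum_i x i).+1.
have N0 : 0 < N%:R :> R by rewrite ltr0n.
have NB i j : (`|nu j| + H * x i < N)%N.
  rewrite ltnS leq_add //; first by rewrite (bigD1 j) //= leq_addr.
  by rewrite leq_mul2l (bigD1 i) //= leq_addr orbT.
have NJ j : (`|nu j| < N)%N.
  by rewrite ltnS (bigD1 j) //= -addnA leq_addr.
have : 0 <= \sum_(s < N) (\sum_i majorant ((x i)%:R * (s%:R / N%:R)) - c) *
     \sum_j b j * cosq ((nu j)%:~R * (s%:R / N%:R)).
  by apply: sumr_ge0 => s _; rewrite mulr_ge0 // subr_ge0.
under eq_bigr => s _ do rewrite mulrBl mulr_suml.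
rewrite sumrB subr_ge0 => h.
rewrite -(ler_pM2l N0); move: h.
set A := \sum_(s < N) c * _; set B := \sum_(s < N) _.
have -> : A = N%:R * (c * \sum_(j | nu j == 0) b j).
  rewrite /A -mulr_sumr exchange_big /= mulrCA; congr (_ * _).
  rewrite [X in _ = _ * X]big_mkcond mulr_sumr; apply: eq_bigr => j _.
  by rewrite -mulr_sumr mean_cosq0 //; case: ifP; rewrite ?mulr0 // mulrC.
have -> // : B = N%:R * \sum_j b j * fhat `|nu j|.
rewrite /B exchange_big /= /fourier mulr_sumr.
under [RHS]eq_bigr => j _ do rewrite mulr_sumr mulr_sumr.
rewrite [RHS]exchange_big /=; apply: eq_bigr => i _.
under eq_bigr => s _ do rewrite mulr_sumr.
rewrite exchange_big /=; apply: eq_bigr => j _.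
rewrite mulrCA -mean_majorant_cosq // mulr_sumr; apply: eq_bigr => s _.
by rewrite mulrCA.
Qed.
End Kernel.

(** * Riesz products *)

(** For [E] a largest dissociated subset of [E0], every [w] in [E0] is a bounded combination of [E]
    up to a factor [c <= C]. The factorial of [C] clears all these factors at once, so that
    [diss_vec_card] compares [D] with [E]. *)
Lemma dim_transfer (T : finType) (x : T -> nat) (C KK u : nat) (D E0 : {set T}) :
  (0 < C)%N -> diss (fun i => (x i)%:Z) 1 D ->
  (forall d, d \in D -> exists w K, [/\ w \in E0, (K <= KK)%N & x d = (K * x w)%N]) ->
  ((2 * #|T| * (KK * C`! * C)).+1 <= 2 ^ u)%N ->
  exists E : {set T}, [/\ E \subset E0, diss (fun i => (x i)%:Z) C E & (#|D| <= u * #|E|)%N].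
Proof.
move=> C0 dD hD hu.
have [E [sE dE spanE]] := diss_span (fun i => (x i)%:Z) E0 C0.
exists E; split=> //.
have hY d : exists Y : T -> int, d \in D -> (forall e, `|Y e| <= (KK * C`! * C)%:Z) /\
    (C`!)%:Z * (x d)%:Z = \sum_(e in E) Y e * (x e)%:Z.
  case: (boolP (d \in D)) => dd; last by exists (fun=> 0).
  have [w [K [wE KKK xd]]] := hD d dd.
  have [c [y [/andP[c0 cC] yb yE]]] := spanE w wE.
  have cdv : (c %| C`!)%N by rewrite dvdn_fact // c0.
  exists (fun e => (K * (C`! %/ c))%:Z * y e) => _; split.
    move=> e; rewrite normrM; apply: le_trans (ler_wpM2l _ (yb e)) _ => //.
    rewrite ger0_norm // -PoszM lez_nat leq_mul2r leq_mul ?orbT // leq_div //.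
  under eq_bigr => e _ do rewrite -mulrA.
  rewrite -mulr_sumr -yE xd !PoszM -{1}(divnK cdv) PoszM; ring.
have [Y hYY] := choice hY.
have cne : (C`!)%:Z != 0 by have := fact_gt0 C; lia.
have := @diss_vec_card T T (fun i => (x i)%:Z) (fun i => (x i)%:Z) D E _ (KK * C`! * C)%N Y dD cne.
move=> /(_ (fun d e dd => (hYY d dd).1 e) (fun d dd => (hYY d dd).2)) h.
have : (2 ^ #|D| <= 2 ^ (u * #|E|))%N.
  apply: leq_trans h _; rewrite expnM; have [->//|e0] := posnP #|E|.
  rewrite leq_exp2r //; apply: leq_trans hu; rewrite ltnS leq_mul2r leq_mul2l max_card !orbT //.
by rewrite leq_exp2l.
Qed.

Section RieszProduct.
Variable (R : realType).
Import complex.ComplexField.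
Local Notation C := (complex.complex R).

Definition cis (t : R) : C := complex.Complex (cos t) (sin t).

Lemma cisD s t : cis (s + t) = cis s * cis t.
Proof. by rewrite /cis cosD sinD; congr complex.Complex; rewrite addrC mulrC. Qed.

Lemma cis0 : cis 0 = 1. Proof. by rewrite /cis cos0 sin0. Qed.

Definition wt (b : R) (j : 'I_3) : R := if j == 1 :> nat then 1 else b / 2.

Lemma riesz_factor b t :
  complex.Complex (1 + b * cos t) 0 =
  \sum_(j < 3) complex.Complex (wt b j) 0 * cis ((sgn3 j)%:~R * t).
Proof.
rewrite !big_ord_recl big_ord0 addr0 /wt /sgn3 /=.
rewrite mulrN1z mulN1r /cis cosN sinN mul0r cos0 sin0 mul1r.
have -> : (bump 0 (bump 0 0))%:Z - 1 = 1 by [].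
rewrite mul1r; congr complex.Complex; rewrite /=; lra.
Qed.

(** With complex exponentials each factor is a sum over three signs, and the expansion is
    distributivity; the real part is taken at the end. *)
Lemma riesz_expand (I : finType) (b t : I -> R) :
  \prod_i (1 + b i * cos (t i)) =
  \sum_(e : {ffun I -> 'I_3}) (\prod_i wt (b i) (e i)) * cos (\sum_i (sgn3 (e i))%:~R * t i).
Proof.
have rcM : {morph (fun r : R => complex.Complex r 0 : C) : u v / u * v >-> u * v}.
  by move=> u v; congr complex.Complex; rewrite ?mul0r ?mulr0 ?subr0 ?addr0.
have rc1 : (complex.Complex 1 0 : C) = 1 by [].
have ReD : {morph (@complex.Re R) : u v / u + v >-> u + v} by case=> ? ? [].
rewrite -[LHS]/(complex.Re (complex.Complex (\prod_i (1 + b i * cos (t i))) 0)).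
rewrite (big_morph _ rcM rc1).
under eq_bigr => i _ do rewrite riesz_factor.
rewrite bigA_distr_bigA (big_morph _ ReD (erefl _)); apply: eq_bigr => e _.
rewrite big_split /= -(big_morph _ rcM rc1) -(big_morph _ cisD cis0) /=.
by rewrite mul0r subr0.
Qed.

Variables (T : finType) (x : T -> nat) (E : {set T}).

Lemma wt_supp (b : T -> R) (e : {ffun T -> 'I_3}) : (forall i, i \notin E -> b i = 0) ->
  ~~ (supp3 e \subset E) -> \prod_i wt (b i) (e i) = 0.
Proof.
move=> b0 /fintype.subsetPn[i]; rewrite inE => ei iE.
by rewrite (bigD1 i) //= /wt (negbTE ei) b0 // !mul0r.
Qed.

Lemma wt_norm (a : R) (b : T -> R) (e : {ffun T -> 'I_3}) :
  (forall i, `|b i| <= a) -> `|\prod_i wt (b i) (e i)| <= (a / 2) ^+ #|supp3 e|.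
Proof.
move=> ba; rewrite normr_prod -prodr_const [leRHS]big_mkcond.
apply: ler_prod => i _; rewrite normr_ge0 /= /wt inE.
case: ifP => _ /=; first by rewrite normr1.
by rewrite normrM (ger0_norm (_ : 0 <= 2^-1)) ?invr_ge0 // ler_wpM2r ?invr_ge0.
Qed.

Definition single (p : T * bool) : {ffun T -> 'I_3} :=
  [ffun k => if k == p.1 then (if p.2 then inord 2 else inord 0) else inord 1].

Lemma supp_single p : supp3 (single p) = [set p.1].
Proof.
apply/setP => k; rewrite !inE ffunE; case: (k == p.1) => /=; last by rewrite inordK.
by case: p.2; rewrite inordK.
Qed.

Lemma single_inj : injective single.
Proof.
move=> [i b] [j c] E1.
have /set1_inj ij : [set i] = [set j] by rewrite -(supp_single (i, b)) -(supp_single (j, c)) E1.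
subst j; congr (_, _); have /ffunP/(_ i) := E1; rewrite !ffunE /= eqxx.
by case: b {E1}; case: c => // /(congr1 val) /=; rewrite !inordK.
Qed.

Lemma supp1_single (G : {ffun T -> 'I_3} -> R) :
  \sum_(e | #|supp3 e| == 1%N) G e = \sum_i (G (single (i, true)) + G (single (i, false))).
Proof.
have E1 : [set e : {ffun T -> 'I_3} | #|supp3 e| == 1%N] = single @: [set: T * bool].
  apply/setP => e; rewrite inE; apply/idP/imsetP => [/cards1P[i Si]|[p _ ->]]; last first.
    by rewrite supp_single cards1.
  exists (i, e i == 2 :> nat) => //; apply/ffunP => k; rewrite ffunE /=; apply/val_inj.
  have := congr1 (fun S : {set T} => k \in S) Si; rewrite !inE.
  case: (eqVneq k i) => [->|_]; last by move/negbFE/eqP => ek; rewrite /= ek inordK.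
  by case: (e i) => -[|[|[|m]]] //= _ _; rewrite inordK.
rewrite (eq_bigl (fun e => e \in single @: [set: T * bool])); last first.
  by move=> e; rewrite -E1 inE.
rewrite big_imset /=; last by move=> ? ? _ _; exact: single_inj.
rewrite (eq_bigl xpredT); last by move=> p; rewrite inE.
rewrite -(pair_bigA _ (fun i c => G (single (i, c)))) /=.
by apply: eq_bigr => i _; rewrite big_bool.
Qed.

Lemma signed_sum_single i c : signed_sum x (single (i, c)) = if c then (x i)%:Z else - (x i)%:Z.
Proof.
rewrite (@signed_sumE _ x [set i]) ?supp_single // big_set1 ffunE eqxx /sgn3.
by case: c; rewrite inordK // ?mul1r // sub0r mulN1r.
Qed.

Lemma wt_single (b : T -> R) i c : \prod_k wt (b k) (single (i, c) k) = b i / 2.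
Proof.
rewrite (bigD1 i) //= big1 ?mulr1.
  by rewrite /wt ffunE eqxx; case: c; rewrite inordK.
by move=> k ki; rewrite /wt ffunE /= (negbTE ki) inordK.
Qed.

Variables (F : nat -> R) (c0 : R).
Hypothesis Hpos : forall (J : finType) (b : J -> R) (nu : J -> int),
  (forall t : R, 0 <= \sum_j b j * cosq ((nu j)%:~R * t)) ->
  c0 * \sum_(j | nu j == 0) b j <= \sum_j b j * F `|nu j|.

(** The coefficient at [i] is [- a] times the sign of [F (lam * x i)]. By dissociation only the zero
    sign vector has frequency 0, so the mean of the product is 1; the two sign vectors supported at
    [i] together contribute [- a * |F (lam * x i)|]. *)
Lemma riesz_bound (a : R) (lam : nat) : (0 < lam)%N -> 0 <= a <= 1 ->
  diss (fun i => (x i)%:Z) 1 E ->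
  c0 + a * \sum_(i in E) `|F (lam * x i)%N| <= F 0%N +
    \sum_(e : {ffun T -> 'I_3} | (supp3 e \subset E) && (2 <= #|supp3 e|)%N)
      (a / 2) ^+ #|supp3 e| * `|F `|(lam%:Z * signed_sum x e)%R|%N|.
Proof.
move=> l0 /andP[a0 a1] dE.
pose b i : R := if i \in E then - (a * Num.sg (F (lam * x i)%N)) else 0.
have b0 i : i \notin E -> b i = 0 by rewrite /b => /negbTE->.
have ba i : `|b i| <= a.
  rewrite /b; case: ifP => _; last by rewrite normr0.
  rewrite normrN normrM (ger0_norm a0) -[leRHS]mulr1 ler_wpM2l // normr_sg.
  by case: (_ != _).
pose w (e : {ffun T -> 'I_3}) := \prod_i wt (b i) (e i).
pose nu (e : {ffun T -> 'I_3}) : int := lam%:Z * signed_sum x e.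
have /(Hpos (b := w) (nu := nu)) : forall t : R, 0 <= \sum_e w e * cosq ((nu e)%:~R * t).
  move=> t; apply: (@le_trans _ _ (\prod_i (1 + b i * cos (2 * pi * (lam%:R * (x i)%:R * t))))).
    apply: prodr_ge0 => i _; have := ler_pM (normr_ge0 _) (normr_ge0 _) (ba i) (cos_max (2 * pi * (lam%:R * (x i)%:R * t))).
    by rewrite -normrM mulr1 ler_norml => /andP[h1 h2]; lra.
  rewrite riesz_expand le_eqVlt; apply/orP; left; apply/eqP.
  apply: eq_bigr => e _; congr (_ * _); rewrite /cosq; congr cos.
  rewrite /nu /signed_sum intrM rmorph_sum /= mulr_sumr mulr_suml mulr_sumr.
  by apply: eq_bigr => i _; rewrite intrM /=; ring.
have Z : \sum_(e | nu e == 0) w e = 1.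
  pose e0 : {ffun T -> 'I_3} := [ffun=> inord 1].
  have s0 : supp3 e0 = finset.set0 by apply/setP => i; rewrite !inE ffunE inordK.
  have n0 : nu e0 == 0 by rewrite /nu (@signed_sumE _ x finset.set0) ?s0 // big_set0 mulr0.
  rewrite (bigD1 e0) //= big1 ?addr0.
    by rewrite /w big1 // => i _; rewrite /wt ffunE inordK.
  move=> e /andP[/eqP ne ee0]; apply/eqP; apply: contraNT ee0 => we.
  have sE : supp3 e \subset E.
    by apply: contraNT we => /(wt_supp b0) h; apply/eqP.
  apply/eqP/ffunP => i; rewrite ffunE; apply/val_inj; rewrite /= inordK //.
  case: (boolP (i \in E)) => iE; last first.
    by apply/eqP; have := contraNN (fintype.subsetP sE i) iE; rewrite inE negbK.
  have : sgn3 (e i) = 0.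
    apply: (dE (fun i => sgn3 (e i))) => // [k|]; first exact: sgn3_bound.
    rewrite -signed_sumE //; move/eqP: ne; rewrite /nu mulf_eq0 => /orP[|/eqP//].
    by move=> h; exfalso; lia.
  by rewrite /sgn3 => ?; lia.
rewrite Z mulr1 => h.
suff : \sum_e w e * F `|nu e|%N <= F 0%N - a * \sum_(i in E) `|F (lam * x i)%N| +
    \sum_(e : {ffun T -> 'I_3} | (supp3 e \subset E) && (2 <= #|supp3 e|)%N)
      (a / 2) ^+ #|supp3 e| * `|F `|(lam%:Z * signed_sum x e)%R|%N| by lra.
rewrite (bigID (fun e => 2 <= #|supp3 e|)%N) /= [leRHS]addrC; apply: lerD.
  rewrite [leLHS]big_mkcond [leRHS]big_mkcond; apply: ler_sum => e _.
  case: (boolP (supp3 e \subset E)) => sE /=; last by case: ifP => // _; rewrite /w wt_supp // mul0r.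
  case: ifP => // _; apply: le_trans (ler_norm _) _; rewrite normrM.
  by apply: ler_wpM2r => //; exact: wt_norm.
rewrite (bigID (fun e => #|supp3 e| == 1%N)) /= [leRHS]addrC; apply: lerD.
  rewrite (eq_bigl (fun e => #|supp3 e| == 1%N)); last first.
    by move=> e /=; case: eqP => [->|_]; rewrite ?andbF.
  rewrite supp1_single (bigID (mem E)) /= [X in _ + X]big1 ?addr0; last first.
    by move=> i iE; rewrite /w !wt_single b0 // !mul0r addr0.
  rewrite mulr_sumr -sumrN; apply: ler_sum => i iE.
  rewrite /w !wt_single /nu !signed_sum_single mulrN abszN -PoszM absz_nat /b iE.
  by rewrite (normrEsg (F _)) le_eqVlt; apply/orP; left; apply/eqP; field.
pose e0 : {ffun T -> 'I_3} := [ffun=> inord 1].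
have s0 : supp3 e0 = finset.set0 by apply/setP => i; rewrite !inE ffunE inordK.
rewrite (big_pred1 e0) /=.
  rewrite /w big1 ?mul1r.
    by rewrite /nu (@signed_sumE _ x finset.set0) ?big_set0 ?mulr0 // s0.
  by move=> i _; rewrite /wt ffunE inordK.
move=> e /=; rewrite -leqNgt; apply/andP/eqP => [[h1 h2]|->]; last first.
  by rewrite s0 cards0.
have : #|supp3 e| = 0%N by move/eqP: h2; lia.
move/eqP; rewrite cards_eq0 => /eqP se; apply/ffunP => i; rewrite ffunE; apply/val_inj => /=.
have ie : i \notin supp3 e by rewrite se inE.
by move: ie; rewrite inE negbK inordK // => /eqP.
Qed.
End RieszProduct.

Section RieszError.
Variables (R : realType) (T : finType) (x : T -> nat) (E : {set T}).
Hypothesis x0 : forall i, (0 < x i)%N.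
Variables (H : nat) (cf : nat -> R) (gam : R).
Hypothesis cf_norm : forall k, `|cf k| <= gam.

Lemma fourier_norm m :
  `|fourier x H cf m| <= \sum_i gam * [exists k : 'I_H, k * x i == m]%N%:R.
Proof.
apply: le_trans (ler_norm_sum _ _ _) _; apply: ler_sum => i _.
have g0 : 0 <= gam by apply: le_trans (cf_norm 0); exact: normr_ge0.
case: existsP => [[k /eqP km]|nk]; last first.
  rewrite mulr0 big1 ?normr0 // => k km; exfalso; apply: nk; by exists k.
rewrite mulr1 (bigD1 k) ?km //= big1 ?addr0 // => k' /andP[/eqP km' /eqP kk'].
case: kk'; apply/val_inj => /=; apply/eqP.
by rewrite -(eqn_pmul2r (x0 i)) km km'.
Qed.

(** A sign vector matters only if its frequency is a multiple, by less than [H], of some [x i]. For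
    supports of size at most [J], [multiples_card] gives a count depending on [r] and [J] alone; for
    larger ones the trivial count [2 * H + 1] is offset by [al ^+ J.+1]. *)
Lemma riesz_error (al : R) (lam C r J : nat) : (0 < lam)%N -> 0 <= al <= 1 ->
  diss (fun i => (x i)%:Z) C E -> (r < C)%N -> (2 <= C)%N ->
  (forall r', (2 ^ r' <= r' * (2 * H) + 1)%N -> (r' <= r)%N) ->
  \sum_(e : {ffun T -> 'I_3} | (supp3 e \subset E) && (2 <= #|supp3 e|)%N)
      al ^+ #|supp3 e| * `|fourier x H cf `|(lam%:Z * signed_sum x e)%R|%N| <=
  gam * #|T|%:R * (((2 * (r * J)).+1 ^ J)%:R * al ^+ 2 + (2 * H).+1%:R * al ^+ J.+1).
Proof.
move=> l0 /andP[al0 al1] dE rC C2 rX.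
have g0 : 0 <= gam by apply: le_trans (cf_norm 0); exact: normr_ge0.
pose hit i (e : {ffun T -> 'I_3}) := [exists k : 'I_H, k * x i == `|(lam%:Z * signed_sum x e)%R|]%N.
apply: le_trans (_ : \sum_(e : {ffun T -> 'I_3} | (supp3 e \subset E) && (2 <= #|supp3 e|)%N)
   \sum_i gam * ((hit i e)%:R * al ^+ #|supp3 e|) <= _).
  apply: ler_sum => e _; apply: le_trans (ler_wpM2l _ (fourier_norm _)) _; first exact: exprn_ge0.
  by rewrite mulr_sumr; apply: ler_sum => i _; rewrite mulrCA [_ * _%:R]mulrC.
rewrite exchange_big /= -mulrA mulr_natl mulrnAr -sumr_const.
apply: ler_sum => i _; rewrite -mulr_sumr; apply: ler_wpM2l => //.
pose kap (e : {ffun T -> 'I_3}) : int := ((lam%:Z * signed_sum x e) %/ (x i)%:Z)%Z.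
have kapP e : hit i e -> `|kap e| <= H%:Z /\ lam%:Z * signed_sum x e = kap e * (x i)%:Z.
  case/existsP => k /eqP kE; have xi := x0 i.
  have dv : ((x i)%:Z %| lam%:Z * signed_sum x e)%Z.
    by rewrite dvdzE absz_nat -kE dvdn_mull.
  have E1 : lam%:Z * signed_sum x e = kap e * (x i)%:Z by rewrite /kap divzK.
  split=> //; move: kE; rewrite E1 abszM absz_nat => /eqP; rewrite eqn_pmul2r // => /eqP kE.
  by have := ltn_ord k; lia.
pose S1 := [set e : {ffun T -> 'I_3} | [&& supp3 e \subset E, (2 <= #|supp3 e|)%N, hit i e & (#|supp3 e| <= J)%N]].
pose S2 := [set e : {ffun T -> 'I_3} | [&& supp3 e \subset E, (2 <= #|supp3 e|)%N, hit i e & ~~ (#|supp3 e| <= J)%N]].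
have c1 : (#|S1| <= (2 * (r * J)).+1 ^ J)%N.
  apply: (@multiples_card T x E C H lam (x i) l0 (x0 i) r J S1 kap) => // e.
  by rewrite inE => /and4P[h1 h2 h3 h4]; have [h5 h6] := kapP e h3.
have c2 : (#|S2| <= (2 * H).+1)%N.
  apply: (@multiples_card_trivial T x E H lam (x i) l0 (x0 i) S2 kap).
    exact: diss_leq dE.
  by move=> e; rewrite inE => /and4P[h1 h2 h3 h4]; have [h5 h6] := kapP e h3.
rewrite (bigID (fun e => #|supp3 e| <= J)%N) /=; apply: lerD.
  apply: le_trans (_ : \sum_(e in S1) al ^+ 2 <= _); last first.
    by rewrite sumr_const -(mulr_natl _ #|S1|) ler_wpM2r ?exprn_ge0 // ler_nat.
  rewrite big_mkcond [leRHS]big_mkcond; apply: ler_sum => e _; rewrite inE.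
  case: (boolP (supp3 e \subset E)) => //= _; case: (leqP 2 #|supp3 e|) => //= s2.
  case: (hit i e); case: (#|supp3 e| <= J)%N => //=; rewrite ?mul0r ?mul1r //.
  exact: ler_wiXn2l.
apply: le_trans (_ : \sum_(e in S2) al ^+ J.+1 <= _); last first.
  by rewrite sumr_const -(mulr_natl _ #|S2|) ler_wpM2r ?exprn_ge0 // ler_nat.
rewrite big_mkcond [leRHS]big_mkcond; apply: ler_sum => e _; rewrite inE.
case: (boolP (supp3 e \subset E)) => //= _; case: (leqP 2 #|supp3 e|) => //= s2.
case: (hit i e); case: (leqP #|supp3 e| J) => //= sJ; rewrite ?mul0r ?mul1r //.
exact: ler_wiXn2l.
Qed.

End RieszError.

Section CosBound.
Variables (R : realType) (F : nat -> R) (c0 : R).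
Hypothesis Hpos : forall (J : finType) (b : J -> R) (nu : J -> int),
  (forall t : R, 0 <= \sum_j b j * cosq ((nu j)%:~R * t)) ->
  c0 * \sum_(j | nu j == 0) b j <= \sum_j b j * F `|nu j|.

(** The test polynomial is [1 - cos (2 pi m t)]. *)
Lemma coefficient_le m : (0 < m)%N -> c0 + F m <= F 0%N.
Proof.
move=> m0; have := @Hpos bool (fun j => if j then -1 else 1) (fun j => if j then m%:Z else 0).
rewrite !big_bool /= [X in c0 * X](_ : _ = 1).
  move=> h; have : c0 * 1 <= -1 * F m + 1 * F 0%N by apply: h => t; rewrite big_bool /= mul0r mul1r mulN1r /cosq mulr0 cos0; have := cos_le1 (2 * pi * (m%:~R * t)); lra.
  lra.
rewrite big_mkcond big_bool /= (_ : (m%:Z == 0) = false) ?add0r //.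
by apply/negbTE; lia.
Qed.
End CosBound.

Local Close Scope ring_scope.

(** * The large spectrum *)

Lemma poly_le_exp A B M : 0 < M ->
  exists q0, forall q, q0 <= q -> A * q ^ B <= 2 ^ (q %/ M).
Proof.
move=> M0; pose k := B.+1; exists (A * M ^ B * k ^ k * M) => q hq.
set t := q %/ M; have tq : A * M ^ B * k ^ k <= t by rewrite leq_divRL.
have qt : q <= t.+1 * M by exact/ltnW/ltn_ceil.
apply: leq_trans (_ : A * M ^ B * t.+1 ^ B <= _).
  rewrite -mulnA leq_mul2l; apply/orP; right.
  rewrite mulnC -expnMn; case: (B) => // B'; by rewrite leq_exp2r.
rewrite -(leq_pmul2r (ltn0Sn t)) -mulnA -expnSr -/k.
apply: leq_trans (leq_mul (leqnn _) (succ_exp_le t (ltn0Sn B))) _.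
by rewrite -/k mulnA mulnC leq_mul2l; apply/orP; right; apply: leq_trans tq _.
Qed.

Lemma fact_le_exp C : C`! <= 2 ^ (C * C).
Proof.
elim: C => // C IH; rewrite factS.
apply: leq_trans (leq_mul (ltn_expl C (isT : 1 < 2)) IH) _.
by rewrite -expnD leq_exp2l //; lia.
Qed.

Section LargeScales.
Variables (m Q : nat).
Hypotheses (m12 : 12 <= m) (Q2 : 2 < Q).
Let MM := 2 * Q * m.
Let b := (2 * MM).+1.
Let J := (26 * MM).+1.

(** The unit [g] of loss: [2 ^ g] is a small power of [n], yet beats powers of [log n] and numbers
    of divisors. Applying [dichotomy] with [2 * g] takes [Q * (2 * g)] scales, which is at most
    [q / m], and [m] will be of order [1 / eps]. *)
Definition step q := q %/ (2 * Q * m).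

(** The depth [b] of the descent satisfies [q < g * b], so that a growth by [2 ^ g] per layer
    exceeds [n]. The threshold [J] between short and long sign vectors comes from
    [13 * q <= g * (26 * MM)]. *)
Record large (q : nat) : Prop := Large {
  large_q : 100 <= q;
  large_step : 0 < step q;
  large_mul : q <= step q * (2 * MM);
  large_I : Q * (2 * step q) * m <= q;
  large_p1 : 3072 * b.+1 * q ^ 3 <= 2 ^ step q;
  large_p5 : 8 * (12 * b + 1000) * q ^ 3 <= 2 ^ step q;
  large_p6 : 32 * (61 * J) ^ J * q ^ J <= 2 ^ step q;
  large_div : forall K, 0 < K -> K <= 2 ^ (12 * q * b) -> size (divisors K) <= 2 ^ step q }.

Lemma eventually_large : exists q0, forall q, q0 <= q -> large q.
Proof.
have MM0 : 0 < MM by rewrite /MM !muln_gt0 /=; lia.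
have [a1 h1] := poly_le_exp (3072 * b.+1) 3 MM0.
have [a2 h2] := poly_le_exp (8 * (12 * b + 1000)) 3 MM0.
have [a3 h3] := poly_le_exp (32 * (61 * J) ^ J) J MM0.
(* With this [k], [divisor_bound] gives at most [ck * 2 ^ (12 * q * b) <= 2 ^ (13 * b * q) <= (2 ^
   g) ^ k], once [q >= ck]. *)
pose k := 13 * b * (2 * MM); pose ck := (k ^ k) ^ (2 ^ k).
exists (maxn (maxn 100 MM) (maxn (maxn a1 a2) (maxn a3 ck))) => q.
rewrite !geq_max => /and3P[/andP[q100 qM] /andP[q1 q2] /andP[q3 qc]].
have g0 : 0 < step q by rewrite divn_gt0.
have qg : q <= step q * (2 * MM).
  have := ltn_ceil q MM0; rewrite -/(step q) => h.
  by apply: leq_trans (ltnW h) _; rewrite mulnCA mulnA leq_mul2r; apply/orP; right; lia.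
have M2 : 0 < 2 * MM by lia.
have k0 : 0 < k by rewrite /k muln_gt0 M2 andbT.
split=> //; [|exact: h1|exact: h2|exact: h3|].
  rewrite (_ : Q * (2 * step q) * m = step q * MM); first exact: leq_trunc_div.
  by rewrite /MM; lia.
move=> K K0 KH; rewrite -(leq_exp2r _ _ k0).
apply: leq_trans (divisor_bound k0 K0) _; rewrite -/ck.
apply: leq_trans (leq_mul (leq_trans qc (ltnW (ltn_expl q (isT : 1 < 2)))) KH) _.
rewrite -expnD -expnM leq_exp2l //.
apply: leq_trans (_ : 13 * b * q <= _); first by rewrite /b; lia.
by rewrite /k mulnCA leq_mul2l qg orbT.
Qed.
End LargeScales.

Section Spectrum.
Variables (R : realType) (m Q : nat).
Hypotheses (m12 : 12 <= m) (Q2 : 2 < Q) (QE : (Q%:R = 2 ^+ 14 :> R)%R).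
Let MM := 2 * Q * m.
Let b := (2 * MM).+1.
Variable q : nat.
Hypothesis qlarge : large m Q q.
Let g := step m Q q.
Let I := Q * (2 * g).
Let H := 2 ^ (12 * q).
Variables (T : finType) (x : T -> nat).
Hypotheses (x0 : forall i, 0 < x i) (x_inj : injective x).
Hypotheses (nlo : 2 ^ q.-1 <= #|T|) (nhi : #|T| <= 2 ^ q).
Variables (cf : nat -> R) (gam : R).
Hypothesis cf_large : forall k, H <= k -> cf k = 0%R.
Hypothesis cf_decay : forall k, 0 < k -> (`|cf k| <= k%:R^-1)%R.
Hypothesis cf_ge : forall k, (k%:R * gam <= 1 / 2)%R -> 2 * k <= H -> (gam / 4 <= cf k)%R.
Hypotheses (glo : (1 <= gam * #|T|%:R)%R) (ghi : (gam * #|T|%:R <= 3)%R).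
Variable D : {set T}.
Hypothesis dD : diss (fun i => Posz (x i)) 2 D.
Hypothesis Dlo : 2 ^ q <= #|D| ^ 2.

Let q100 : 100 <= q. Proof. by case: qlarge. Qed.
Let g0 : 0 < g. Proof. by case: qlarge. Qed.
Let gI : g <= I. Proof. rewrite /I; nia. Qed.
Let I12 : 12 * I <= q.
Proof.
case: qlarge => _ _ _ h _ _ _ _; rewrite -/g -/I in h.
by apply: leq_trans h; rewrite mulnC leq_mul2l m12 orbT.
Qed.
Let n0 : 0 < #|T|. Proof. by apply: leq_trans nlo; rewrite expn_gt0. Qed.
Let I3 : 6 <= I. Proof. rewrite /I; nia. Qed.
Let gexpI : 2 ^ g <= 2 ^ I. Proof. by rewrite leq_exp2l. Qed.

(** For [l] in this window, [l * 2 ^ s <= n / 8] keeps the coefficients at [l * t] above [gam / 4]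
    for [t <= 2 ^ s], while [n <= l * 2 ^ (s + 8)] limits the terms of size [1 / (l * t)]. *)
Let ps s := primes_in (2 ^ (q - 8 - s)) (2 ^ (q - 4 - s)).

Let ps_size s : s <= I -> 2 ^ (q - I) <= 64 * q * size (ps s).
Proof.
move=> sI; have s16 : 16 <= q - 5 - s by lia.
have h := many_primes s16.
have E1 : q - 5 - s - 3 = q - 8 - s by lia.
have E2 : (q - 5 - s).+1 = q - 4 - s by lia.
have E3 : (q - 5 - s).-1 = q - 6 - s by lia.
move: h; rewrite E1 E2 E3 -/(ps s) => h.
have E4 : 2 ^ (q - s) = 64 * 2 ^ (q - 6 - s).
  by rewrite (_ : 64 = 2 ^ 6) // -expnD; congr (2 ^ _); lia.
apply: leq_trans (_ : 2 ^ (q - s) <= _); first by rewrite leq_exp2l //; lia.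
rewrite E4 -mulnA leq_pmul2l //; apply: leq_trans h _.
by rewrite leq_mul2r; apply/orP; right; lia.
Qed.

Let y := 12 * q * b.+1.
(** [r1] separates sparse from dense [d], and [vb] bounds the vertices to avoid in the dense case.
    Both are affordable because every scale has at least [2 ^ (q - I)] primes up to a factor
    [64 * q]. *)
Let r1 := 2 ^ (q - 3 * I).
Let vb := 2 ^ (2 * I).
Let rho := 2 * y + 6.

Let q2q3 : q ^ 2 <= q ^ 3. Proof. by rewrite leq_exp2l //; lia. Qed.

Let p1 : 3072 * b.+1 * q ^ 3 <= 2 ^ I.
Proof. by case: qlarge => _ _ _ _ h _ _ _; apply: leq_trans h gexpI. Qed.

Let yA s : s <= I -> 4 * I.+1 * (r1 * y) <= size (ps s).
Proof.
move=> sI; have h := ps_size sI; have q0 : 0 < 64 * q by lia.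
rewrite -(leq_pmul2l q0); apply: leq_trans h.
apply: leq_trans (_ : r1 * (3072 * b.+1 * q ^ 3) <= _).
  rewrite (_ : 64 * q * (4 * I.+1 * (r1 * y)) = r1 * (256 * I.+1 * q * y)); last by ring.
  rewrite leq_mul2l; apply/orP; right; rewrite /y.
  apply: leq_trans (_ : 256 * q * q * (12 * q * b.+1) <= _); first by rewrite !leq_mul //; lia.
  by rewrite leq_eqVlt; apply/orP; left; apply/eqP; ring.
apply: leq_trans (leq_mul (leqnn _) p1) _.
by rewrite /r1 -expnD leq_exp2l //; lia.
Qed.

Let yB s : s <= I -> #|T| * (4 * y) <= vb * size (ps s).
Proof.
move=> sI; have h := ps_size sI; have q0 : 0 < 64 * q by lia.
rewrite -(leq_pmul2l q0); apply: leq_trans (_ : vb * 2 ^ (q - I) <= _); last first.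
  by rewrite [leqRHS]mulnCA leq_mul2l h orbT.
apply: leq_trans (_ : 2 ^ q * 2 ^ I <= _); last by rewrite /vb -!expnD leq_exp2l //; lia.
rewrite mulnCA; apply: leq_mul => //; apply: leq_trans p1.
rewrite /y; apply: leq_trans (_ : 3072 * b.+1 * q ^ 2 <= _).
  by rewrite leq_eqVlt; apply/orP; left; apply/eqP; ring.
by apply: leq_mul; [rewrite leq_mul2r; apply/orP; right; lia | exact: q2q3].
Qed.

Let hD : 8 * #|T| * (I.+1 * (2 * rho * vb)) <= #|D| * r1.
Proof.
(* [12 * I <= q] turns [Dlo] into [2 ^ (6 * I)], which pays for the exponents [3 * I] of [r1],
   [2 * I] of [vb] and [I] for logarithmic factors. *)
have DI : 2 ^ (6 * I) <= #|D|.
  rewrite -(leq_exp2r _ _ (isT : 0 < 2)) -expnM; apply: leq_trans Dlo.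
  by rewrite leq_exp2l //; lia.
apply: leq_trans (leq_mul DI (leqnn _)).
apply: leq_trans (_ : 2 ^ q * (2 ^ I * 2 ^ (2 * I)) <= _); last first.
  by rewrite /r1 -!expnD leq_exp2l //; lia.
rewrite (_ : 8 * #|T| * (I.+1 * (2 * rho * vb)) = #|T| * ((16 * I.+1 * rho) * vb)); last by ring.
apply: leq_mul => //; apply: leq_mul => //; apply: leq_trans p1.
apply: leq_trans (_ : 16 * (2 * q) * (30 * q * b.+1) <= _).
  apply: leq_mul; first by lia.
  by rewrite /rho /y; nia.
apply: leq_trans (_ : 960 * b.+1 * q ^ 2 <= _); last first.
  by apply: leq_mul; [rewrite leq_mul2r; apply/orP; right; lia | exact: q2q3].
by rewrite leq_eqVlt; apply/orP; left; apply/eqP; ring.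
Qed.

Let E0 l := [set w | (gam / 8 <= fourier x H cf (l * x w))%R].

(** A vertex outside the spectrum has [2 ^ (2 * g)] close divisors, while the quotients met have at
    most [2 ^ g] divisors. Layers of the descent would thus grow by [2 ^ g] each and exceed [n]
    after [b] steps. *)
Lemma flat_reaches_spectrum (lam : nat -> nat) (d : T) :
  (forall s, s <= I -> lam s \in ps s) ->
  (forall s, s <= I -> flat_below x (12 * q) b d (lam s)) ->
  exists s w K, [/\ s <= I, w \in E0 (lam s), K <= H ^ b & x d = K * x w].
Proof.
move=> hlam fl.
have gam0 : (0 <= gam)%R.
  have nR : (0 < #|T|%:R :> R)%R by rewrite ltr0n.
  by rewrite -(pmulr_lge0 _ nR); apply: le_trans glo.
pose S w := [exists s : 'I_I.+1, w \in E0 (lam s)].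
have [] := @bounded_descent T x x0 x_inj (12 * q) d S b (2 ^ (2 * g)) (2 ^ g).
- move=> w K Kb xd nS.
  have [||[s sI sp]|//] := @dichotomy R T x x0 (12 * q) cf gam gam0 cf_large cf_decay cf_ge Q QE w lam (2 * g).
  + by rewrite -/I; lia.
  + move=> s sI; rewrite -/I in sI; have := hlam s sI; rewrite mem_primes_in => /and3P[pl l1 l2].
    have l3 : lam s * 2 ^ s <= 2 ^ (q - 4).
      apply: leq_trans (leq_mul l2 (leqnn _)) _; by rewrite -expnD leq_exp2l //; lia.
    have l4 : 2 ^ q <= lam s * 2 ^ (s + 8).
      apply: leq_trans (_ : 2 ^ (q - 8 - s) * 2 ^ (s + 8) <= _); first by rewrite -expnD leq_exp2l //; lia.
      by rewrite leq_mul2r ltnW ?orbT.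
    split; [exact: (fl s sI w K) | exact: prime_gt0 | | |].
    * have : lam s * 2 ^ s * 8 <= #|T|.
        apply: leq_trans nlo; apply: leq_trans (leq_mul l3 (leqnn 8)) _.
        by rewrite -[8]/(2 ^ 3) -expnD leq_exp2l //; lia.
      rewrite -(ler_nat R) natrM => h; have := ler_wpM2l gam0 h.
      by move: ((lam s * 2 ^ s)%:R)%R => u; move: (#|T|%:R)%R h ghi => v h ghi'; nra.
    * apply: leq_trans (leq_mul (leqnn 2) l3) _; rewrite -expnS leq_exp2l //; lia.
    * apply: le_trans glo _; rewrite mulrC; apply: ler_wpM2r => //.
      by rewrite ler_nat; apply: leq_trans nhi l4.
  exfalso; move/negP: nS; apply; apply/existsP; rewrite -/I in sI.
  by exists (Ordinal (sI : s < I.+1)); rewrite inE.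
- by move=> K K0 KH; case: qlarge => _ _ _ _ _ _ _; apply => //; rewrite expnM.
- have h1 : #|T| < 2 ^ (g * b).
    apply: leq_ltn_trans nhi _; rewrite ltn_exp2l //; case: qlarge => _ _ h _ _ _ _ _.
    by apply: leq_ltn_trans h _; rewrite ltn_pmul2l.
  by rewrite mul2n -addnn expnD expnMn -[(2 ^ g) ^ b]expnM ltn_pmul2r // expn_gt0.
move=> w [K [/existsP[s ws] KH xd]].
by exists s, w, K; split=> //; rewrite -ltnS.
Qed.

(** [C.-1] is the bound from [pow2_linear_bound] on the size of a dissociated set of integers up to
    [H = 2 ^ (12 * q)], so the level exceeds that size. *)
Let C := 24 * q + 7.
Let u := 2 + q + 12 * q * b + C * C + C.

(** One [l] must serve all of [E], so only the most frequent of the [I.+1] scales is kept. The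
    losses are [4 * 2 ^ (3 * I)] from [select_flat], [I.+1] from the scale and [u] from
    [dim_transfer], together at most [2 ^ (4 * I)]. *)
Lemma large_spectrum : exists l, 0 < l /\ exists E : {set T},
  [/\ diss (fun i => Posz (x i)) C E, #|D| <= 2 ^ (4 * I) * #|E| &
    forall e, e \in E -> (gam / 8 <= fourier x H cf (l * x e))%R].
Proof.
have dD1 : diss (fun i => Posz (x i)) 1 D by exact: diss_leq dD.
have HY : (2 ^ (12 * q)) ^ b.+1 <= 2 ^ y by rewrite -expnM leqnn.
have rhoP r : 2 ^ r <= r * (2 * 2 ^ y) + 1 -> r <= rho.
  by rewrite -expnS => /pow2_linear_bound; rewrite /rho; lia.
have psN s : s <= I -> ps s != [::].
  by move=> /ps_size; case: (ps s) => //=; rewrite muln0 leqNgt expn_gt0.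
have psY s l : s <= I -> l \in ps s -> l <= 2 ^ y.
  move=> sI; rewrite mem_primes_in => /and3P[_ _ h]; apply: leq_trans h _.
  have qy : q <= y by rewrite /y -mulnA mulnCA leq_pmulr.
  by rewrite leq_exp2l //; lia.
have r1n : r1 <= #|T| by apply: leq_trans nlo; rewrite /r1 leq_exp2l //; lia.
have [lam [hlam [D' sD' [cD' fl]]]] := @select_flat T x x0 (12 * q) b y HY D dD1 rho rhoP I r1 vb ps
  (fun s => primes_in_uniq _ _) (fun s => primes_in_all _ _) psY psN yA yB r1n hD.
pose Ds s := [set d in D' | [exists w, (w \in E0 (lam s)) && [exists K : 'I_(H ^ b).+1, x d == K * x w]]].
have cov : D' \subset \bigcup_(s < I.+1) Ds s.
  apply/fintype.subsetP => d dD'.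
  have [s [w [K [sI wE KH xd]]]] := flat_reaches_spectrum hlam (fun s sI => fl d s dD' sI).
  apply/bigcupP; exists (Ordinal (sI : s < I.+1)) => //; rewrite inE dD' /=.
  apply/existsP; exists w; rewrite wE /=; apply/existsP.
  by exists (Ordinal (KH : K < (H ^ b).+1)); apply/eqP.
have [s hs] : exists s : 'I_I.+1, #|D'| <= I.+1 * #|Ds s|.
  apply/existsP; apply: contraTT (subset_leq_card cov); rewrite negb_exists => /forallP nh.
  rewrite -ltnNge; apply: leq_ltn_trans (_ : \sum_(s < I.+1) #|Ds s| < _).
    elim/big_rec2: _ => [|s k V _ hh]; first by rewrite cards0.
    by apply: leq_trans (leq_card_setU _ _) _; rewrite leq_add2l.
  rewrite -(ltn_pmul2l (ltn0Sn I)) big_distrr /=.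
  have nh' (s : 'I_I.+1) : I.+1 * #|Ds s| < #|D'| by rewrite ltnNge nh.
  have -> : I.+1 * #|D'| = \sum_(i < I.+1) #|D'| by rewrite sum_nat_const card_ord.
  rewrite !big_ord_recl -addSn leq_add //.
  by apply: leq_sum => s _; exact: ltnW.
have sI : s <= I by rewrite -ltnS.
have lps := hlam s sI; have := lps; rewrite mem_primes_in => /and3P[/prime_gt0 l0 _ _].
exists (lam s); split=> //.
have sDs : Ds s \subset D.
  by apply: fintype.subset_trans sD'; apply/fintype.subsetP => d; rewrite inE => /andP[].
have C0 : 0 < C by rewrite /C; lia.
have hw d : d \in Ds s -> exists w K, [/\ w \in E0 (lam s), K <= H ^ b & x d = K * x w].
  rewrite inE => /andP[_ /existsP[w /andP[wE /existsP[K /eqP xd]]]].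
  by exists w, K; split=> //; rewrite -ltnS.
have hu : (2 * #|T| * (H ^ b * C`! * C)).+1 <= 2 ^ u.
  have h : 2 * #|T| * (H ^ b * C`! * C) <= 2 ^ u.-1.
    rewrite (_ : u.-1 = 1 + q + (12 * q * b + C * C + C)); last by rewrite /u; lia.
    rewrite (expnD 2 (1 + q)) (expnD 2 1) (expnD 2 (_ + C * C)) (expnD 2 (12 * q * b)).
    apply: leq_mul; first exact: leq_mul.
    apply: leq_mul; last by apply: ltnW; exact: ltn_expl.
    by apply: leq_mul; [rewrite -expnM | exact: fact_le_exp].
  have -> : u = u.-1.+1 by rewrite /u; lia.
  have p0 : 0 < 2 ^ u.-1 by rewrite expn_gt0.
  have key X A : 0 < A -> X <= A -> X.+1 <= 2 * A by lia.
  rewrite (expnS 2 u.-1); exact: key p0 h.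
have [E [sE dE cE]] := dim_transfer C0 (diss_subset sDs dD1) hw hu.
exists E; split=> //; last by move=> e /(fintype.subsetP sE); rewrite inE.
have p5 : 4 * I.+1 * u <= 2 ^ I.
  case: qlarge => _ _ _ _ _ h _ _; apply: leq_trans gexpI; apply: leq_trans h.
  have uq : u <= (12 * b + 1000) * q ^ 2.
    have C25 : C <= 25 * q by rewrite /C; lia.
    have CC : C * C <= 625 * q ^ 2.
      by apply: leq_trans (leq_mul C25 C25) _; rewrite -mulnn leq_eqVlt; apply/orP; left; apply/eqP; ring.
    have qq : q <= q ^ 2 by rewrite -mulnn leq_pmulr //; lia.
    have bq : 12 * q * b <= 12 * b * q ^ 2.
      by rewrite mulnAC leq_mul2l qq orbT.
    rewrite mulnDl /u; move: (12 * q * b) (12 * b * q ^ 2) (q ^ 2) (C * C) bq qq CC C25 => X Y' Z W; lia.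
  move: (12 * b + 1000) uq => B uq.
  apply: leq_trans (_ : 4 * (2 * q) * (B * q ^ 2) <= _).
    by apply: leq_mul => //; lia.
  by rewrite leq_eqVlt; apply/orP; left; apply/eqP; ring.
have r0 : 0 < r1 by rewrite expn_gt0.
rewrite -(leq_pmul2r r0); apply: leq_trans cD' _.
apply: leq_trans (_ : 4 * 2 ^ q * (I.+1 * (u * #|E|)) <= _).
  by apply: leq_mul; [rewrite leq_mul2l nhi orbT | apply: leq_trans hs _; rewrite leq_mul2l cE orbT].
rewrite (_ : 4 * 2 ^ q * (I.+1 * (u * #|E|)) = 2 ^ q * #|E| * (4 * I.+1 * u)); last by ring.
apply: leq_trans (leq_mul (leqnn _) p5) _.
rewrite (_ : 2 ^ (4 * I) * #|E| * r1 = #|E| * (2 ^ (4 * I) * r1)); last by ring.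
rewrite [2 ^ q * #|E|]mulnC -mulnA leq_mul2l; apply/orP; right.
by rewrite /r1 -!expnD leq_exp2l //; lia.
Qed.

End Spectrum.

Local Open Scope ring_scope.

(** * The gap *)

(** With [a = N / (n * G)] the linear gain is at least [a ^+ 2 * G / 8], and [G >= 16 * (B + 1)]
    keeps the error below half of it. *)
Lemma gap_arithmetic (R : realFieldType) (n N G D P P9 gam c0 F0 S B a tl : R) :
  0 < n -> 0 <= N -> 0 < G -> 0 <= D -> 0 < P9 -> 0 <= B ->
  a * (n * G) = N -> 1 <= gam * n -> gam * n <= 3 ->
  c0 + a * S <= F0 + gam * n * (B * (a / 2) ^+ 2 + tl) ->
  N * (gam / 8) <= S -> tl <= (a / 2) ^+ 2 -> 16 * (B + 1) <= G ->
  D <= P * N -> P ^+ 2 * (16 * G) <= P9 ->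
  c0 + D ^+ 2 / (n ^+ 2 * P9) <= F0.
Proof.
move=> n0 N0 G0 D0 P90 B0 aE glo ghi main gain tail BG DP PP.
have a0 : 0 <= a.
  by rewrite -(pmulr_lge0 a (mulr_gt0 n0 G0)) aE.
have A0 : 0 <= a ^+ 2 by exact: sqr_ge0.
have err : gam * n * (B * (a / 2) ^+ 2 + tl) <= a ^+ 2 * G / 16.
  apply: (@le_trans _ _ (3 * ((B + 1) * (a / 2) ^+ 2))).
    have h : B * (a / 2) ^+ 2 + tl <= (B + 1) * (a / 2) ^+ 2 by lra.
    have h0 : 0 <= (B + 1) * (a / 2) ^+ 2 by rewrite mulr_ge0 ?sqr_ge0 //; lra.
    apply: le_trans (ler_wpM2l _ h) _; first by lra.
    by apply: ler_wpM2r.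
  have -> : 3 * ((B + 1) * (a / 2) ^+ 2) = 3 / 4 * (a ^+ 2 * (B + 1)) by field.
  have h : a ^+ 2 * (16 * (B + 1)) <= a ^+ 2 * G by rewrite ler_wpM2l.
  have h1 : 0 <= a ^+ 2 * G by rewrite mulr_ge0 // ltW.
  have E : a ^+ 2 * (16 * (B + 1)) = 16 * (a ^+ 2 * (B + 1)) by ring.
  lra.
have gS : a ^+ 2 * G / 8 <= a * S.
  apply: le_trans (_ : a * (N * (gam / 8)) <= _); last by rewrite ler_wpM2l.
  rewrite -aE (_ : a * (a * (n * G) * (gam / 8)) = a ^+ 2 * G / 8 * (gam * n)); last by field.
  by rewrite ler_peMr // divr_ge0 // mulr_ge0 // ltW.
have DD : D ^+ 2 / (n ^+ 2 * P9) <= a ^+ 2 * G / 16.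
  rewrite ler_pdivrMr; last by rewrite mulr_gt0 ?exprn_gt0.
  apply: le_trans (_ : (P * N) ^+ 2 <= _).
    by apply: lerXn2r; rewrite ?nnegrE //; apply: le_trans DP.
  rewrite -aE (_ : (P * (a * (n * G))) ^+ 2 = a ^+ 2 * n ^+ 2 * G / 16 * (P ^+ 2 * (16 * G))); last by field.
  rewrite (_ : a ^+ 2 * G / 16 * (n ^+ 2 * P9) = a ^+ 2 * n ^+ 2 * G / 16 * P9); last by field.
  apply: ler_wpM2l => //; apply: divr_ge0 => //.
  by rewrite !mulr_ge0 // ?sqr_ge0 // ltW.
have h1 : 0 <= a ^+ 2 * G by rewrite mulr_ge0 // ltW.
lra.
Qed.

Local Close Scope ring_scope.

Section Gap.
Variables (R : realType) (m Q : nat).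
Hypotheses (m12 : 12 <= m) (Q2 : 2 < Q) (QE : (Q%:R = 2 ^+ 14 :> R)%R).
Let MM := 2 * Q * m.
Let b := (2 * MM).+1.
Variable q : nat.
Hypothesis qlarge : large m Q q.
Let g := step m Q q.
Let I := Q * (2 * g).
Let H := 2 ^ (12 * q).
Variables (T : finType) (x : T -> nat).
Hypotheses (x0 : forall i, 0 < x i) (x_inj : injective x).
Hypotheses (nlo : 2 ^ q.-1 <= #|T|) (nhi : #|T| <= 2 ^ q).
Variables (cf : nat -> R) (gam : R).
Hypothesis cf_large : forall k, H <= k -> cf k = 0%R.
Hypothesis cf_decay : forall k, 0 < k -> (`|cf k| <= k%:R^-1)%R.
Hypothesis cf_ge : forall k, (k%:R * gam <= 1 / 2)%R -> 2 * k <= H -> (gam / 4 <= cf k)%R.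
Hypotheses (glo : (1 <= gam * #|T|%:R)%R) (ghi : (gam * #|T|%:R <= 3)%R).
Variable D : {set T}.
Hypothesis dD : diss (fun i => Posz (x i)) 2 D.
Hypothesis Dlo : 2 ^ q <= #|D| ^ 2.

Let q100 : 100 <= q. Proof. by case: qlarge. Qed.
Let g0 : 0 < g. Proof. by case: qlarge. Qed.
Let gI : g <= I. Proof. rewrite /I; nia. Qed.
Let I12 : 12 * I <= q.
Proof.
case: qlarge => _ _ _ h _ _ _ _; rewrite -/g -/I in h.
by apply: leq_trans h; rewrite mulnC leq_mul2l m12 orbT.
Qed.
Let n0 : 0 < #|T|. Proof. by apply: leq_trans nlo; rewrite expn_gt0. Qed.
Let I3 : 6 <= I. Proof. rewrite /I; nia. Qed.
Let gexpI : 2 ^ g <= 2 ^ I. Proof. by rewrite leq_exp2l. Qed.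

Let C := 24 * q + 7.
Let large_spectrum_ := large_spectrum m12 Q2 QE qlarge x0 x_inj nlo nhi cf_large cf_decay cf_ge glo ghi dD Dlo.

Let J := (26 * MM).+1.
Let Bd := (2 * (C.-1 * J)).+1 ^ J.

Let C2 : 2 <= C. Proof. by rewrite /C addnC. Qed.
Let rC : C.-1 < C. Proof. by rewrite prednK // (leq_trans _ C2). Qed.
Let rX r' : 2 ^ r' <= r' * (2 * H) + 1 -> r' <= C.-1.
Proof. by rewrite /H -expnS => /pow2_linear_bound; rewrite /C; lia. Qed.

Let C30 : C.-1 <= 30 * q. Proof. by rewrite /C; lia. Qed.

Let B1 : 16 * Bd.+1 <= 2 ^ g.
Proof.
case: qlarge => _ _ _ _ _ _ h _; rewrite -/MM -/J -/g in h; apply: leq_trans h.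
have J1 : 0 < J by [].
have h1 : Bd <= (61 * J) ^ J * q ^ J.
  rewrite /Bd -expnMn leq_exp2r //.
  have qJ : 0 < q * J by rewrite muln_gt0 J1 andbT; apply: leq_trans q100.
  apply: leq_trans (_ : (2 * (30 * q * J)).+1 <= _); first by rewrite ltnS leq_mul2l leq_mul2r C30 !orbT.
  rewrite (_ : 2 * (30 * q * J) = 60 * (q * J)); last by rewrite mulnA mulnA mulnA.
  rewrite (_ : 61 * J * q = 61 * (q * J)); last by rewrite -mulnA [J * q]mulnC.
  by move: (q * J) qJ => v; clear; lia.
have h2 : 0 < (61 * J) ^ J * q ^ J.
  by rewrite muln_gt0 !expn_gt0 muln_gt0 J1 /= (leq_trans _ q100).
by rewrite -(mulnA 32); move: ((61 * J) ^ J * q ^ J) h1 h2 => v; move: (Bd) => w; clear; lia.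
Qed.

Let gap0 : 4 + g <= I. Proof. rewrite /I; nia. Qed.

Let H13 : (2 * H).+1 <= 2 ^ (13 * q).
Proof.
apply: leq_trans (_ : 2 ^ (12 * q + 2) <= _); last by rewrite leq_exp2l //; lia.
have H0 : 0 < H by rewrite expn_gt0.
by rewrite expnD -/H; move: (H) H0; clear; lia.
Qed.

Let gJ : 13 * q <= g * (26 * MM).
Proof.
case: qlarge => _ _ h _ _ _ _ _; rewrite -/MM -/g in h.
apply: leq_trans (leq_mul (leqnn 13) h) _.
by rewrite mulnCA leq_mul2l mulnA leqnn orbT.
Qed.

(** This fixes [J]: [a / 2] to the power [26 * MM] is at most [2 ^- (13 * q)], hence at most
    [1 / (2 * H + 1)], and two factors [a / 2] are left. *)
Lemma small_tail (a : R) : (0 <= a)%R -> (a <= (2 ^+ g)^-1)%R ->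
  ((2 * H).+1%:R * (a / 2) ^+ J.+1 <= (a / 2) ^+ 2)%R.
Proof.
move=> a0 aG; have al0 : (0 <= a / 2)%R by rewrite divr_ge0.
rewrite (_ : J.+1 = (26 * MM) + 2)%N; last by rewrite /J addn2.
rewrite exprD mulrA ler_piMl ?exprn_ge0 //.
have h1 : ((a / 2) ^+ (26 * MM) <= (2 ^+ (13 * q))^-1)%R.
  apply: le_trans (_ : ((2 ^+ g)^-1 ^+ (26 * MM) <= _)%R).
    apply: lerXn2r; rewrite ?nnegrE ?invr_ge0 ?exprn_ge0 //.
    by apply: le_trans aG; rewrite ler_pdivrMr // ler_peMr // ler1n.
  by rewrite exprVn lef_pV2 ?posrE ?exprn_gt0 // -exprM ler_weXn2l ?ler1n.
apply: le_trans (ler_wpM2l _ h1) _; first exact: ler0n.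
by rewrite ler_pdivrMr ?exprn_gt0 // mul1r -natrX ler_nat.
Qed.

Hypothesis cf_norm : forall k, (`|cf k| <= gam)%R.
Variable c0 : R.
Hypothesis Hpos : forall (J : finType) (b : J -> R) (nu : J -> int),
  (forall t : R, 0 <= \sum_j b j * cosq ((nu j)%:~R * t))%R ->
  (c0 * \sum_(j | nu j == 0) b j <= \sum_j b j * fourier x H cf `|nu j|%N)%R.

Lemma gap_bound :
  (c0 + #|D|%:R ^+ 2 / (#|T|%:R ^+ 2 * 2 ^+ (9 * I)) <= fourier x H cf 0)%R.
Proof.
have [l [l0 [E [dE cE hE]]]] := large_spectrum_.
have nR : (0 < #|T|%:R :> R)%R by rewrite ltr0n.
have G0 : (0 < 2 ^+ g :> R)%R by rewrite exprn_gt0.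
have nG : (0 < #|T|%:R * 2 ^+ g :> R)%R by rewrite mulr_gt0.
have Nn : (#|E|%:R <= #|T|%:R :> R)%R by rewrite ler_nat max_card.
have [a aE] : exists a : R, (a * (#|T|%:R * 2 ^+ g) = #|E|%:R)%R.
  by exists (#|E|%:R / (#|T|%:R * 2 ^+ g))%R; rewrite divfK // gt_eqF.
have a0 : (0 <= a)%R by rewrite -(pmulr_lge0 a nG) aE ler0n.
have aG : (a <= (2 ^+ g)^-1)%R.
  rewrite -(ler_pM2r nG) aE; apply: le_trans Nn _.
  by rewrite mulrCA mulVf ?gt_eqF // mulr1.
have a1 : (a <= 1)%R.
  by apply: le_trans aG _; rewrite invf_le1 // exprn_ege1 // ler1n.
have dE1 : diss (fun i => Posz (x i)) 1 E by apply: diss_leq dE; apply: ltnW.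
have al01 : (0 <= a / 2 <= 1)%R.
  by rewrite divr_ge0 //= ler_pdivrMr // mul1r; apply: le_trans a1 _; rewrite ler1n.
have a01 : (0 <= a <= 1)%R by rewrite a0.
have err := riesz_error x0 cf_norm J l0 al01 dE rC C2 rX.
have main := le_trans (riesz_bound Hpos l0 a01 dE1) (lerD (lexx _) err).
apply: (gap_arithmetic (P := (2 ^+ (4 * I))%R) nR _ G0 _ _ _ aE glo ghi main).
- exact: ler0n.
- exact: ler0n.
- by rewrite exprn_gt0.
- exact: ler0n.
- rewrite mulr_natl -sumr_const; apply: ler_sum => i iE.
  by apply: le_trans (hE i iE) _; exact: ler_norm.
- exact: small_tail.
- by rewrite natr1 -natrX -natrM ler_nat.
- by rewrite -natrX -natrM ler_nat.
(* The exponent 9 comes from [2 * (4 * I) + 4 + g <= 9 * I]. *)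
- rewrite -exprM (_ : 16 = 2 ^+ 4 :> R)%R; last by rewrite -natrX.
  by rewrite -!exprD ler_weXn2l ?ler1n //; move: gap0; clear; lia.
Qed.
End Gap.

(** * From a cover of the circle to a lower bound for the sum of majorants *)

Section Covering.
Variables (R : realType) (q : nat).
Hypothesis q100 : 100 <= q.
Variables (T : finType) (x : T -> nat).
Hypotheses (x0 : forall i, 0 < x i).
Hypotheses (nlo : 2 ^ q.-1 <= #|T|) (nhi : #|T| <= 2 ^ q).
Variable delta : R.
Hypothesis cover : forall t : R, exists i, (dist_int (t * (x i)%:R) <= delta)%R.
Let n : R := #|T|%:R.
Hypotheses (dlo : (1 <= 2 * n * delta)%R) (dhi : (2 * n * delta <= 2)%R).
Let H := 2 ^ (12 * q).
Let L := 2 ^ (13 * q).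
Let z : R := (2 ^+ q)^-1%R.

Let z0 : (0 < z)%R. Proof. by rewrite invr_gt0 exprn_gt0. Qed.
Let z4 : (z <= 1 / 16)%R.
Proof.
rewrite div1r lef_pV2 ?posrE ?exprn_gt0 //.
rewrite (_ : 16 = 2 ^+ 4 :> R)%R; last by rewrite -natrX.
by rewrite ler_weXn2l ?ler1n //; apply: leq_trans q100.
Qed.
Let nz1 : (n * z <= 1)%R.
Proof. by rewrite ler_pdivrMr ?exprn_gt0 // mul1r -natrX ler_nat. Qed.
Let nz2 : (1 <= 2 * n * z)%R.
Proof.
rewrite ler_pdivlMr ?exprn_gt0 // mul1r -natrX -natrM ler_nat.
by rewrite -(@prednK q) ?(leq_trans _ q100) // expnS leq_pmul2l.
Qed.
Let HE : (H%:R^-1 = z ^+ 12 :> R)%R.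
Proof. by rewrite /H natrX mulnC exprM exprVn. Qed.
Let LE : (L%:R^-1 = z ^+ 13 :> R)%R.
Proof. by rewrite /L natrX mulnC exprM exprVn. Qed.
Let H0 : 0 < H. Proof. by rewrite expn_gt0. Qed.
Let L0 : (0 < L%:R :> R)%R. Proof. by rewrite ltr0n expn_gt0. Qed.
Let HL : 2 * H <= L. Proof. by rewrite -expnS leq_exp2l //; lia. Qed.

(** [M / L] is [delta + z ^+ 4] rounded down to the grid. As [H] is [z ^- 12], the margin [z ^+ 4]
    leaves a Fejer tail of [2 / (H * z ^+ 8) = 2 * z ^+ 4]; it adds at most [3 * z ^+ 4] to the mean
    of one majorant, hence [3 * z ^+ 3] to that of the sum. *)
Lemma majorant_exists : exists M, [/\ 2 * M + 2 <= L,
  (1 <= gam R L M * n)%R, (gam R L M * n <= 2 * n * delta + 3 * z ^+ 3)%R &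
  forall t : R, (1 - 2 * z ^+ 3 <= \sum_i majorant L M H ((x i)%:R * t))%R].
Proof.
have n0 : (0 < n)%R by move: nz2 z0; nra.
have d0 : (0 < delta)%R by move: dlo n0; nra.
have dz : (delta <= 2 * z)%R.
  rewrite -(ler_pM2l n0); move: dhi nz2; lra.
have y0 : (0 <= (delta + z ^+ 4) * L%:R)%R.
  by apply: mulr_ge0; [apply: addr_ge0; [exact: ltW | exact/exprn_ge0/ltW] | exact: ltW].
pose M := Num.truncn ((delta + z ^+ 4) * L%:R)%R; exists M.
have M1 : (M%:R <= (delta + z ^+ 4) * L%:R)%R by rewrite truncn_le.
have M2 : ((delta + z ^+ 4) * L%:R < M.+1%:R)%R by exact: truncnS_gt.
have M1' : (M%:R / L%:R <= delta + z ^+ 4)%R by rewrite ler_pdivrMr.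
have M2' : (delta + z ^+ 4 <= M.+1%:R / L%:R)%R by rewrite ler_pdivlMr // ltW.
have zM k : (z ^+ k.+1 <= z ^+ k / 16)%R.
  by rewrite exprSr; apply: ler_wpM2l; [exact/exprn_ge0/ltW | move: z4; lra].
have zp k : (0 < z ^+ k)%R by exact: exprn_gt0.
have z13 : (z ^+ 13 <= z ^+ 4)%R.
  by apply: ler_wiXn2l => //; [exact: ltW | move: z4; lra].
have z43 : (z ^+ 4 <= z ^+ 3 / 16)%R by exact: zM.
have zz1 : (z ^+ 4 <= z)%R.
  by rewrite -[leRHS]expr1; apply: ler_wiXn2l => //; [exact: ltW | move: z4; lra].
have gE : (gam R L M = 2 * (M%:R / L%:R) + z ^+ 13)%R.
  by rewrite /gam natrD natrM mulrDl -mulrA mul1r LE.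
have gE' : (gam R L M = 2 * (M.+1%:R / L%:R) - z ^+ 13)%R.
  by rewrite gE -natr1 mulrDl mul1r LE; ring.
have nz4 : (n * z ^+ 4 <= z ^+ 3)%R.
  by rewrite exprS mulrA; apply: ler_piMl => //; exact: ltW.
have ML : 2 * M + 2 <= L.
  rewrite -(ler_nat R) natrD natrM -(ler_pM2r (_ : 0 < L%:R^-1)%R) ?invr_gt0 //.
  rewrite divff ?gt_eqF // mulrDl -mulrA; move: M1'; rewrite LE => M1z.
  move: z4 dz zz1 z13 z0 M1z; lra.
split.
- exact: ML.
- have gd : (2 * delta <= gam R L M)%R by move: gE' M2' z13 (zp 4); lra.
  by apply: le_trans dlo _; rewrite mulrAC ler_wpM2r // ltW.
- have h : (gam R L M <= 2 * delta + 3 * z ^+ 4)%R by move: gE M1' z13; lra.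
  have := ler_wpM2r (ltW n0) h; move: nz4; lra.
- move=> t; have [i hi] := cover t.
  rewrite (bigD1 i) //= -[leLHS]addr0; apply: lerD; last by apply: sumr_ge0 => j _; exact: majorant_ge0.
  have h1 : (dist_int ((x i)%:R * t) + z ^+ 4 <= M.+1%:R / L%:R)%R.
    by rewrite mulrC; apply: le_trans M2'; rewrite lerD2r.
  apply: le_trans (majorant_ge H0 HL ML (zp 4) h1).
  have -> : (2 / (H%:R * z ^+ 4 ^+ 2) = 2 * z ^+ 4)%R.
    rewrite invfM HE -exprM (_ : z ^+ 12 = z ^+ 4 * z ^+ (4 * 2))%R; last by rewrite -exprD.
    by rewrite mulfK // gt_eqF.
  by move: z43 (zp 3); lra.
Qed.
End Covering.

Lemma fourier0 (R : realType) (T : finType) (x : T -> nat) H (cf : nat -> R) :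
  0 < H -> (forall i, 0 < x i) -> fourier x H cf 0 = (cf 0 * #|T|%:R)%R.
Proof.
case: H => // H _ x0; rewrite /fourier mulr_natr -sumr_const; apply: eq_bigr => i _.
rewrite (big_pred1 ord0) // => k /=.
by rewrite muln_eq0 (gtn_eqF (x0 i)) orbF.
Qed.

(** In [k * x j = x i] the factor [k] is positive, so minimality forces [x j = x i] and [k = 1]. *)
Lemma fourier_min (R : realType) (T : finType) (x : T -> nat) H (cf : nat -> R) i :
  1 < H -> injective x -> 0 < x i -> (forall j, x i <= x j) ->
  fourier x H cf (x i) = cf 1.
Proof.
case: H => [|[|H]] // _ x_inj xi0 xmin; rewrite /fourier (bigD1 i) //=.
rewrite (big_pred1 (lift ord0 ord0)) => [|k /=]; last first.
  by rewrite -[X in _ == X]mul1n eqn_pmul2r.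
rewrite big1 ?addr0 // => j ji; apply: big_pred0 => k.
apply: contraNF ji => /eqP kE; apply/eqP/x_inj/eqP; rewrite eqn_leq xmin andbT -kE.
by apply: leq_pmull; case: (nat_of_ord k) kE xi0 => // <-.
Qed.

Section Dichotomy.
Variables (R : realType) (m Q : nat).
Hypotheses (m12 : 12 <= m) (Q2 : 2 < Q) (QE : (Q%:R = 2 ^+ 14 :> R)%R).
Variable q : nat.
Hypothesis qlarge : large m Q q.
Variables (T : finType) (x : T -> nat).
Hypotheses (x0 : forall i, 0 < x i) (x_inj : injective x).
Hypotheses (nlo : 2 ^ q.-1 <= #|T|) (nhi : #|T| <= 2 ^ q).
Variable delta : R.
Hypothesis cover : forall t : R, exists i, (dist_int (t * (x i)%:R) <= delta)%R.
Let n : R := #|T|%:R.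
Hypotheses (dlo : (1 <= 2 * n * delta)%R) (dhi : (2 * n * delta <= 2)%R).
Variable D : {set T}.
Hypothesis dD : diss (fun i => Posz (x i)) 2 D.
Let z : R := (2 ^+ q)^-1%R.

(** The first bound tests with [1 - cos] at the smallest [x i], the second with the Riesz product.
    The term [5 * z ^+ 3] collects [3 * z ^+ 3] from the mean and [2 * z ^+ 3] from the lower bound
    of the sum of majorants. *)
Lemma cover_excess : (1 / (4 * n) <= 2 * n * delta - 1 + 5 * z ^+ 3)%R /\
  ((2 ^ q <= #|D| ^ 2)%N -> (#|D|%:R ^+ 2 / (n ^+ 2 * 2 ^+ (9 * (Q * (2 * step m Q q)))) <=
     2 * n * delta - 1 + 5 * z ^+ 3)%R).
Proof.
have q100 : 100 <= q by case: qlarge.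
have [M [ML glo ghi pos]] := majorant_exists q100 nlo nhi cover dlo dhi.
rewrite -/n -/z in glo ghi pos.
set H := 2 ^ (12 * q) in pos; set L := 2 ^ (13 * q) in ML glo ghi pos.
have H0 : 0 < H by rewrite expn_gt0.
have HL : 2 * H <= L by rewrite -expnS leq_exp2l //; lia.
have H2 : 2 <= H by rewrite -[X in X <= _]expn1 leq_exp2l // muln_gt0 /= (leq_trans _ q100).
have Hpos := positivity H0 HL ML x0 pos.
have z1 : (z ^+ 3 <= 1 / 4)%R.
  rewrite div1r exprVn -exprM lef_pV2 ?posrE ?exprn_gt0 //.
  rewrite (_ : 4 = 2 ^+ 2 :> R)%R; last by rewrite -natrX.
  by rewrite ler_weXn2l ?ler1n //; apply: leq_trans (leq_pmulr _ _) => //; apply: leq_trans q100.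
have ghi3 : (gam R L M * n <= 3)%R by move: ghi dhi z1; lra.
have n6 : (6 <= n)%R.
  rewrite /n ler_nat; apply: leq_trans nlo.
  by apply: (@leq_trans (2 ^ 3)) => //; rewrite leq_exp2l // -ltnS prednK; apply: leq_trans q100.
have n0 : (0 < n)%R by apply: lt_le_trans n6.
have F0 := fourier0 (coef R L M H) H0 x0; rewrite (coef0 _ _ _ H0) -/n in F0.
split=> [|Dlo].
  have /card_gt0P[i0 _] : 0 < #|T| by apply: leq_trans nlo; rewrite expn_gt0.
  have [i _ imin] := @arg_minnP T i0 xpredT x isT.
  have := coefficient_le Hpos (x0 i).
  rewrite F0 (fourier_min _ H2 x_inj (x0 i) (fun j => imin j isT)).
  have c1 : (gam R L M / 4 <= coef R L M H 1)%R.
    apply: coef_ge => //; rewrite mul1r -(ler_pM2r n0); move: ghi3 n6; lra.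
  have g1 : (1 / (4 * n) <= gam R L M / 4)%R.
    rewrite ler_pdivrMr ?mulr_gt0 //; move: glo; lra.
  move: ghi c1 g1; lra.
have := gap_bound m12 Q2 QE qlarge x0 x_inj nlo nhi (coef_large R L M (H := H))
  (coef_decay _ H0 HL ML) (coef_ge H0 HL ML) glo ghi3 dD Dlo (coef_norm _ L M H0) Hpos.
rewrite F0 -/n; move: ghi; lra.
Qed.
End Dichotomy.

Local Open Scope fset_scope.

Local Open Scope ring_scope.

(** * Conclusion *)

Lemma dim2_attained (V : {fset int}) :
  exists D, [/\ D `<=` V, dissociated2 D & #|` D| = dim2 V].
Proof.
rewrite /dim2 big_seq_cond; apply: (big_ind (fun k => exists D, [/\ D `<=` V, dissociated2 D & #|` D| = k])).
- by exists fset0; split; [exact: fsub0set | move=> e _ _ d; rewrite inE | exact: cardfs0].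
- by move=> a b ha hb; case: (leqP a b).
- by move=> D; rewrite fpowersetE => /andP[DV /asboolP dD]; exists D.
Qed.

Lemma big_fsub (A : nmodType) (V D : {fset int}) (F : int -> A) : D `<=` V ->
  \sum_(d <- D) F d = \sum_(i in [set i : V | val i \in D]) F (val i).
Proof.
move=> DV; rewrite (eq_bigl (fun i : V => val i \in D)); last by move=> i; rewrite inE.
rewrite -(big_seq_fsetE _ V (fun d => d \in D) F) -big_filter; apply: perm_big.
apply: uniq_perm; rewrite ?filter_uniq ?fset_uniq // => d.
rewrite mem_filter; case dD: (d \in D) => //=.
by rewrite (fsubsetP DV).
Qed.

Lemma dissociated2_diss (V D : {fset int}) : D `<=` V -> (forall v, v \in V -> 0 < v) ->
  dissociated2 D -> diss (fun i : V => `|val i|%N%:Z) 2 [set i : V | val i \in D].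
Proof.
move=> DV V0 dD y y2 ysum s; rewrite inE => sD.
pose e (d : int) : int := if insub d is Some i then y i else 0.
have eE (i : V) : e (val i) = y i by rewrite /e valK.
rewrite -eE; apply: dD => // [d dinD|].
  have dV : d \in V := fsubsetP DV d dinD.
  have := y2 [` dV]; rewrite -eE /=; move: (e d) => v; rewrite !inE.
  by move=> hv; lia.
rewrite (big_fsub (fun d => e d * d) DV) -[RHS]ysum.
by apply: eq_bigr => i _; rewrite eE gtz0_abs // V0 ?fsvalP.
Qed.

(** If [d ^+ 2 * z >= 1], the assumed excess is at most half of the Riesz gain and the other half
    exceeds [5 * z ^+ 3]. Otherwise [d ^+ 2 <= 2 * n], so the assumed excess is at most
    [1 / (8 * n)], half of the gain at the smallest element. *)
Lemma excess_absurd (R : realFieldType) (n z d E X : R) : 0 < n -> 0 < z -> z <= 1 / 16 ->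
  n * z <= 1 -> 1 <= 2 * n * z -> 0 < X -> X * z <= 1 -> 32 <= E -> 4 * X <= E ->
  1 / (4 * n) <= 2 * d ^+ 2 / (n ^+ 2 * E) + 5 * z ^+ 3 ->
  (1 <= d ^+ 2 * z -> d ^+ 2 / (n ^+ 2 * X) <= 2 * d ^+ 2 / (n ^+ 2 * E) + 5 * z ^+ 3) ->
  False.
Proof.
move=> n0 z0 z16 nz1 nz2 X0 Xz E32 EX small big.
have E0 : 0 < E by lra.
have d0 : 0 <= d ^+ 2 := sqr_ge0 d.
have zz : z ^+ 2 <= z / 16 by rewrite expr2; apply: ler_wpM2l; [exact: ltW | lra].
have zz0 : 0 < z ^+ 2 by rewrite exprn_gt0.
have [large_d|small_d] := lerP 1 (d ^+ 2 * z).
- have {big}h := big large_d.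
  have h1 : 2 * d ^+ 2 / (n ^+ 2 * E) <= d ^+ 2 / (n ^+ 2 * X) / 2.
    rewrite (_ : d ^+ 2 / (n ^+ 2 * X) / 2 = 2 * d ^+ 2 / (n ^+ 2 * (4 * X))); last by field; rewrite !gt_eqF.
    apply: ler_wpM2l; first by lra.
    by rewrite lef_pV2 ?posrE ?mulr_gt0 ?exprn_gt0 ?ler_pM2l ?exprn_gt0 //.
  have h2 : d ^+ 2 / (n ^+ 2 * X) <= 10 * z ^+ 3 by lra.
  have {}h2 : d ^+ 2 <= 10 * z ^+ 3 * (n ^+ 2 * X).
    by rewrite -ler_pdivrMr // !mulr_gt0.
  have h3 : d ^+ 2 * z <= 10 * z ^+ 2 * ((n * z) ^+ 2 * X).
    have -> : 10 * z ^+ 2 * ((n * z) ^+ 2 * X) = 10 * z ^+ 3 * (n ^+ 2 * X) * z by ring.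
    by rewrite ler_pM2r.
  have h4 : (n * z) ^+ 2 <= 1 by rewrite exprn_ile1 // mulr_ge0 // ltW.
  have h5 : z ^+ 2 * ((n * z) ^+ 2 * X) <= z ^+ 2 * X.
    by apply: ler_wpM2l; [exact: ltW | rewrite ler_piMl // ltW].
  have h6 : z ^+ 2 * X <= z by rewrite expr2 -mulrA ler_piMr ?(ltW z0) // [_ * X]mulrC.
  lra.
- have h1 : d ^+ 2 <= 2 * n by rewrite -(ler_pM2r z0); lra.
  have h2 : 2 * d ^+ 2 / (n ^+ 2 * E) <= 1 / (8 * n).
    rewrite ler_pdivrMr ?mulr_gt0 ?exprn_gt0 //.
    rewrite (_ : 1 / (8 * n) * (n ^+ 2 * E) = n * E / 8); last by field; rewrite gt_eqF.
    have : n * 32 <= n * E by rewrite ler_pM2l.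
    lra.
  have h3 : 1 / (8 * n) <= 5 * z ^+ 3.
    have : 1 / (4 * n) = 2 * (1 / (8 * n)) by field; rewrite gt_eqF.
    lra.
  have : 1 <= 5 * z ^+ 3 * (8 * n) by rewrite -ler_pdivrMr // mulr_gt0.
  have -> : 5 * z ^+ 3 * (8 * n) = 40 * (z ^+ 2 * (n * z)) by ring.
  have : z ^+ 2 * (n * z) <= z ^+ 2 by rewrite ler_piMr // ltW.
  lra.
Qed.

Lemma exp_le_powR (R : realType) (eps n : R) (k q : nat) : 0 < eps ->
  2 ^+ q <= n -> k%:R <= q%:R * eps -> 2 ^+ k <= n `^ eps.
Proof.
move=> eps0 qn kq; rewrite -powR_mulrn //.
apply: le_trans (ler_powR _ kq) _; first exact: ler1n.
rewrite powRrM powR_mulrn //; apply: ge0_ler_powR => //; rewrite ?nnegrE ?exprn_ge0 //.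
  exact: ltW.
by apply: le_trans qn; rewrite exprn_ge0.
Qed.

Theorem proposition2p3 (R : realType) (eps : R) (heps : 0 < eps) :
  exists n0 : nat, forall n : nat, (n0 <= n)%N ->
    forall V : {fset int}, #|` V| = n -> (forall v : int, v \in V -> 0 < v) ->
      1 / (2 * n%:R) + (dim2 V)%:R ^+ 2 / n%:R `^ (3 + eps) <= ML R V.
Proof.
have nat_above (y : R) : exists k : nat, y <= k%:R.
  by exists (Num.truncn y).+1; exact/ltW/truncnS_gt.
(* With [I * m <= 9 * q] below, [eps * m >= 40] makes [4 * 2 ^+ I] at most [n] to the power
   [eps]. *)
have [m m12 epsm] : exists2 m, (12 <= m)%N & 40 <= eps * m%:R.
  have [k hk] := nat_above (40 / eps); exists (12 + k)%N; first exact: leq_addr.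
  rewrite natrD mulrDr; move: hk; rewrite ler_pdivrMr // mulrC => hk.
  by apply: le_trans hk _; rewrite lerDr mulr_ge0 // ltW.
have [Q QE] : exists Q : nat, Q%:R = 2 ^+ 14 :> R by exists (2 ^ 14)%N; rewrite natrX.
have Q2 : (2 < Q)%N by rewrite -(ltr_nat R) QE -[ltLHS]expr1 ltr_eXn2l // ltr1n.
have [q0 q0P] := eventually_large m12 Q2.
have [q1 q1P] := nat_above (20 / eps).
exists (2 ^ maxn q0 q1)%N => n n_large V Vn V0.
have n_gt0 : (0 < n)%N by apply: leq_trans n_large; rewrite expn_gt0.
have [q [qlo nlo nhi]] : exists q, [/\ (maxn q0 q1 <= q.-1)%N, (2 ^ q.-1 <= n)%N & (n <= 2 ^ q)%N].
  have /andP[h1 h2] := trunc_log_bounds (isT : (1 < 2)%N) n_gt0.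
  by exists (trunc_log 2 n).+1; split=> //=; [exact: trunc_log_max | exact: ltnW].
move: qlo; rewrite geq_max => /andP[qq0 qq1].
have qlarge : large m Q q by apply: q0P; apply: leq_trans qq0 (leq_pred q).
have q100 : (100 <= q)%N by case: qlarge.
have qE : (q = q.-1.+1)%N by rewrite prednK // (leq_trans _ q100).
set I := (9 * (Q * (2 * step m Q q)))%N.
have Im : (I * m <= 9 * q)%N by rewrite /I -mulnA leq_pmul2l //; case: qlarge.
have Iq : (I <= q)%N.
  have : (I * 12 <= I * m)%N by rewrite leq_mul2l m12 orbT.
  by move: Im; clear; lia.
have Ieps : I%:R * 40 <= 9 * (q%:R * eps).
  apply: le_trans (_ : I%:R * (eps * m%:R) <= _); first by rewrite ler_wpM2l.
  by rewrite mulrCA -natrM mulrA -natrM mulrC ler_pM2r // ler_nat.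
have qeps : 20 <= q.-1%:R * eps.
  rewrite -ler_pdivrMr //; apply: le_trans q1P _; by rewrite ler_nat.
have q1eps : q%:R * eps <= 2 * (q.-1%:R * eps).
  by rewrite mulrA ler_pM2r // -natrM ler_nat; lia.
have nR : 2 ^+ q.-1 <= n%:R :> R by rewrite -natrX ler_nat.
have n0 : (0 : R) < n%:R by rewrite ltr0n.
pose E := n%:R `^ eps.
have E5 : 32 <= E.
  rewrite (_ : 32 = 2 ^+ 5); last by rewrite -natrX.
  by apply: exp_le_powR heps nR _ => //; lra.
have EI : 4 * 2 ^+ I <= E.
  rewrite (_ : 4 = 2 ^+ 2); last by rewrite -natrX.
  by rewrite -exprD; apply: exp_le_powR heps nR _ => //; rewrite natrD; lra.
have E0 : 0 < E by apply: lt_le_trans E5.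
rewrite powRD; last by apply/implyP => _; rewrite gt_eqF.
rewrite powR_mulrn ?ler0n // -/E.
set delta := _ + _; rewrite leNgt; apply/negP => MLlt.
have [D [DV dD dimE]] := dim2_attained V.
have Vneq0 : V != fset0 by rewrite -cardfs_gt0 Vn.
have card_V : #|{: V}| = n by rewrite -cardfE.
pose x (i : V) : nat := `|val i|%N.
have x0 i : (0 < x i)%N by rewrite absz_gt0 gt_eqF // V0 ?fsvalP.
have xE i : Posz (x i) = val i by rewrite gtz0_abs // V0 ?fsvalP.
have x_inj : injective x by move=> i j h; apply: val_inj; rewrite -!xE h.
have cover (t : R) : exists i, dist_int (t * (x i)%:R) <= delta.
  have [v vV vE] := min_dist_min t Vneq0; exists [` vV].
  have -> : (x [` vV])%:R = v%:~R :> R by rewrite -[v in RHS](xE [` vV]).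
  rewrite -vE; have [_ _ tmax] := ML_max R Vneq0.
  exact: le_trans (tmax t) (ltW MLlt).
pose D' := [set i : V | val i \in D].
have cD : #|D'| = dim2 V.
  rewrite -dimE -sum1_card; apply: etrans (esym (big_fsub (fun=> 1%N) DV)) _.
  by elim: (enum_fset D) => [|d s IH]; rewrite ?big_nil ?big_cons //= -IH.
have dD' : diss (fun i => Posz (x i)) 2 D' by exact: dissociated2_diss.
have dn : (dim2 V)%:R <= n%:R :> R by rewrite ler_nat -dimE -Vn fsubset_leq_card.
have deltaE : 2 * n%:R * delta - 1 = 2 * (dim2 V)%:R ^+ 2 / (n%:R ^+ 2 * E).
  by rewrite /delta; field; rewrite !gt_eqF.
have dlo : 1 <= 2 * #|{: V}|%:R * delta.
  rewrite card_V -subr_ge0 deltaE divr_ge0 ?mulr_ge0 ?exprn_ge0 //; exact: ltW.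
have dhi : 2 * #|{: V}|%:R * delta <= 2.
  rewrite card_V -lerBlDr in dlo *.
  have -> : 2 * n%:R * delta = 1 + 2 * (dim2 V)%:R ^+ 2 / (n%:R ^+ 2 * E) by rewrite -deltaE; ring.
  have : 2 * (dim2 V)%:R ^+ 2 / (n%:R ^+ 2 * E) <= 1.
    rewrite ler_pdivrMr ?mulr_gt0 ?exprn_gt0 // mul1r mulrC; apply: ler_pM => //; last by lra.
    by apply: lerXn2r; rewrite ?nnegrE.
  lra.
rewrite -card_V in nlo nhi.
have [small big] := cover_excess m12 Q2 QE qlarge x0 x_inj nlo nhi cover dlo dhi dD'.
rewrite card_V cD deltaE in small big nlo nhi.
pose z : R := (2 ^+ q)^-1; rewrite -/z in small big.
have z0 : 0 < z by rewrite invr_gt0 exprn_gt0.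
have p0 k : 0 < 2 ^+ k :> R by exact: exprn_gt0.
apply: (excess_absurd n0 z0 _ _ _ (p0 I) _ E5 EI small).
- rewrite div1r lef_pV2 ?posrE // (_ : 16 = 2 ^+ 4); last by rewrite -natrX.
  by rewrite ler_weXn2l ?ler1n // (leq_trans _ q100).
- by rewrite ler_pdivrMr // mul1r -natrX ler_nat.
- by rewrite ler_pdivlMr // mul1r qE exprS ler_pM2l.
- by rewrite ler_pdivrMr // mul1r ler_weXn2l ?ler1n.
move=> dbig; apply: big; rewrite -(ler_nat R) !natrX.
by move: dbig; rewrite ler_pdivlMr // mul1r.
Qed.
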